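(* Let $\mathcal{A}$ be a real $n_1\times n_2\times n_3$ tensor, let $k\ge1$ be an integer (the target truncation term), let $p\ge2$ be an integer (the oversampling parameter), let $\mathbf{q}=(q_1,\dots,q_{n_3})$ be a vector of nonnegative integers (the iteration counts), and let $\mathcal{W}$ be an $n_2\times(k+p)\times n_3$ Gaussian random tensor. For each $i$ let $\hat\sigma_1^{(i)}\ge\hat\sigma_2^{(i)}\ge\cdots$ be the singular values of the $i$-th Fourier-domain frontal slice $\hat{\mathcal{A}}^{(i)}$, and assume that $\hat\sigma_k^{(i)}>0$ and that the singular value gap $\tau_k^{(i)}:=\hat\sigma_{k+1}^{(i)}/\hat\sigma_k^{(i)}$ satisfies $\tau_k^{(i)}<1$. Let $\mathcal{Q}$ be obtained from the slicewise randomized subspace iteration in the Fourier domain with iteration counts $\mathbf{q}$ and starting tensor $\mathcal{W}$. Let $0<\delta<1$ and define $$C_\delta=\frac{e\sqrt{k+p}}{p+1}\left(\frac{2}{\delta}\right)^{\frac{1}{p+1}}\left(\sqrt{n_2-k}+\sqrt{k+p}+\sqrt{2\log\frac{2}{\delta}}\right).$$ Then, with probability at least $1-\delta$, $$\|\mathcal{A}-\mathcal{Q}\ast\mathcal{Q}^{\rm T}\ast\mathcal{A}\|_{\rm F}^2\;\le\;\frac{1}{n_3}\sum_{i=1}^{n_3}\left(1+C_\delta^2\big(\tau_k^{(i)}\big)^{4q_i}\right)\left(\sum_{j=k+1}^{\min\{n_1,n_2\}}\big(\hat\sigma_j^{(i)}\big)^2\right).$$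
   Context: For a third-order tensor $\mathcal{A}$ of size $n_1\times n_2\times n_3$, $\mathcal{A}^{(i)}=\mathcal{A}(:,:,i)$ is its $i$-th frontal slice, and $\|\mathcal{A}\|_{\rm F}$ is the square root of the sum of the squared absolute values of all entries. $\hat{\mathcal{A}}$ denotes the tensor obtained by applying the (unnormalized) discrete Fourier transform of length $n_3$ to every tube $\mathcal{A}(i,j,:)$, and $\hat{\mathcal{A}}^{(i)}$ its $i$-th frontal slice. By convention $\hat\sigma_j^{(i)}=0$ for $j>\min\{n_1,n_2\}$. t-product: for $\mathcal{A}$ of size $n_1\times n_2\times n_3$ and $\mathcal{B}$ of size $n_2\times n_4\times n_3$, $\mathcal{C}=\mathcal{A}\ast\mathcal{B}$ is the $n_1\times n_4\times n_3$ tensor with tubes $\mathcal{C}(i,j,:)=\sum_{l=1}^{n_2}\mathcal{A}(i,l,:)\circ\mathcal{B}(l,j,:)$, where $\circ$ is circular convolution; equivalently $\hat{\mathcal{C}}^{(i)}=\hat{\mathcal{A}}^{(i)}\hat{\mathcal{B}}^{(i)}$ for all $i$. Transpose: for real $\mathcal{A}$, $\mathcal{A}^{\rm T}$ is the $n_2\times n_1\times n_3$ tensor obtained by transposing each frontal slice and then reversing the order of the transposed slices $2,\dots,n_3$; equivalently, its Fourier slices are the conjugate transposes $(\hat{\mathcal{A}}^{(i)})^{\rm H}$. The Fourier-slice description is taken as the definition of $\mathcal{Q}^{\rm T}$ in general, so that $\mathcal{Q}\ast\mathcal{Q}^{\rm T}\ast\mathcal{A}$ has Fourier slices $\hat{\mathcal{Q}}^{(i)}(\hat{\mathcal{Q}}^{(i)})^{\rm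 H}\hat{\mathcal{A}}^{(i)}$. Gaussian random tensor: the entries of the first frontal slice $\mathcal{W}^{(1)}$ are independent standard normal random variables and all other frontal slices are zero; hence every $\hat{\mathcal{W}}^{(i)}$ equals $\mathcal{W}^{(1)}$. Slicewise randomized subspace iteration: for each $i=1,\dots,n_3$, compute a thin QR factorization of $\hat{\mathcal{A}}^{(i)}\hat{\mathcal{W}}^{(i)}$, with orthonormal factor $\hat{\mathcal{Q}}_0^{(i)}$; for $j=1,\dots,q_i$, let $\hat{\mathcal{G}}_j^{(i)}$ be the orthonormal factor of a thin QR factorization of $(\hat{\mathcal{A}}^{(i)})^{\rm H}\hat{\mathcal{Q}}_{j-1}^{(i)}$ and let $\hat{\mathcal{Q}}_j^{(i)}$ be the orthonormal factor of a thin QR factorization of $\hat{\mathcal{A}}^{(i)}\hat{\mathcal{G}}_j^{(i)}$. Set $\hat{\mathcal{Q}}^{(i)}=\hat{\mathcal{Q}}_{q_i}^{(i)}$, and let $\mathcal{Q}$ be the inverse discrete Fourier transform along the third dimension of the tensor with frontal slices $\hat{\mathcal{Q}}^{(i)}$. *)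

(* Defs.v *)
From mathcomp Require Import all_boot all_order all_algebra.
From mathcomp Require Import complex.
From mathcomp Require Import all_classical all_reals all_analysis.

Set Implicit Arguments.
Unset Strict Implicit.
Unset Printing Implicit Defensive.

Import Order.TTheory GRing.Theory Num.Theory.

Local Open Scope classical_set_scope.
Local Open Scope complex_scope.
Local Open Scope sesquilinear_scope.
Local Open Scope ring_scope.

(* A third-order tensor is the family of its frontal slices, so that the entry
   A(a, b, t) is [A t a b]; all indices start from 0. *)
Definition tensor (K : Type) (n1 n2 n3 : nat) :=
  {ffun 'I_n3 -> 'M[K]_(n1, n2)}.

Definition tube (K : Type) (n1 n2 n3 : nat) (A : tensor K n1 n2 n3)
    (a : 'I_n1) (b : 'I_n2) : 'I_n3 -> K :=
  fun t => A t a b.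

Definition circ_conv (K : pzRingType) (n : nat) (x y : 'I_n -> K) : 'I_n -> K :=
  fun t => \sum_(r < n) \sum_(s < n | ((r + s) %% n)%N == t) x r * y s.

Definition tprod (K : pzRingType) (n1 n2 n3 n4 : nat)
    (A : tensor K n1 n2 n3) (B : tensor K n2 n4 n3) : tensor K n1 n4 n3 :=
  [ffun t => \matrix_(a, b)
     \sum_(l < n2) circ_conv (tube A a l) (tube B l b) t].

Definition tensorC (R : rcfType) (n1 n2 n3 : nat) (A : tensor R n1 n2 n3) :
    tensor R[i] n1 n2 n3 :=
  [ffun t => map_mx (real_complex R) (A t)].

Definition frob (R : rcfType) (n1 n2 n3 : nat) (A : tensor R[i] n1 n2 n3) : R :=
  Num.sqrt (\sum_(t < n3) \sum_(a < n1) \sum_(b < n2)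
    ComplexField.Normc.normc (A t a b) ^+ 2).

(* exp (- 2 pi i / n) *)
Definition dft_root (R : realType) (n : nat) : R[i] :=
  cos (2 * pi / n%:R) -i* sin (2 * pi / n%:R).

Definition dft (R : realType) (n1 n2 n3 : nat) (A : tensor R[i] n1 n2 n3) :
    tensor R[i] n1 n2 n3 :=
  [ffun i : 'I_n3 => \sum_(t < n3) dft_root R n3 ^+ (i * t) *: A t].

Definition idft (R : realType) (n1 n2 n3 : nat) (A : tensor R[i] n1 n2 n3) :
    tensor R[i] n1 n2 n3 :=
  [ffun t : 'I_n3 =>
     n3%:R^-1 *: \sum_(i < n3) dft_root R n3 ^- (i * t) *: A i].

(* The tensor whose Fourier slices are the conjugate transposes of those of A;
   for a real A this transposes each frontal slice and reverses the order of
   all but the first. *)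
Definition ttr (R : realType) (n1 n2 n3 : nat) (A : tensor R[i] n1 n2 n3) :
    tensor R[i] n2 n1 n3 :=
  idft [ffun i : 'I_n3 => (dft A i) ^t*].

(* s 1 >= s 2 >= ... are the singular values of X, continued by 0 beyond
   min(m, n).  The numbering starts from 1; s 0 is irrelevant. *)
Definition singular_values (R : rcfType) (m n : nat) (X : 'M[R[i]]_(m, n))
    (s : nat -> R) : Prop :=
  [/\ forall j, (0 < j)%N -> 0 <= s j.+1 <= s j,
      forall j, (minn m n < j)%N -> s j = 0
    & exists (U : 'M[R[i]]_m) (V : 'M[R[i]]_n),
      [/\ U \is unitarymx, V \is unitarymx
        & X = U *m (\matrix_(a < m, b < n)
                      (if a == b :> nat then (s a.+1)%:C else 0)) *m V ^t*]].

(* Q is the orthonormal factor of some thin QR factorization of X.  Such a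
   factorization always exists, and is not unique if X is rank-deficient.
   [is_trig_mx] means lower triangular. *)
Definition thin_qr_factor (R : rcfType) (m n : nat) (X : 'M[R[i]]_(m, n))
    (Q : 'M[R[i]]_(m, minn m n)) : Prop :=
  Q ^t* *m Q = 1%:M /\
  exists T : 'M[R[i]]_(minn m n, n), is_trig_mx T^T /\ X = Q *m T.

(* [subspace_iter X W j Q] : Q may be the orthonormal factor obtained after j
   iterations for the matrix X and the starting matrix W.  The number c of
   columns of Q is l as soon as l <= min(m, n). *)
Inductive subspace_iter (R : rcfType) (m n l : nat)
    (X : 'M[R[i]]_(m, n)) (W : 'M[R[i]]_(n, l)) :
    nat -> forall c : nat, 'M[R[i]]_(m, c) -> Prop :=
| SubspaceIter0 (Q : 'M[R[i]]_(m, minn m l)) :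
    thin_qr_factor (X *m W) Q -> subspace_iter X W 0 Q
| SubspaceIterS (j c : nat) (Q : 'M[R[i]]_(m, c))
    (G : 'M[R[i]]_(n, minn n c)) (Q' : 'M[R[i]]_(m, minn m (minn n c))) :
    subspace_iter X W j Q ->
    thin_qr_factor (X ^t* *m Q) G ->
    thin_qr_factor (X *m G) Q' ->
    subspace_iter X W j.+1 Q'.

(* Q may be the tensor computed by the slicewise randomized subspace iteration
   with iteration counts q and starting tensor W.  If l > min(n1, n2), thin QR
   factors can have c < l columns, with c depending on the slice; they are then
   completed by zero columns ([Qi *m pid_mx c] is Qi followed by l - c zero
   columns), which does not change Q * Q^T. *)
Definition slicewise_rsi (R : realType) (n1 n2 n3 l : nat)
    (A : tensor R n1 n2 n3) (W : tensor R n2 l n3) (q : 'I_n3 -> nat)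
    (Q : tensor R[i] n1 l n3) : Prop :=
  exists Qhat : tensor R[i] n1 l n3,
    (forall i : 'I_n3, exists (c : nat) (Qi : 'M[R[i]]_(n1, c)),
       subspace_iter (dft (tensorC A) i) (dft (tensorC W) i) (q i) Qi /\
       Qhat i = Qi *m pid_mx c) /\
    Q = idft Qhat.

Definition mutually_independent (d : measure_display) (T : measurableType d)
    (R : realType) (P : probability T R) (I : finType)
    (X : I -> {RV P >-> R}) : Prop :=
  forall (J : {set I}) (B : I -> set R),
    (forall i, i \in J -> measurable (B i)) ->
    P [set w | forall i, i \in J -> B i (X i w)] =
    (\prod_(i in J) P (X i @^-1` B i))%E.

Definition standard_normal (d : measure_display) (T : measurableType d)
    (R : realType) (P : probability T R) (X : {RV P >-> R}) : Prop :=
  forall B : set R, measurable B ->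
    distribution P X B = normal_prob (0 : R) 1 B.

Definition gaussian_tensor (d : measure_display) (T : measurableType d)
    (R : realType) (P : probability T R) (n1 n2 n3 : nat)
    (W : T -> tensor R n1 n2 n3) : Prop :=
  exists g : 'I_n1 * 'I_n2 -> {RV P >-> R},
    [/\ mutually_independent g,
        forall ab, standard_normal (g ab)
      & forall w (t : 'I_n3) a b,
          W w t a b = if t == 0%N :> nat then g (a, b) w else 0].

(* "S holds with probability at least r", for an S which need not be measurable
   (the QR factors may depend on the sample point in a non-measurable way). *)
Definition prob_ge (d : measure_display) (T : measurableType d)
    (R : realType) (P : probability T R) (r : R) (S : set T) : Prop :=
  exists E : set T, [/\ measurable E, E `<=` S & (r%:E <= P E)%E].

Lemma prob_geE (d : measure_display) (T : measurableType d) (R : realType)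
    (P : probability T R) (r : R) (S : set T) :
  measurable S -> prob_ge P r S <-> (r%:E <= P S)%E.
Proof.
move=> mS; split=> [[E [mE ES rE]]|rS]; last by exists S; split.
by apply: le_trans rE _; apply: le_measure; rewrite ?inE.
Qed.

Definition C_delta (R : realType) (n2 k p : nat) (delta : R) : R :=
  expR 1 * Num.sqrt (k + p)%:R / p.+1%:R * (2 / delta) `^ (p.+1%:R^-1) *
  (Num.sqrt (n2%:R - k%:R) + Num.sqrt (k + p)%:R + Num.sqrt (2 * ln (2 / delta))).

(* Main.v *)
(* Fix a Fourier slice X = U diag(s) V^H, let V1 consist of the first k columns
   of V, and put O = V1^H W.  If O O^H is regular, the range of Q contains that
   of X (X^H X)^q W O^H (O O^H)^-1, and comparing Q Q^H X with a suitable matrix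
   of that range bounds the squared error of the slice by
     sum_(a >= k) s_a^2 (1 + tau^(4 q) |xi_a|^2),
   where xi_a = v_a^H W O^H (O O^H)^-1.  By Parseval's identity only one weighted
   average of the 1 + |xi_a|^2 over all slices has to be bounded, so that no
   union bound over the slices is needed.

   If w is a fresh gaussian column, then the expectation over w of the excess
   (|r_a|^2 - t)_+ of r_a = (v_a^H - xi_a V1^H) w is at least s e^(-t / s) for
   s = 1 + |xi_a|^2, hence at least an affine function of s.  By Markov's
   inequality it remains to bound E (|r_a|^2 - t)_+ for a single a.  Now [W w]
   is a gaussian matrix with one more column, and
     |r_a|^2 <= |v_a^H [W w]|^2 / (3 u^H N u),
   where u is the last unit vector and N differs by a rank-one term from the
   projector onto the kernel of V1^H [W w].  Bounding the excess by an integral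
   of exponentials in u^H N u, and replacing u by a random gaussian direction,
   which rotation invariance allows, gives determinants of 1 + s N, which are of
   order s^(p + 1), and a moment of |v_a^H [W w]|^2. *)

Require Import Defs.
From HB Require Import structures.
From mathcomp Require Import all_boot all_order all_algebra.
From mathcomp Require Import complex.
From mathcomp Require Import all_classical all_reals all_analysis.
From mathcomp Require Import measurable_realfun.
From mathcomp Require Import ring lra.

Set Implicit Arguments.
Unset Strict Implicit.
Unset Printing Implicit Defensive.

Import Order.TTheory GRing.Theory Num.Theory.
Import numFieldNormedType.Exports.

Local Open Scope classical_set_scope.
Local Open Scope ring_scope.

(** * Gaussian vectors *)

(** The starting matrix is real while the Fourier slices are complex. What survives is invariance
    under real rotations of the columns of [W], acting from the right, together with determinant
    bounds for real gaussian integrals of complex Hermitian forms, which are inequalities because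
    squares of imaginary parts are discarded. The tilt serves the constant. For the projector H
    itself, Cauchy-Schwarz gives |r|^2 <= |v^H [W w]|^2 / (u^H H u). Tilting puts 3 N in place of H
    in the exponent, at the price of a factor 4 in the determinant, hence 2 after the square root.
    With this gain of 3 the last numerical requirement is 8/3 <= e. The free parameters m / 2 in
    [Bt] and m / 2 - 1 in [bad_prob], for m = p + 1, minimise the respective bounds, and the power m
    of the bound turns (2 / delta)^(1 / (p + 1)) into 2 / delta. *)

Notation gam R := (normal_prob (0 : R) 1).

Section cylinders.
Context {R : realType}.

Definition rect (I : finType) (B : I -> set R) : set (I -> R) :=
  [set f | forall i, B i (f i)].

Definition rectangles (I : finType) : set_system (I -> R) :=
  [set A | exists2 B : I -> set R, (forall i, measurable (B i)) & A = rect B].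

Arguments rectangles : clear implicits.
Local Notation vect I := (g_sigma_algebraType (rectangles I)).

Lemma rectangles_setI (I : finType) : setI_closed (rectangles I).
Proof.
move=> _ _ [B mB ->] [C mC ->]; exists (fun i => B i `&` C i).
  by move=> i; exact: measurableI.
by apply/seteqP; split=> [f [fB fC] i|f fBC]; split=> // i; case: (fBC i).
Qed.

Lemma measurable_rect (I : finType) (B : I -> set R) :
  (forall i, measurable (B i)) -> measurable (rect B : set (vect I)).
Proof. by move=> mB; apply: sub_sigma_algebra; exists B. Qed.

Lemma measurable_coord (I : finType) (i : I) :
  measurable_fun setT (fun f : vect I => f i).
Proof.
move=> _ Y mY; rewrite setTI; apply: sub_sigma_algebra.
exists (fun j => if j == i then Y else setT).
  by move=> j; case: ifP.
apply/seteqP; split=> f /=; first by move=> Yf j; case: eqP => // ->.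
by move=> /(_ i); rewrite eqxx.
Qed.

Lemma measurable_vect d (T : measurableType d) (I : finType) (F : T -> vect I) :
  (forall i, measurable_fun setT (fun x => F x i)) -> measurable_fun setT F.
Proof.
move=> mF; apply: (@measurability _ _ T (vect I) setT F (rectangles I)) => //.
move=> _ [_ [B mB ->] <-]; rewrite setTI.
have -> : F @^-1` rect B = \big[setI/setT]_(i in I) ((fun x => F x i) @^-1` B i).
  rewrite -bigcap_seq; apply/seteqP; split=> x /=.
    by move=> Fx i _; exact: Fx.
  by move=> Fx i; apply: (Fx i); rewrite /= mem_index_enum.
apply: bigsetI_measurable => i _.
by rewrite -[X in measurable X]setTI; exact: mF.
Qed.

(** A standard gaussian vector is a map on an arbitrary probability space whose law is prescribed on
    rectangles only. Adjoining independent coordinates then amounts to passing to a product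
    space. *)
Definition gauss_map d (T : measurableType d) (P : probability T R)
    (I : finType) (F : T -> vect I) :=
  measurable_fun setT F /\
  forall B : I -> set R, (forall i, measurable (B i)) ->
    P (F @^-1` rect B) = (\prod_(i in I) gam R (B i))%E.

(** Rectangles form a pi-system generating the sigma-algebra, so [gauss_map] determines the law.
    Inside an expectation a gaussian vector may thus be exchanged for a rotated copy or for one on a
    product space. *)
Lemma gauss_law d (T : measurableType d) (P : probability T R)
    d' (T' : measurableType d') (P' : probability T' R)
    (I : finType) (F : T -> vect I) (F' : T' -> vect I) (f : vect I -> \bar R) :
  gauss_map P F -> gauss_map P' F' ->
  measurable_fun setT f -> (forall x, (0 <= f x)%E) ->
  (\int[P]_x f (F x) = \int[P']_x f (F' x))%E.
Proof.
move=> [mF PF] [mF' PF'] mf f0.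
pose X : {mfun T >-> vect I} := HB.pack F (isMeasurableFun.Build _ _ _ _ _ mF).
pose X' : {mfun T' >-> vect I} :=
  HB.pack F' (isMeasurableFun.Build _ _ _ _ _ mF').
have := @ge0_integral_distribution _ _ _ _ _ P X _ mf f0.
have := @ge0_integral_distribution _ _ _ _ _ P' X' _ mf f0.
rewrite /comp /= => <- <-.
apply: eq_measure_integral => A mA _.
apply: (@measure_unique _ R (vect I) (rectangles I) (fun=> setT)) => //.
- exact: rectangles_setI.
- by move=> _; exists (fun=> setT) => //; apply/seteqP; split.
- by rewrite bigcup_const.
- by move=> _ [B mB ->]; rewrite /= /distribution /pushforward /= PF// PF'.
- by move=> _; rewrite (le_lt_trans (probability_le1 _ _))// ltry.
Qed.

End cylinders.

Notation vect R I := (g_sigma_algebraType (@rectangles R I)).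

Section gauss_constructions.
Context {R : realType}.
Local Notation vect I := (vect R I).

(** Reindexing and passing to marginals in one: a rectangle over J pulls back along the injection to
    one over I whose sides outside the image are [setT], of mass 1. *)
Lemma gauss_sub d (T : measurableType d) (P : probability T R)
    (I J : finType) (e : J -> I) (F : T -> vect I) (G : T -> vect J) :
  injective e -> (forall x j, G x j = F x (e j)) ->
  gauss_map P F -> gauss_map P G.
Proof.
move=> einj GF [mF PF]; split.
  apply: measurable_vect => j.
  rewrite (_ : (fun x => _) = (fun f : vect I => f (e j)) \o F).
    by apply: measurableT_comp => //; exact: measurable_coord.
  by apply/funext => x; rewrite /= GF.
move=> B mB.
pose C i : set R := if [pick j | e j == i] is Some j then B j else setT.
have Ce j : C (e j) = B j.
  rewrite /C; case: pickP => [j' /eqP /einj -> //|/(_ j)].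
  by rewrite eqxx.
have -> : G @^-1` rect B = F @^-1` rect C.
  apply/seteqP; split=> x /= BG => [i|j]; last by rewrite GF -Ce.
  rewrite /C; case: pickP => [j /eqP ji|//].
  by rewrite -ji -GF.
rewrite PF; last by move=> i; rewrite /C; case: pickP.
rewrite (bigID (fun i => i \in e @: [set: J]%SET))/=.
rewrite [X in (_ * X)%E]big1 ?mule1; last first.
  move=> i /negP iN; rewrite /C; case: pickP => [j /eqP ji|_].
    by case: iN; rewrite -ji imset_f ?inE.
  exact: probability_setT.
rewrite big_imset/=; last by move=> ? ? _ _; exact: einj.
by apply: eq_big => [j|j _]; [rewrite inE|rewrite Ce].
Qed.

Lemma gauss_join d1 d2 (T1 : measurableType d1) (T2 : measurableType d2)
    (P1 : probability T1 R) (P2 : probability T2 R)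
    (I1 I2 : finType) (F1 : T1 -> vect I1) (F2 : T2 -> vect I2) :
  gauss_map P1 F1 -> gauss_map P2 F2 ->
  gauss_map (P1 \x P2)%E (fun z => (fun i : I1 + I2 =>
    match i with inl i => F1 z.1 i | inr i => F2 z.2 i end) : vect _).
Proof.
move=> [mF1 PF1] [mF2 PF2]; split.
  apply: measurable_vect => -[i|i].
    rewrite (_ : (fun x => _) = (fun f : vect I1 => f i) \o F1 \o fst)//.
    apply: measurableT_comp => //; apply: measurableT_comp => //.
    exact: measurable_coord.
  rewrite (_ : (fun x => _) = (fun f : vect I2 => f i) \o F2 \o snd)//.
  apply: measurableT_comp => //; apply: measurableT_comp => //.
  exact: measurable_coord.
move=> B mB.
rewrite big_sumType/= -PF1// -PF2// -product_measure1E; first last.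
- rewrite -[X in measurable X]setTI; apply: mF2 => //.
  exact: measurable_rect.
- rewrite -[X in measurable X]setTI; apply: mF1 => //.
  exact: measurable_rect.
congr (_ _); apply/seteqP; split=> -[x y]/=.
  by move=> BF; split=> i; [exact: (BF (inl i))|exact: (BF (inr i))].
by move=> [BF1 BF2] [i|i]; [exact: BF1|exact: BF2].
Qed.

Lemma gauss_normal (I : finType) : #|I| = 1%N ->
  gauss_map (gam R) (fun x => (fun _ : I => x) : vect I).
Proof.
move=> I1; split; first by apply: measurable_vect => i; exact: measurable_id.
move=> B mB; have [i0 Ii0] := fintype1 I1.
rewrite (bigD1 i0)//= big1 ?mule1; last by move=> i; rewrite (Ii0 i) eqxx.
congr (_ _); apply/seteqP; split=> x /=; first exact.
by move=> Bx i; rewrite (Ii0 i).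
Qed.

Lemma gauss_exists (I : finType) :
  exists (d : measure_display) (T : measurableType d) (P : probability T R)
    (F : T -> vect I), gauss_map P F.
Proof.
suff H n : exists (d : measure_display) (T : measurableType d)
    (P : probability T R) (F : T -> vect 'I_n), gauss_map P F.
  have [d [T [P [F gF]]]] := H #|I|.
  exists d, T, P, (fun x i => F x (enum_rank i)).
  exact: (gauss_sub (@enum_rank_inj I) _ gF).
elim: n => [|n [d [T [P [F gF]]]]].
  exists _, _, (gam R), (fun _ _ => 0); split.
    by apply: measurable_vect => -[].
  move=> B mB; rewrite big1 => [|[]//].
  rewrite -[RHS](probability_setT (gam R)); congr (_ _).
  by apply/seteqP; split=> // x _ [].
have g1 := @gauss_normal unit card_unit.
have := gauss_join g1 gF => /(gauss_sub _)H.
exists _, _, (gam R \x P)%E, (fun z (i : 'I_n.+1) =>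
  if unlift ord0 i is Some j then F z.2 j else z.1).
apply: (H _ (fun i => if unlift ord0 i is Some j then inr j else inl tt)).
  move=> i j; case: unliftP => [i' ->|->]; case: unliftP => [j' ->|->] //.
  by case=> ->.
by move=> z i; case: unliftP.
Qed.

End gauss_constructions.

(** * Densities and rotation invariance in the plane *)

Section gauss_density.
Context {R : realType}.
Local Notation mu := (@lebesgue_measure R).
Local Notation pdf := (normal_pdf (0 : R) 1).

Lemma integral_gam (f : R -> \bar R) : measurable_fun setT f ->
  (forall x, 0 <= f x)%E ->
  (\int[gam R]_x f x = \int[mu]_x (f x * (pdf x)%:E))%E.
Proof.
move=> mf f0.
have dom := @normal_prob_dominates R 0 1.
rewrite -(Radon_Nikodym_SigmaFinite.change_of_variables dom)//.
apply: ae_eq_integral => //.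
- apply: emeasurable_funM => //.
  by have /measurable_int := Radon_Nikodym_SigmaFinite.f_integrable dom.
- apply: emeasurable_funM => //; apply/measurable_EFinP.
  exact: measurable_normal_pdf.
apply: ae_eqe_mul2l.
apply: integral_ae_eq => //.
- exact: Radon_Nikodym_SigmaFinite.f_integrable.
- by apply/measurable_EFinP; exact: measurable_normal_pdf.
- by move=> E _ mE; rewrite -Radon_Nikodym_SigmaFinite.f_integral.
Qed.

(** The scaled image measure is identified with Lebesgue measure on half-open intervals; for a < 0
    the preimage of such an interval is closed at its other end, whence the two cases. *)
Lemma integral_affine (a b : R) (f : R -> \bar R) : a != 0 ->
  measurable_fun setT f -> (forall x, 0 <= f x)%E ->
  (\int[mu]_x f x = `|a|%:E * \int[mu]_x f (a * x + b)%R)%E.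
Proof.
move=> a0 mf f0.
pose h : measurableTypeR R -> measurableTypeR R := fun x => a * x + b.
have mh : measurable_fun setT h.
  by apply: measurable_funD => //; exact: measurable_funM.
pose X : {mfun measurableTypeR R >-> measurableTypeR R} :=
  HB.pack h (isMeasurableFun.Build _ _ _ _ _ mh).
have a_ge0 : 0 <= `|a| by [].
have muE A : measurable A ->
    mu A = mscale (NngNum a_ge0) (pushforward mu X) A.
  move=> mA; apply: lebesgue_measure_unique => // _ [[u v]] _ <-.
  transitivity (`|a|%:E * mu (h @^-1` `]u, v]))%E; last by [].
  have [a_gt0|a_lt0|/eqP] := ltgtP 0 a; last by rewrite eq_sym (negbTE a0).
  - rewrite [Y in (_ * mu Y)%E](_ : _ = `]((u - b) / a), ((v - b) / a)]%classic).
    rewrite !lebesgue_measure_itv/= !lte_fin ltr_pM2r ?invr_gt0// ltrD2r.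
    case: ifPn => _; last by rewrite mule0.
    rewrite gtr0_norm// -!EFinB -EFinM; congr EFin; field.
    by rewrite gt_eqF.
    apply/seteqP; split=> x /=; rewrite /h !in_itv/=;
      by rewrite ltr_pdivrMr// ler_pdivlMr// ltrBlDr lerBrDr (mulrC x).
  - rewrite [Y in (_ * mu Y)%E](_ : _ = `[((v - b) / a), ((u - b) / a)[%classic).
    rewrite !lebesgue_measure_itv/= !lte_fin ltr_nM2r ?invr_lt0// ltrD2r.
    case: ifPn => _; last by rewrite mule0.
    rewrite ltr0_norm// -!EFinB -EFinM; congr EFin; field.
    by rewrite lt_eqF.
    apply/seteqP; split=> x /=; rewrite /h !in_itv/= andbC;
      by rewrite ltr_ndivlMr// ler_ndivrMr// ltrBlDr lerBrDr (mulrC x).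
rewrite (eq_measure_integral (mscale (NngNum a_ge0) (pushforward mu X))).
  rewrite ge0_integral_mscale//= ge0_integral_pushforward//=.
by move=> A mA _; exact: muE.
Qed.

Lemma mule_cancel (c : R) (x y : \bar R) : 0 < c ->
  (c%:E * x = c%:E * y -> x = y)%E.
Proof.
move=> c0 /(congr1 (mule c^-1%:E)).
by rewrite !muleA -EFinM mulVf ?gt_eqF// !mul1e.
Qed.

Lemma pdfE x : pdf x = normal_peak 1 * expR (- x ^+ 2 / 2).
Proof.
by rewrite normal_pdfE ?oner_neq0// /normal_fun subr0 expr1n.
Qed.

Lemma gam2E (p : R * R -> \bar R) : measurable_fun setT p ->
  (forall z, 0 <= p z)%E ->
  (\int[gam R]_x \int[gam R]_y p (x, y) =
   \int[mu]_x \int[mu]_y (p (x, y) * (pdf x)%:E * (pdf y)%:E))%E.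
Proof.
have m1 x : measurable_fun setT p -> measurable_fun setT (fun y => p (x, y)).
  by move=> mp; apply: measurableT_comp.
have pdf0 x : (0 <= (pdf x)%:E)%E by rewrite lee_fin normal_pdf_ge0.
move=> mp p0.
rewrite integral_gam//; last first.
- by move=> x; apply: integral_ge0.
- exact: measurable_fun_fubini_tonelli_F.
apply: eq_integral => x _.
rewrite integral_gam//; last exact: m1.
have mpy : measurable_fun setT (fun y => p (x, y) * (pdf y)%:E)%E.
  apply: emeasurable_funM; first exact: m1.
  by apply/measurable_EFinP; exact: measurable_normal_pdf.
have p0y y : setT y -> (0 <= p (x, y) * (pdf y)%:E)%E.
  by move=> _; exact: mule_ge0.
rewrite muleC -(@ge0_integralZl _ _ R mu setT measurableT _ mpy _ p0y (pdf0 x)).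
by apply: eq_integral => y _; rewrite muleA (muleC (pdf x)%:E).
Qed.

(** Instead of a change of variables in two dimensions, the rotation is split into affine
    substitutions in one variable each. Both bring in the factor |c|, which cancels. *)
Lemma gauss2_rot (c s : R) (g : R * R -> \bar R) :
  c ^+ 2 + s ^+ 2 = 1 -> c != 0 -> measurable_fun setT g ->
  (forall z, 0 <= g z)%E ->
  (\int[gam R]_x \int[gam R]_y g (c * x - s * y, s * x + c * y)%R =
   \int[gam R]_x \int[gam R]_y g (x, y))%E.
Proof.
move=> cs1 c0 mg g0.
have mP (u v : R * R -> R) : measurable_fun setT u -> measurable_fun setT v ->
    measurable_fun setT (fun z => g (u z, v z)).
  by move=> mu' mv; apply: measurableT_comp => //; exact/measurable_fun_pairP.
have mpdf (u : R * R -> R) : measurable_fun setT u ->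
    measurable_fun setT (fun z => (pdf (u z))%:E).
  move=> mu'; apply/measurable_EFinP; apply: measurableT_comp => //.
  exact: measurable_normal_pdf.
have mlin (a b : R) : measurable_fun setT (fun z : R * R => a * z.1 + b * z.2).
  by apply: measurable_funD; apply: measurable_funM.
have m1 (p : R * R -> \bar R) x : measurable_fun setT p ->
    measurable_fun setT (fun y => p (x, y)).
  by move=> mp; apply: measurableT_comp.
have m2 (p : R * R -> \bar R) y : measurable_fun setT p ->
    measurable_fun setT (fun x => p (x, y)).
  by move=> mp; apply: measurableT_comp.
have pdf0 x : (0 <= (pdf x)%:E)%E by rewrite lee_fin normal_pdf_ge0.
(* The intermediate integrand, in the rotated first coordinate and the old second one: replacing its
   first variable by c x - s y returns the left-hand integrand, replacing its second one by c y - s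
   x the right-hand one. *)
pose q (z : R * R) := (g (z.1, (s * z.1 + z.2) / c)%R *
  (pdf ((z.1 + s * z.2) / c))%:E * (pdf z.2)%:E)%E.
have mq : measurable_fun setT q.
  apply: emeasurable_funM; last exact: mpdf.
  apply: emeasurable_funM.
    apply: mP => //; apply: measurable_funM => //.
    by apply: measurable_funD => //; exact: measurable_funM.
  apply: mpdf; apply: measurable_funM => //.
  by apply: measurable_funD => //; exact: measurable_funM.
have q0 z : (0 <= q z)%E by rewrite /q !mule_ge0.
rewrite (@gam2E (fun z => g (c * z.1 - s * z.2, s * z.1 + c * z.2)))//; last first.
  apply: mP; last exact: mlin.
  rewrite (_ : (fun z => _) = (fun z => c * z.1 + (- s) * z.2)); first exact: mlin.
  by apply/funext => z; rewrite mulNr.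
rewrite (@gam2E g mg g0).
pose G1 (z : R * R) := (g (c * z.1 - s * z.2, s * z.1 + c * z.2)%R *
  (pdf z.1)%:E * (pdf z.2)%:E)%E.
have mG1 : measurable_fun setT G1.
  apply: emeasurable_funM; last exact: mpdf.
  apply: emeasurable_funM; last exact: mpdf.
  apply: mP; last exact: mlin.
  rewrite (_ : (fun z => _) = (fun z => c * z.1 + (- s) * z.2)); first exact: mlin.
  by apply/funext => z; rewrite mulNr.
have G10 z : (0 <= G1 z)%E by rewrite /G1 !mule_ge0.
rewrite (@fubini_tonelli _ _ _ _ R mu mu G1 mG1 G10).
have s2 : 1 - s ^+ 2 = c ^+ 2 by rewrite -cs1 addrK.
have cgt0 : 0 < `|c| by rewrite normr_gt0.
have E1 : (\int[mu]_y \int[mu]_x q (x, y) =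
           `|c|%:E * \int[mu]_y \int[mu]_x G1 (x, y))%E.
  have mG := @measurable_fun_fubini_tonelli_G _ _ _ _ R mu G1 mG1 G10.
  have G0 y : setT y -> (0 <= \int[mu]_x G1 (x, y))%E.
    by move=> _; exact: integral_ge0.
  have cE : (0 <= `|c|%:E)%E by rewrite lee_fin.
  rewrite -(@ge0_integralZl _ _ R mu setT measurableT _ mG _ G0 cE).
  apply: eq_integral => y _.
  rewrite (@integral_affine c (- s * y) _ c0 (m2 q y mq) (fun x => q0 (x, y))).
  apply: (f_equal (mule `|c|%:E)); apply: eq_integral => x _; rewrite /q /G1/=.
  have -> : (s * (c * x + - s * y) + y) / c = s * x + c * y.
    apply: (mulIf c0); rewrite divfK//.
    by transitivity (s * c * x + (1 - s ^+ 2) * y); [|rewrite s2]; ring.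
  have -> : (c * x + - s * y + s * y) / c = x by field.
  by rewrite mulNr.
have E2 : (\int[mu]_x \int[mu]_y q (x, y) =
           `|c|%:E * \int[mu]_x \int[mu]_y
              (g (x, y) * (pdf x)%:E * (pdf y)%:E))%E.
  pose G2 (z : R * R) := (g z * (pdf z.1)%:E * (pdf z.2)%:E)%E.
  have mG2 : measurable_fun setT G2.
    apply: emeasurable_funM; last exact: mpdf.
    by apply: emeasurable_funM; [exact: mg|exact: mpdf].
  have G20 z : (0 <= G2 z)%E by rewrite /G2 !mule_ge0.
  have mF := @measurable_fun_fubini_tonelli_F _ _ _ _ R mu G2 mG2 G20.
  have F0 x : setT x -> (0 <= \int[mu]_y G2 (x, y))%E.
    by move=> _; exact: integral_ge0.
  have cE : (0 <= `|c|%:E)%E by rewrite lee_fin.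
  rewrite -(@ge0_integralZl _ _ R mu setT measurableT _ mF _ F0 cE).
  apply: eq_integral => x _.
  rewrite (@integral_affine c (- s * x) _ c0 (m1 q x mq) (fun y => q0 (x, y))).
  apply: (f_equal (mule `|c|%:E)); apply: eq_integral => y _; rewrite /q /=.
  have -> : (s * x + (c * y + - s * x)) / c = y by field.
  rewrite /G2 -muleA -[in RHS]muleA; congr (_ * _)%E; rewrite -!EFinM; congr EFin.
  rewrite !pdfE mulrACA [RHS]mulrACA; congr (_ * _); rewrite -!expRD.
  congr expR; rewrite -!mulrDl -!opprD; congr (- _ / _).
  have -> : (x + s * (c * y + - s * x)) / c = c * x + s * y.
    apply: (mulIf c0); rewrite divfK//.
    by transitivity ((1 - s ^+ 2) * x + s * y * c); [|rewrite s2]; ring.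
  transitivity ((c ^+ 2 + s ^+ 2) * (x ^+ 2 + y ^+ 2)); first ring.
  by rewrite cs1 mul1r.
have E3 := etrans (etrans (esym E2) (@fubini_tonelli _ _ _ _ R mu mu q mq q0)) E1.
exact: esym (mule_cancel cgt0 E3).
Qed.

End gauss_density.

(** * Rotation invariance of gaussian vectors *)

Section rotations.
Context {R : realType}.
Local Notation vect I := (vect R I).

Definition givens (I : finType) (i j : I) (c s : R) (f : I -> R) : I -> R :=
  fun k => if k == i then c * f i - s * f j
           else if k == j then s * f i + c * f j else f k.

Lemma gauss_measurable d (T : measurableType d) (P : probability T R)
    (I : finType) (F : T -> vect I) (i : I) :
  gauss_map P F -> measurable_fun setT (fun x => F x i).
Proof.
move=> [mF _]; rewrite (_ : (fun x => _) = (fun f : vect I => f i) \o F)//.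
by apply: measurableT_comp => //; exact: measurable_coord.
Qed.

Lemma measure_int_indic d (T : measurableType d) (mu : measure T R) (A : set T) :
  measurable A -> mu A = (\int[mu]_x (\1_A x)%:E)%E.
Proof. by move=> mA; rewrite integral_indic// setIT. Qed.

Lemma measurable_EFin_indic d (T : measurableType d) (A : set T) :
  measurable A -> measurable_fun setT (fun x => (\1_A x : R)%:E).
Proof. by move=> mA; apply/measurable_EFinP; exact: measurable_indic. Qed.

Lemma indic_ge0 T (A : set T) x : (0 <= (\1_A x : R)%:E)%E.
Proof. by rewrite lee_fin indicE. Qed.

Lemma gauss_law_set d (T : measurableType d) (P : probability T R)
    d' (T' : measurableType d') (P' : probability T' R)
    (I : finType) (F : T -> vect I) (F' : T' -> vect I) (A : set (vect I)) :
  measurable A -> gauss_map P F -> gauss_map P' F' ->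
  P (F @^-1` A) = P' (F' @^-1` A).
Proof.
move=> mA gF gF'.
have mPre (d0 : measure_display) (T0 : measurableType d0) (H : T0 -> vect I) :
    measurable_fun setT H -> measurable (H @^-1` A).
  by move=> mH; rewrite -[X in measurable X]setTI; exact: mH.
rewrite (measure_int_indic _ (mPre _ _ _ gF.1)).
rewrite (measure_int_indic _ (mPre _ _ _ gF'.1)).
exact: (gauss_law gF gF' (measurable_EFin_indic mA) (indic_ge0 A)).
Qed.

Lemma gam2_int (A : set (R * R)) : measurable A ->
  (gam R \x gam R)%E A = (\int[gam R]_x \int[gam R]_y (\1_A (x, y))%:E)%E.
Proof.
move=> mA; apply: etrans (measure_int_indic (gam R \x gam R)%E mA) _.
exact: (@fubini_tonelli1 _ _ _ _ R (gam R) (gam R) _ (measurable_EFin_indic mA) (indic_ge0 A)).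
Qed.

Lemma gam2_rot (c s : R) (B C : set R) :
  c ^+ 2 + s ^+ 2 = 1 -> c != 0 -> measurable B -> measurable C ->
  (gam R \x gam R)%E
    [set z | B (c * z.1 - s * z.2) /\ C (s * z.1 + c * z.2)] =
  (gam R B * gam R C)%E.
Proof.
move=> cs1 c0 mB mC.
pose h (z : R * R) := (c * z.1 - s * z.2, s * z.1 + c * z.2).
have mh : measurable_fun setT h.
  apply/measurable_fun_pairP; split.
    by apply: measurable_funB; apply: measurable_funM.
  by apply: measurable_funD; apply: measurable_funM.
have mBC : measurable (B `*` C) by exact: measurableX.
have mA : measurable (h @^-1` (B `*` C)).
  by rewrite -[X in measurable X]setTI; exact: mh.
apply: etrans (gam2_int mA) _.
apply: etrans (gauss2_rot cs1 c0 (measurable_EFin_indic mBC) (indic_ge0 _)) _.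
apply: etrans (esym (gam2_int mBC)) _.
exact: product_measure1E.
Qed.

Lemma measurable_rot (I : finType) (i j : I) (c s : R) :
  measurable_fun setT (givens i j c s : vect I -> vect I).
Proof.
apply: measurable_vect => k; rewrite /givens.
case: (k == i); [apply: measurable_funB|case: (k == j);
  [apply: measurable_funD|exact: measurable_coord]];
by apply: measurable_funM => //; exact: measurable_coord.
Qed.

(** The law of F is that of [G], in which the coordinates i and j are two separate independent
    normals. There the event splits into one about the rotated pair and one about the other
    coordinates. *)
Let gauss_rot0 d (T : measurableType d) (P : probability T R)
    (I : finType) (F : T -> vect I) (i j : I) (c s : R) :
  i != j -> c ^+ 2 + s ^+ 2 = 1 -> c != 0 ->
  gauss_map P F -> gauss_map P (fun x => givens i j c s (F x) : vect I).
Proof.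
move=> ij cs1 c0 gF; have [mF PF] := gF.
have mrot := @measurable_rot I i j c s.
have mrF : measurable_fun setT (fun x => givens i j c s (F x) : vect I).
  exact: (measurableT_comp mrot mF).
split=> // B mB.
pose A : set (vect I) := givens i j c s @^-1` rect B.
have mA : measurable A.
  by rewrite -[X in measurable X]setTI; apply: mrot => //; exact: measurable_rect.
have g1 := @gauss_normal R unit card_unit.
pose e k : (unit + unit) + I :=
  if k == i then inl (inl tt) else if k == j then inl (inr tt) else inr k.
pose G (z : (R * R) * T) : vect I := fun k =>
  if k == i then z.1.1 else if k == j then z.1.2 else F z.2 k.
have gG : gauss_map ((gam R \x gam R) \x P)%E G.
  apply: (gauss_sub (e := e) _ _ (gauss_join (gauss_join g1 g1) gF)).
    move=> k k'; rewrite /e; case: (eqVneq k i) => [->|ki].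
      by case: (eqVneq k' i) => // _; case: ifP.
    case: (eqVneq k j) => [->|kj].
      by case: (eqVneq k' i) => // _; case: (eqVneq k' j).
    by case: (eqVneq k' i) => // _; case: (eqVneq k' j) => // _ [].
  by move=> z k; rewrite /G /e; case: ifP => //; case: ifP.
apply: etrans (gauss_law_set mA gF gG) _.
pose D := F @^-1` rect (fun k => if k == i then setT else if k == j then setT
                         else B k).
have mD : measurable D.
  rewrite -[X in measurable X]setTI; apply: mF => //; apply: measurable_rect => k.
  by case: (k == i) => //; case: (k == j).
pose A2 := [set z : R * R | B i (c * z.1 - s * z.2) /\ B j (s * z.1 + c * z.2)].
have mA2 : measurable A2.
  apply: measurableI.
    rewrite -[X in measurable X]setTI.
    have mh : measurable_fun setT (fun z : R * R => c * z.1 - s * z.2).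
      by apply: measurable_funB; apply: measurable_funM.
    exact: mh.
  rewrite -[X in measurable X]setTI.
  have mh : measurable_fun setT (fun z : R * R => s * z.1 + c * z.2).
    by apply: measurable_funD; apply: measurable_funM.
  exact: mh.
have -> : G @^-1` A = A2 `*` D.
  apply/seteqP; split=> -[z w]; rewrite /A2 /D /A /rect /givens /G /=.
    move=> BG; split.
      split; first by have := BG i; rewrite !eqxx [j == i]eq_sym (negbTE ij) ?eqxx.
      by have := BG j; rewrite !eqxx [j == i]eq_sym (negbTE ij) ?eqxx.
    move=> k; case: eqVneq => // ki; case: eqVneq => // kj; have := BG k.
    by rewrite (negbTE ki) (negbTE kj).
  move=> [[Bi Bj] BD] k; rewrite !eqxx [j == i]eq_sym (negbTE ij) ?eqxx.
  case: eqVneq => [->//|ki]; case: eqVneq => [->//|kj].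
  by have := BD k; rewrite (negbTE ki) (negbTE kj).
apply: etrans (@product_measure1E _ _ _ _ R (gam R \x gam R)%E P _ _ mA2 mD) _.
have mB' k : measurable (if k == i then setT else if k == j then setT else B k).
  by case: (k == i) => //; case: (k == j).
apply: etrans (f_equal2 mule (gam2_rot cs1 c0 (mB i) (mB j)) (PF _ mB')) _.
have ji : (j == i) = false by rewrite eq_sym (negbTE ij).
rewrite [RHS](bigD1 i)//= [in RHS](bigD1 j)/= ?ji// muleA.
congr (_ * _)%E; rewrite (bigD1 i)//= eqxx probability_setT mul1e.
rewrite (bigD1 j)/= ?ji// eqxx probability_setT mul1e.
by apply: eq_bigr => k /andP[/negbTE-> /negbTE->].
Qed.

(** A rotation with c = 0 is a quarter turn in one of the two directions, hence the square of an
    eighth turn, whose cosine h = 1 / sqrt 2 is not zero. *)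
Lemma gauss_rot d (T : measurableType d) (P : probability T R)
    (I : finType) (F : T -> vect I) (i j : I) (c s : R) :
  i != j -> c ^+ 2 + s ^+ 2 = 1 ->
  gauss_map P F -> gauss_map P (fun x => givens i j c s (F x) : vect I).
Proof.
move=> ij cs1 gF; have [c0|c0] := eqVneq c 0; last exact: gauss_rot0.
have s1 : s ^+ 2 = 1 by rewrite -cs1 c0 expr0n/= add0r.
pose h : R := Num.sqrt (2^-1).
have h2 : h ^+ 2 = 2^-1 by rewrite sqr_sqrtr// invr_ge0.
have h0 : h != 0 by rewrite gt_eqF// sqrtr_gt0 invr_gt0.
have cs1' : h ^+ 2 + (s * h) ^+ 2 = 1.
  by rewrite exprMn s1 mul1r h2; field.
suff -> : (fun x => givens i j c s (F x) : vect I) =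
    (fun x => givens i j h (s * h) (givens i j h (s * h) (F x)) : vect I).
  exact: gauss_rot0 ij cs1' h0 (gauss_rot0 ij cs1' h0 gF).
apply/funext => x; apply/funext => k; rewrite /givens c0.
have hh : h * h = 2^-1 by rewrite -expr2.
have ss : s * s = 1 by rewrite -expr2.
rewrite !eqxx [j == i]eq_sym (negbTE ij) ?eqxx.
case: ifP => _.
  symmetry; transitivity ((h * h) * (1 - s * s) * F x i - 2 * s * (h * h) * F x j).
    ring.
  by rewrite hh ss; field.
case: ifP => // _.
symmetry; transitivity ((h * h) * (1 - s * s) * F x j + 2 * s * (h * h) * F x i).
  ring.
by rewrite hh ss; field.
Qed.

End rotations.

(** * The squared radius in the plane *)

Section exponential_law.
Context {R : realType}.
Local Notation mu := (@lebesgue_measure R).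

Lemma integral_oneDsqrV :
  (\int[mu]_x (oneDsqr x)^-1%:E = (pi : R)%:E)%E.
Proof.
have -> := @ge0_symfun_integralT R (fun x => (oneDsqr x)^-1).
- rewrite (_ : [set x | 0 <= x] = `[0, +oo[%classic); last first.
    by apply/seteqP; split => x/=; rewrite in_itv/= andbT.
  by rewrite integral0y_oneDsqr -EFinM mulrCA divff// mulr1.
- by move=> x; rewrite invr_ge0.
- exact: continuous_oneDsqrV.
- by move=> x; rewrite /= /oneDsqr sqrrN.
Qed.

Lemma sqr_normal_peak : normal_peak (1 : R) ^+ 2 = (2 * pi)^-1.
Proof.
rewrite /normal_peak exprVn expr1n mul1r sqr_sqrtr ?mulr_natl//.
by rewrite mulrn_wge0// pi_ge0.
Qed.

Lemma continuous_gauss (c : R) : continuous (fun x : R => expR (- (x ^+ 2 / c))).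
Proof.
move=> x; apply: continuous_comp; last exact: continuous_expR.
apply: (@cvgN R R^o); apply: (@cvgM R); last exact: cvg_cst.
exact: exprn_continuous.
Qed.

Lemma cvg_affine_expRN (a t : R) :
  ((a * u - t + a) * expR (- u)) @[u --> +oo] --> 0.
Proof.
have e2 : (expR (- (u / 2)) : R) @[u --> +oo] --> 0.
  apply: (cvg_comp (fun u : R => u / 2) (fun u => expR (- u))).
    exact: gt0_cvgMly.
  exact: cvgr_expR.
have ue : (u * expR (- u) : R) @[u --> +oo] --> 0.
  apply: (@squeeze_cvgr _ _ _ _ (fun=> 0) (fun u => 2 * expR (- (u / 2)))).
  - near=> u; have u0 : 0 <= u by near: u; exact: nbhs_pinfty_ge.
    rewrite mulr_ge0 ?expR_ge0//=.
    have -> : expR (- u) = expR (- (u / 2)) * expR (- (u / 2)).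
      by rewrite -expRD; congr expR; field.
    rewrite mulrA ler_pM2r ?expR_gt0// expRN ler_pdivrMr ?expR_gt0//.
    by have := expR_ge1Dx (u / 2); lra.
  - exact: cvg_cst.
  - by rewrite -[X in _ --> X](mulr0 2); apply: (@cvgM R) => //; exact: cvg_cst.
have -> : (fun u => (a * u - t + a) * expR (- u)) =
    (fun u => a * (u * expR (- u)) + (a - t) * expR (- u)).
  by apply/funext => u; ring.
rewrite -[X in _ --> X](addr0 0); apply: (@cvgD R R^o).
  by rewrite -[X in _ --> X](mulr0 a); apply: (@cvgM R) => //; exact: cvg_cst.
rewrite -[X in _ --> X](mulr0 (a - t)); apply: (@cvgM R).
  exact: cvg_cst.
exact: cvgr_expR.
Unshelve. all: by end_near. Qed.

(** On [x0, +oo[ with x0 = sqrt (2 t / a) the positive part can be omitted, and -(a x^2 / 2 - t + a)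
    e^(-x^2 / 2) is an antiderivative, equal to -a e^(-t / a) at x0. The factor 2 is the symmetry in
    x. *)
Lemma gauss_tail1 (a t : R) : 0 < a -> 0 <= t ->
  ((2 * a * expR (- (t / a)))%:E <=
   \int[mu]_x (`|x| * (Num.max 0 (a * (x ^+ 2 / 2) - t)) *
               expR (- (x ^+ 2 / 2)))%:E)%E.
Proof.
move=> a0 t0.
pose f x := `|x| * (Num.max 0 (a * (x ^+ 2 / 2) - t)) * expR (- (x ^+ 2 / 2)).
have f0 x : 0 <= f x.
  by rewrite !mulr_ge0 ?expR_ge0// le_max lexx.
have cq : continuous (fun x : R => a * (x ^+ 2 / 2) - t).
  move=> x; apply: (@cvgB R R^o); last exact: cvg_cst.
  apply: (@cvgM R); first exact: cvg_cst.
  apply: (@cvgM R); last exact: cvg_cst.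
  exact: exprn_continuous.
have cf : continuous f.
  move=> x; apply: (@cvgM R); last exact: continuous_gauss.
  apply: (@cvgM R); first exact: norm_continuous.
  have cmax := max_fun_continuous (fun y => cvg_cst (0 : R) : _ --> _) cq.
  exact: cmax.
have ef : f =1 f \o -%R by move=> x; rewrite /f/= normrN sqrrN.
have mf : measurable_fun setT (fun x => (f x)%:E).
  by apply/measurable_EFinP; exact: continuous_measurable_fun.
rewrite [leRHS](@ge0_symfun_integralT R f f0 cf ef).
pose x0 := Num.sqrt (2 * (t / a)).
have x00 : 0 <= x0 by exact: sqrtr_ge0.
have ta0 : 0 <= t / a by rewrite divr_ge0// ltW.
have x02 : x0 ^+ 2 / 2 = t / a.
  rewrite sqr_sqrtr; last exact: mulr_ge0.
  by move: (t / a) => u; field.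
rewrite -mulrA EFinM lee_pmul2l//.
pose g x := x * (a * (x ^+ 2 / 2) - t) * expR (- (x ^+ 2 / 2)).
pose G x := - ((a * (x ^+ 2 / 2) - t + a) * expR (- (x ^+ 2 / 2))).
have qge x : x0 <= x -> 0 <= a * (x ^+ 2 / 2) - t.
  move=> x0x; rewrite subr_ge0 mulrC -ler_pdivrMr// -x02.
  by rewrite ler_pM2r ?invr_gt0// lerXn2r// nnegrE// (le_trans x00).
have gf x : x0 <= x -> f x = g x.
  move=> x0x; rewrite /f /g ger0_norm ?(le_trans x00)// max_r//.
  exact: qge.
have g0 x : x0 <= x -> 0 <= g x by move=> /gf <-.
have cg : continuous g.
  move=> x; apply: (@cvgM R); last exact: continuous_gauss.
  by apply: (@cvgM R); [exact: cvg_id|exact: cq].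
have dG (x : R) : is_derive x 1 G (g x).
  apply: is_derive_eq; rewrite /GRing.scale /= /g.
  by set e := expR _; field.
have GI : (\int[mu]_(x in `[x0, +oo[) (g x)%:E = 0%:E - (G x0)%:E)%E.
  apply: ge0_continuous_FTC2y => //.
  - by apply: continuous_subspaceT.
  - rewrite -[X in _ --> X]oppr0; apply: (@cvgN R R^o).
    have sqy : (x ^+ 2 / 2 : R) @[x --> +oo] --> +oo.
      apply: (cvg_comp (fun x : R => x ^+ 2) (fun x => x / 2)).
        exact: cvgr_expr2.
      exact: gt0_cvgMly.
    exact: (cvg_comp _ _ sqy (cvg_affine_expRN a t)).
  - apply: cvg_at_right_filter.
    apply: (@differentiable_continuous R R^o R^o).
    by apply/derivable1_diffP; exact: ex_derive.
  - by move=> x _; rewrite derive1E; exact: derive_val.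
have -> : (a * expR (- (t / a)))%:E = (0%:E - (G x0)%:E)%E.
  rewrite /G x02 -EFinB; congr EFin; rewrite sub0r opprK; congr (_ * _).
  by rewrite mulrCA divff ?gt_eqF// mulr1 subrr add0r.
rewrite -GI.
rewrite (_ : (\int[mu]_(x in `[x0, +oo[) (g x)%:E)%E =
  (\int[mu]_(x in `[x0, +oo[) (f x)%:E)%E); last first.
  apply: eq_integral => x; rewrite inE/= in_itv/= andbT => x0x.
  by rewrite gf.
apply: ge0_subset_integral => //.
- rewrite (_ : [set x | 0 <= x] = `[0, +oo[%classic)//.
  by apply/seteqP; split => x/=; rewrite in_itv/= andbT.
- exact: measurable_funTS.
- by move=> x _; rewrite lee_fin.
- by move=> x /=; rewrite in_itv/= andbT; exact: le_trans.
Qed.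

(** Polar coordinates in projective form: the plane is described by the slope s = y / x and a
    rescaled abscissa, so that only substitutions in one variable occur. The integral of 1 / (1 +
    s^2) is pi, which with the density constant 1 / (2 pi) leaves 1/2. The line x = 0 has no slope
    and accounts for the inequality. *)
Lemma gauss2_polar (F : R -> \bar R) : measurable_fun setT F ->
  (forall u, 0 <= F u)%E ->
  (2^-1%:E * \int[mu]_x (`|x|%R%:E * (F (x ^+ 2 / 2)%R * (expR (- (x ^+ 2 / 2)))%:E)) <=
   \int[gam R]_x \int[gam R]_y F ((x ^+ 2 + y ^+ 2) / 2)%R)%E.
Proof.
move=> mF F0.
pose c : R := normal_peak 1.
pose p (z : R * R) := F ((z.1 ^+ 2 + z.2 ^+ 2) / 2).
have p0 z : (0 <= p z)%E by exact: F0.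
have mp : measurable_fun setT p.
  apply: (measurableT_comp mF); apply: measurable_funM => //.
  by apply: measurable_funD; exact: measurable_funX.
rewrite [leRHS](@gam2E R p mp p0).
pose K x := (`|x|%R%:E * (F (x ^+ 2 / 2)%R * (expR (- (x ^+ 2 / 2)))%:E))%E.
have K0 x : (0 <= K x)%E by rewrite !mule_ge0// lee_fin// expR_ge0.
pose pdf := normal_pdf (0 : R) 1.
have pdf0 x : 0 <= pdf x by exact: normal_pdf_ge0.
pose H (z : R * R) := (`|z.1|%R%:E * (p (z.1, z.1 * z.2)%R * (pdf z.1)%:E *
  (pdf (z.1 * z.2))%:E))%E.
have H0 z : (0 <= H z)%E by rewrite !mule_ge0// lee_fin.
have mpdf (u : R * R -> R) : measurable_fun setT u ->
    measurable_fun setT (fun z => (pdf (u z))%:E).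
  move=> mu'; apply/measurable_EFinP; apply: measurableT_comp => //.
  exact: measurable_normal_pdf.
have mprod : measurable_fun setT (fun z : R * R => z.1 * z.2).
  exact: measurable_funM.
have mH : measurable_fun setT H.
  apply: emeasurable_funM.
    by apply/measurable_EFinP; apply: measurableT_comp.
  apply: emeasurable_funM; last exact: mpdf.
  apply: emeasurable_funM; last exact: mpdf.
  apply: (measurableT_comp mp); apply/measurable_fun_pairP.
  by split; [exact: measurable_fst|exact: mprod].
have mK : measurable_fun setT K.
  apply: emeasurable_funM.
    by apply/measurable_EFinP; exact: normr_measurable.
  have mx : measurable_fun setT (fun x : R => x ^+ 2 / 2).
    by apply: measurable_funM => //; exact: measurable_funX.
  apply: emeasurable_funM; first exact: (measurableT_comp mF).
  by apply/measurable_EFinP; apply: measurableT_comp => //; exact: measurableT_comp.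
pose p2 (z : R * R) := (p z * (pdf z.1)%:E * (pdf z.2)%:E)%E.
have p20 z : (0 <= p2 z)%E by rewrite !mule_ge0// lee_fin.
have mp2 : measurable_fun setT p2.
  by apply: emeasurable_funM; [apply: emeasurable_funM|] => //; exact: mpdf.
have E1 : (\int[mu]_x \int[mu]_s H (x, s) <= \int[mu]_x \int[mu]_y p2 (x, y))%E.
  apply: ge0_le_integral.
  - exact: measurableT.
  - by move=> x _; exact: integral_ge0.
  - exact: (@measurable_fun_fubini_tonelli_F _ _ _ _ R mu H mH H0).
  - exact: (@measurable_fun_fubini_tonelli_F _ _ _ _ R mu p2 mp2 p20).
  move=> x _; have [->|x0] := eqVneq x 0.
    rewrite [leLHS]integral0_eq; first exact: integral_ge0.
    by move=> s _; rewrite /H/= normr0 mul0e.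
  have mp2x : measurable_fun setT (fun y => p2 (x, y)).
    by apply: (measurableT_comp mp2).
  rewrite (@integral_affine R x 0 _ x0 mp2x (fun y => p20 (x, y))).
  have mq : measurable_fun setT (fun s => p2 (x, (x * s + 0)%R)).
    by apply: (measurableT_comp mp2x); exact: measurable_funD.
  have xE : (0 <= `|x|%R%:E)%E by rewrite lee_fin.
  rewrite -(@ge0_integralZl _ _ R mu setT measurableT _ mq _
    (fun s _ => p20 (x, x * s + 0)) xE).
  rewrite le_eqVlt; apply/orP; left; apply/eqP; apply: eq_integral => s _.
  by rewrite /H /p2 addr0.
apply: le_trans E1.
rewrite (@fubini_tonelli _ _ _ _ R mu mu H mH H0).
have HK s : (\int[mu]_x H (x, s) =
    (\int[mu]_x K x) * ((c ^+ 2)%:E * (oneDsqr s)^-1%:E))%E.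
  have D0 : 0 < oneDsqr s by rewrite (lt_le_trans _ (oneDsqr_ge1 s)).
  (* Rescaling x by r turns x^2 + (x s)^2 into x^2, which separates the two variables. *)
  pose r := (Num.sqrt (oneDsqr s))^-1.
  have r0 : 0 < r by rewrite invr_gt0 sqrtr_gt0.
  have r2 : r ^+ 2 = (oneDsqr s)^-1 by rewrite exprVn sqr_sqrtr// ltW.
  have mHs : measurable_fun setT (fun x => H (x, s)).
    by apply: (measurableT_comp mH).
  rewrite (@integral_affine R r 0 _ (lt0r_neq0 r0) mHs (fun x => H0 (x, s))).
   have rc0 : (0 <= (r * c ^+ 2)%:E)%E.
    by rewrite lee_fin; apply: mulr_ge0; [exact: ltW|exact: sqr_ge0].
  transitivity (`|r|%R%:E * \int[mu]_x ((r * c ^+ 2)%:E * K x))%E.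
    apply: (f_equal (mule _)); apply: eq_integral => x _.
    rewrite /H /K /p addr0/= normrM (gtr0_norm r0).
    have -> : ((r * x) ^+ 2 + (r * x * s) ^+ 2) / 2 = x ^+ 2 / 2.
      transitivity (r ^+ 2 * oneDsqr s * (x ^+ 2 / 2)).
        by rewrite /oneDsqr; field.
      by rewrite r2 mulVf ?mul1r// gt_eqF.
    rewrite -muleA -EFinM; have -> : pdf (r * x) * pdf (r * x * s) =
        c ^+ 2 * expR (- (x ^+ 2 / 2)).
      rewrite /pdf !pdfE mulrACA -expr2; congr (_ * _).
      rewrite -expRD; congr expR.
      transitivity (- (r ^+ 2 * oneDsqr s * (x ^+ 2 / 2))).
        by rewrite /oneDsqr; field.
      by rewrite r2 mulVf ?mul1r// gt_eqF.
    move: (c ^+ 2) (F _) => c2 y; rewrite !EFinM -!muleA.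
    by rewrite (muleCA y) (muleCA `|x|%R%:E).
  rewrite (@ge0_integralZl _ _ R mu setT measurableT _ mK _ (fun x _ => K0 x) rc0).
  rewrite muleA muleC; congr (_ * _)%E; rewrite -!EFinM; congr EFin.
  by rewrite gtr0_norm// mulrA -expr2 r2 mulrC.
apply: (@le_trans _ _ (\int[mu]_s
    ((\int[mu]_x K x) * ((c ^+ 2)%:E * (oneDsqr s)^-1%:E)))%E); last first.
  rewrite le_eqVlt; apply/orP; left; apply/eqP.
  by apply: eq_integral => s _; exact: esym (HK s).
have oD0 s : (0 <= (oneDsqr s)^-1%:E :> \bar R)%E by rewrite lee_fin invr_ge0.
have moD : measurable_fun setT (fun s : R => (oneDsqr s)^-1%:E).
  by apply/measurable_EFinP; apply: continuous_measurable_fun; exact: continuous_oneDsqrV.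
have c20 : (0 <= (c ^+ 2)%:E)%E by rewrite lee_fin sqr_ge0.
have KI0 : (0 <= \int[mu]_x K x)%E by exact: integral_ge0.
have mcD : measurable_fun setT (fun s : R => (c ^+ 2)%:E * (oneDsqr s)^-1%:E)%E.
  by apply: emeasurable_funM.
rewrite (@ge0_integralZl _ _ R mu setT measurableT _ mcD _
  (fun s _ => mule_ge0 c20 (oD0 s)) KI0).
rewrite (@ge0_integralZl _ _ R mu setT measurableT _ moD _ (fun s _ => oD0 s) c20).
rewrite integral_oneDsqrV muleC -EFinM.
rewrite sqr_normal_peak; have -> : (2 * pi)^-1 * pi = 2^-1 :> R.
  by rewrite invfM -mulrA mulVf ?mulr1// gt_eqF// pi_gt0.
by [].
Qed.

(** (x^2 + y^2) / 2 is exponentially distributed with mean 1, and a e^(-t / a) is the mean excess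
    over t of a times such a variable. *)
Lemma gauss2_tail (a t : R) : 0 < a -> 0 <= t ->
  ((a * expR (- (t / a)))%:E <=
   \int[gam R]_x \int[gam R]_y
     (Num.max 0 (a * ((x ^+ 2 + y ^+ 2) / 2) - t))%:E)%E.
Proof.
move=> a0 t0.
pose F u := (Num.max 0 (a * u - t))%:E.
have F0 u : (0 <= F u)%E by rewrite lee_fin le_max lexx.
have mF : measurable_fun setT F.
  apply/measurable_EFinP; apply: measurable_maxr => //.
  by apply: measurable_funB => //; exact: measurable_funM.
apply: le_trans (gauss2_polar mF F0).
rewrite (_ : (\int[mu]_x _)%E = (\int[mu]_x (`|x| *
  (Num.max 0 (a * (x ^+ 2 / 2) - t)) * expR (- (x ^+ 2 / 2)))%:E)%E); last first.
  by apply: eq_integral => x _; rewrite /F -!EFinM mulrA.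
apply: le_trans (lee_wpmul2l _ (gauss_tail1 a0 t0)); last by rewrite lee_fin.
by rewrite -EFinM lee_fin !mulrA mulVf ?mul1r.
Qed.

End exponential_law.

(** * Reduction of linear forms by rotations *)

Section reduction.
Context {R : realType} (I : finType).
Local Notation vect I := (vect R I).

Lemma sum_rotM (A : {set I}) i j (c s : R) (a b : I -> R) :
  i \in A -> j \in A -> i != j -> c ^+ 2 + s ^+ 2 = 1 ->
  \sum_(k in A) givens i j c s a k * givens i j c s b k = \sum_(k in A) a k * b k.
Proof.
move=> iA jA ij cs1.
have ji : (j == i) = false by rewrite eq_sym (negbTE ij).
rewrite (bigD1 i)// [RHS](bigD1 i)//= (bigD1 j)/= ?jA ?ji//.
rewrite [X in _ = _ + X](bigD1 j)/= ?jA ?ji// !addrA /givens !eqxx ji.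
congr (_ + _); last first.
  by apply: eq_bigr => k /andP[/andP[_ /negbTE->] /negbTE->].
transitivity ((c ^+ 2 + s ^+ 2) * (a i * b i + a j * b j)); first by ring.
by rewrite cs1 mul1r.
Qed.

Lemma big_fin_setT (f : I -> R) : \sum_(i in [set: I]%SET) f i = \sum_i f i.
Proof. by apply: eq_bigl => i; rewrite finset.in_setT. Qed.

(** Givens rotations annihilate the coordinates of a in A one by one, collecting its norm at i0, and
    b is rotated along; K sees no difference. The induction is on the number of coordinates still to
    be annihilated. *)
Lemma rot_reduce (Y : Type) (K : (I -> R) -> (I -> R) -> Y) (A : {set I})
    (i0 : I) : i0 \in A ->
  (forall i j c s a b, i \in A -> j \in A -> i != j -> c ^+ 2 + s ^+ 2 = 1 ->
     K (givens i j c s a) (givens i j c s b) = K a b) ->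
  forall a b, exists a' b', [/\ K a' b' = K a b,
    forall i, i \in A -> i != i0 -> a' i = 0,
    \sum_(i in A) a' i ^+ 2 = \sum_(i in A) a i ^+ 2,
    \sum_(i in A) b' i ^+ 2 = \sum_(i in A) b i ^+ 2 &
    forall i, i \notin A -> a' i = a i /\ b' i = b i].
Proof.
move=> i0A invK a b.
have [n] := ubnP #|[set i in A | (i != i0) && (a i != 0)]|.
elim: n a b => // n IHn a b; rewrite ltnS => le_n.
have [i /andP[iA /andP[ii0 ai0]]|no] :=
    pickP (fun i => (i \in A) && ((i != i0) && (a i != 0))); last first.
  exists a, b; split=> // i iA ii0.
  by have := no i; rewrite iA ii0/= => /negbFE/eqP.
pose r2 := a i0 ^+ 2 + a i ^+ 2.
have r2_gt0 : 0 < r2.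
  by rewrite ltr_wpDl ?sqr_ge0// exprn_even_gt0.
pose r := Num.sqrt r2.
have r_gt0 : 0 < r by rewrite sqrtr_gt0.
have rE : r ^+ 2 = r2 by rewrite sqr_sqrtr// ltW.
have r0 : r != 0 by rewrite gt_eqF.
pose c := a i0 / r; pose s := - a i / r.
have cs1 : c ^+ 2 + s ^+ 2 = 1.
  rewrite !exprMn sqrrN -mulrDl -/r2 -rE -exprMn mulfV// expr1n//.
have i0i : i0 != i by rewrite eq_sym.
pose a1 := givens i0 i c s a; pose b1 := givens i0 i c s b.
have a1i : a1 i = 0.
  by rewrite /a1 /givens (negbTE ii0) eqxx /c /s; field.
have a1k k : k != i0 -> k != i -> a1 k = a k.
  by rewrite /a1 /givens => /negbTE-> /negbTE->.
have [|a' [b' [K' a'0 sa sb out]]] := IHn a1 b1.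
  apply: leq_trans le_n; apply: proper_card; apply/properP; split.
    apply/fintype.subsetP => k; rewrite !inE => /andP[-> /andP[kk0 ak]]/=.
    rewrite kk0/=; have [ki|ki] := eqVneq k i; first by rewrite ki.
    by rewrite -(a1k k).
  by exists i; rewrite !inE iA ii0//= a1i eqxx.
exists a', b'; split.
- by rewrite K' invK.
- exact: a'0.
- by rewrite sa; under eq_bigr do rewrite expr2; rewrite sum_rotM.
- by rewrite sb; under eq_bigr do rewrite expr2; rewrite sum_rotM.
- move=> k kA; have [-> ->] := out k kA; rewrite /a1 /b1 /givens.
  by rewrite !ifN//; apply: contraNneq kA => ->.
Qed.

Definition dot (a w : I -> R) := \sum_i a i * w i.

Lemma measurable_dot (a : I -> R) : measurable_fun setT (dot a : vect I -> R).
Proof.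
apply: measurable_sum => i.
by apply: measurable_funM => //; exact: measurable_coord.
Qed.

Lemma dot_rot i j (c s : R) (a b : I -> R) :
  i != j -> c ^+ 2 + s ^+ 2 = 1 -> dot (givens i j c s a) (givens i j c s b) = dot a b.
Proof.
move=> ij cs1.
by have := sum_rotM a b (finset.in_setT i) (finset.in_setT j) ij cs1; rewrite !big_fin_setT.
Qed.

(** a and b are the real and imaginary parts of a complex linear form, so the quadratic form has
    rank at most two, with unequal eigenvalues in general. Averaging over a quarter turn of its
    plane makes it isotropic; by convexity of the positive part this can only lower the expectation,
    and the isotropic case is [gauss2_tail]. *)
Lemma gauss_form_tail d (T : measurableType d) (P : probability T R)
    (F : T -> vect I) (a b : I -> R) (t : R) (i0 i1 : I) :
  i0 != i1 -> gauss_map P F -> 0 <= t ->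
  let s := \sum_i a i ^+ 2 + \sum_i b i ^+ 2 in 0 < s ->
  ((s * expR (- (t / s)))%:E <=
   \int[P]_x (Num.max 0 (dot a (F x) ^+ 2 + dot b (F x) ^+ 2 - t))%:E)%E.
Proof.
move=> i01 gF t0 s s0.
pose f a b (w : I -> R) := (Num.max 0 (dot a w ^+ 2 + dot b w ^+ 2 - t))%:E.
have f0 a' b' w : (0 <= f a' b' w)%E by rewrite lee_fin le_max lexx.
have mf a' b' : measurable_fun setT (f a' b' : vect I -> _).
  apply/measurable_EFinP; apply: measurable_maxr => //.
  apply: measurable_funB => //; apply: measurable_funD;
  by apply: measurable_funX; exact: measurable_dot.
pose K a b := (\int[P]_x f a b (F x))%E.
have invK i j c u a' b' : i != j -> c ^+ 2 + u ^+ 2 = 1 ->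
    K (givens i j c u a') (givens i j c u b') = K a' b'.
  move=> ij cu1; rewrite /K.
  rewrite (gauss_law gF (gauss_rot ij cu1 gF) (mf _ _) (f0 _ _)).
  by apply: eq_integral => x _; rewrite /f !dot_rot.
have [a1 [b1 [K1 a10 sa1 sb1 _]]] := @rot_reduce _ K [set: I]%SET i0
  (finset.in_setT _) (fun i j c u a' b' _ _ => @invK i j c u a' b') a b.
have i1A : i1 \in [set~ i0]%SET by rewrite !inE eq_sym.
(* The second reduction acts off i0 only. There the first vector is already zero, and it stays so
   because its norm on that set is preserved. *)
have [b2 [a2 [K2 b20 sb2 sa2 out]]] := @rot_reduce _ (fun b a => K a b)
  [set~ i0]%SET i1 i1A (fun i j c u b' a' _ _ => @invK i j c u a' b') b1 a1.
have a20 i : i != i0 -> a2 i = 0.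
  move=> ii0; move: sa2; rewrite [RHS]big1; last first.
    by move=> k; rewrite !inE => ki; rewrite a10 ?expr0n// finset.in_setT.
  move/eqP; rewrite psumr_eq0; last by move=> k _; exact: sqr_ge0.
  by move=> /allP/(_ i (mem_index_enum _)); rewrite !inE ii0/= sqrf_eq0 => /eqP.
have b21 i : i != i0 -> i != i1 -> b2 i = 0.
  by move=> ii0 ii1; rewrite b20// !inE.
have sE : s = a2 i0 ^+ 2 + b2 i0 ^+ 2 + b2 i1 ^+ 2.
  move: sa1 sb1; rewrite !big_fin_setT /s => <- <-.
  have [-> ->] : b2 i0 = b1 i0 /\ a2 i0 = a1 i0 by apply: out; rewrite !inE eqxx.
  rewrite -addrA; congr (_ + _).
    rewrite (bigD1 i0)//= big1 ?addr0// => k ki.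
    by rewrite a10 ?expr0n// finset.in_setT.
  rewrite (bigD1 i0)//=; congr (_ + _).
  transitivity (\sum_(i in [set~ i0]%SET) b1 i ^+ 2).
    by apply: eq_bigl => k; rewrite !inE.
  rewrite -sb2 (bigD1 i1)//= big1 ?addr0// => k /andP[]; rewrite !inE => ki0 ki1.
  by rewrite b21// expr0n.
rewrite -[leRHS]/(K a b) -K1 -K2.
have dotE (u w : I -> R) : (forall i, i != i0 -> i != i1 -> u i = 0) ->
    dot u w = u i0 * w i0 + u i1 * w i1.
  move=> u0; rewrite /dot (bigD1 i0)//= (bigD1 i1)/= 1?eq_sym// big1 ?addr0//.
  by move=> k /andP[ki0 ki1]; rewrite u0// mul0r.
have fE w : f a2 b2 w = (Num.max 0 ((a2 i0 * w i0) ^+ 2 +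
    (b2 i0 * w i0 + b2 i1 * w i1) ^+ 2 - t))%:E.
  rewrite /f !dotE//; last by move=> i ii0 _; exact: a20.
  by rewrite (a20 i1) 1?eq_sym// mul0r addr0.
pose h (z : R * R) := (Num.max 0 (s * ((z.1 ^+ 2 + z.2 ^+ 2) / 2) - t))%:E.
have h0 z : (0 <= h z)%E by rewrite lee_fin le_max lexx.
have mh : measurable_fun setT h.
  apply/measurable_EFinP; apply: measurable_maxr => //.
  apply: measurable_funB => //; apply: measurable_funM => //.
  by apply: measurable_funM => //; apply: measurable_funD; exact: measurable_funX.
have cs1 : (0 : R) ^+ 2 + 1 ^+ 2 = 1 by rewrite expr0n/= add0r expr1n.
pose F' x : vect I := givens i0 i1 0 1 (F x).
have gF' : gauss_map P F' := gauss_rot i01 cs1 gF.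
have mF i : measurable_fun setT (fun x => F x i) := gauss_measurable i gF.
have mh2 : measurable_fun setT (fun x => h (F x i0, F x i1)).
  apply: (measurableT_comp mh).
  by apply/measurable_fun_pairP; split; exact: mF.
have mfF u v : measurable_fun setT (fun x => f u v (F x)).
  by apply: (measurableT_comp (mf u v)); case: gF.
have mfF' u v : measurable_fun setT (fun x => f u v (F' x)).
  by apply: (measurableT_comp (mf u v)); case: gF'.
(* The values of the form at a vector and at its quarter turn add up to the trace s times the
   squared norm, and the positive part of a mean is at most the mean of the positive parts. *)
have half : (\int[P]_x h (F x i0, F x i1) <= K a2 b2)%E.
  have two : (K a2 b2 + K a2 b2 = \int[P]_x (f a2 b2 (F x) + f a2 b2 (F' x)))%E.
    rewrite ge0_integralD//.
    by congr (_ + _)%E; exact: (gauss_law gF gF' (mf _ _) (f0 _ _)).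
  have two' : (\int[P]_x h (F x i0, F x i1) + \int[P]_x h (F x i0, F x i1) <=
      K a2 b2 + K a2 b2)%E.
    rewrite two -ge0_integralD//; apply: ge0_le_integral => //.
    - by move=> x _; rewrite adde_ge0.
    - exact: emeasurable_funD.
    - exact: emeasurable_funD.
    move=> x _; rewrite !fE /h /F' /givens -!EFinD lee_fin/=.
    rewrite !eqxx eq_sym (negbTE i01).
    set w0 := F x i0; set w1 := F x i1.
    set u := (a2 i0 * w0) ^+ 2 + _ ; set v := (a2 i0 * _) ^+ 2 + _ .
    have uv : u + v = 2 * (s * ((w0 ^+ 2 + w1 ^+ 2) / 2)).
      by rewrite /u /v sE; field.
    move: uv; move: (s * _) => m uv.
    have : 0 <= Num.max 0 (u - t) by rewrite le_max lexx.
    have : 0 <= Num.max 0 (v - t) by rewrite le_max lexx.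
    have : u - t <= Num.max 0 (u - t) by rewrite le_max lexx orbT.
    have : v - t <= Num.max 0 (v - t) by rewrite le_max lexx orbT.
    by have [] := leP 0 (m - t); lra.
  have dbl (y : \bar R) : (y + y = 2%:E * y)%E by rewrite mule_natl.
  by rewrite !dbl lee_pmul2l in two'.
apply: le_trans half.
pose e (u : unit + unit) := if u is inl _ then i0 else i1.
have einj : injective e.
  by move=> [[]|[]] [[]|[]]//= /eqP; rewrite ?[i1 == i0]eq_sym (negbTE i01).
have gFe : gauss_map P (fun x => (fun u => F x (e u)) : vect (unit + unit)%type).
  exact: (gauss_sub einj _ gF).
have g1 := @gauss_normal R unit card_unit.
pose h' (w : vect (unit + unit)%type) := h (w (inl tt), w (inr tt)).
have mh' : measurable_fun setT h'.
  apply: (measurableT_comp mh).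
  by apply/measurable_fun_pairP; split; exact: measurable_coord.
have := gauss_law gFe (gauss_join g1 g1) mh' (fun w => h0 _).
rewrite /h'/= => ->.
have := @fubini_tonelli1 _ _ _ _ R (gam R) (gam R) h mh h0.
have := gauss2_tail s0 t0.
by rewrite /fubini_F => le1 E1; apply: le_trans le1 _; rewrite -E1.
Qed.

End reduction.

(** * Gaussian integrals, coordinate by coordinate and column by column *)

Section gauss_integrals.
Context {R : realType}.
Local Notation vect I := (vect R I).

(** The summand x^2 / 2 cancels the exponent of the gaussian density; what is left is, up to a
    constant, the normal density with mean -b / m and variance 1 / m. *)
Lemma gam_exp (m b : R) : 0 < m ->
  (\int[gam R]_x (expR (x ^+ 2 / 2 - m * x ^+ 2 / 2 - b * x))%:E =
   ((Num.sqrt m)^-1 * expR (b ^+ 2 / (2 * m)))%:E)%E.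
Proof.
move=> m0.
have mf : measurable_fun setT
    (fun x : R => (expR (x ^+ 2 / 2 - m * x ^+ 2 / 2 - b * x))%:E).
  apply/measurable_EFinP; apply: measurableT_comp => //.
  apply: measurable_funB; last exact: measurable_funM.
  have mX : measurable_fun setT (fun x : R => x ^+ 2) by exact: measurable_funX.
  by apply: measurable_funB; do !apply: measurable_funM => //.
rewrite integral_gam//.
pose s : R := (Num.sqrt m)^-1.
have s0 : 0 < s by rewrite invr_gt0 sqrtr_gt0.
have s2 : s ^+ 2 = m^-1 by rewrite exprVn sqr_sqrtr// ltW.
have peakE : normal_peak 1 = s * normal_peak s.
  rewrite /normal_peak expr1n -!mulrnAr mul1r sqrtrM ?sqr_ge0//.
  by rewrite sqrtr_sqr gtr0_norm// invfM mulrA mulfV ?mul1r// gt_eqF.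
pose c := s * expR (b ^+ 2 / (2 * m)).
have c0 : (0 <= c%:E)%E by rewrite lee_fin mulr_ge0 ?expR_ge0// ltW.
transitivity (\int[lebesgue_measure]_x (c%:E * (normal_pdf (- b / m) s x)%:E))%E.
  apply: eq_integral => x _; rewrite -!EFinM; congr EFin.
  rewrite pdfE normal_pdfE ?gt_eqF// peakE /normal_fun s2 /c.
  have -> : expR (b ^+ 2 / (2 * m)) = expR (x ^+ 2 / 2 - m * x ^+ 2 / 2 - b * x)
    * expR (- x ^+ 2 / 2) / expR (- (x - - b / m) ^+ 2 / (m^-1 *+ 2)).
    rewrite -expRD -expRB; congr expR; field.
    by rewrite gt_eqF.
  by field; rewrite gt_eqF// expR_gt0.
have mpdf : measurable_fun setT (fun x => (normal_pdf (- b / m) s x)%:E).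
  by apply/measurable_EFinP; exact: measurable_normal_pdf.
apply: etrans (@ge0_integralZl _ _ R (@lebesgue_measure R) setT measurableT _ mpdf _ _ c0) _.
  by move=> x _; rewrite lee_fin normal_pdf_ge0.
by rewrite integral_normal_pdf ?gt_eqF// mule1.
Qed.

Definition vcons n (x : R) (y : 'I_n -> R) : 'I_n.+1 -> R :=
  fun i => if unlift ord0 i is Some j then y j else x.

Lemma gauss_consE d (T : measurableType d) (P : probability T R)
    d' (T' : measurableType d') (P' : probability T' R) n
    (F : T -> vect 'I_n.+1) (F' : T' -> vect 'I_n) (f : vect 'I_n.+1 -> \bar R) :
  gauss_map P F -> gauss_map P' F' -> measurable_fun setT f ->
  (forall w, 0 <= f w)%E ->
  (\int[P]_x f (F x) = \int[P']_y \int[gam R]_x f (vcons x (F' y)))%E.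
Proof.
move=> gF gF' mf f0.
have g1 := @gauss_normal R unit card_unit.
pose G (z : R * T') : vect 'I_n.+1 := vcons z.1 (F' z.2).
have gG : gauss_map (gam R \x P')%E G.
  apply: (gauss_sub (e := fun i : 'I_n.+1 =>
    if unlift ord0 i is Some j then inr j else inl tt) _ _ (gauss_join g1 gF')).
    move=> i j; case: unliftP => [i' ->|->]; case: unliftP => [j' ->|->] //.
    by case=> ->.
  by move=> z i; rewrite /G /vcons; case: unliftP.
have mG : measurable_fun setT G by case: gG.
rewrite (gauss_law gF gG mf f0).
have mfG : measurable_fun setT (f \o G) by exact: measurableT_comp.
exact: (@fubini_tonelli2 _ _ _ _ R (gam R) P' (f \o G) mfG (fun z => f0 (G z))).
Qed.

Lemma emeasurable_prod d (T : measurableType d) n (f : 'I_n -> T -> \bar R) :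
  (forall j, measurable_fun setT (f j)) ->
  measurable_fun setT (fun x => \prod_(j < n) f j x)%E.
Proof.
elim: n f => [|n IHn] f mf.
  by rewrite (_ : (fun x => _) = cst 1%E)//; apply/funext => x; rewrite big_ord0.
rewrite (_ : (fun x => _) =
    (fun x => f ord0 x * \prod_(j < n) f (lift ord0 j) x)%E).
  by apply: emeasurable_funM => //; exact: IHn.
by apply/funext => x; rewrite big_ord_recl.
Qed.

(** The columns of a gaussian matrix are independent and identically distributed, so a product over
    them integrates to a product. The first column is moved to a space of its own. *)
Lemma gauss_prodE d (T : measurableType d) (P : probability T R)
    d' (T' : measurableType d') (P' : probability T' R) (I : finType) n
    (F : T -> vect (I * 'I_n)%type) (F' : T' -> vect I) (f : vect I -> \bar R) :
  gauss_map P F -> gauss_map P' F' -> measurable_fun setT f ->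
  (forall w, 0 <= f w)%E ->
  (\int[P]_x \prod_(j < n) f (fun i => F x (i, j)) =
   \prod_(j < n) \int[P']_y f (F' y))%E.
Proof.
move=> gF gF' mf f0.
elim: n d T P F gF => [|n IHn] d T P F gF.
  rewrite big_ord0; under eq_integral do rewrite big_ord0.
  rewrite integral_cst// mul1e; exact: probability_setT.
have [d1 [T1 [P1 [F1 gF1]]]] := @gauss_exists R (I * 'I_n)%type.
pose G (z : T' * T1) : vect (I * 'I_n.+1)%type := fun ij =>
  if unlift ord0 ij.2 is Some j then F1 z.2 (ij.1, j) else F' z.1 ij.1.
have gG : gauss_map (P' \x P1)%E G.
  apply: (gauss_sub (e := fun ij : I * 'I_n.+1 =>
    if unlift ord0 ij.2 is Some j then inr (ij.1, j) else inl ij.1) _ _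
      (gauss_join gF' gF1)).
    move=> [i j] [i' j']/=; case: unliftP => [k ->|->];
    case: unliftP => [k' ->|->] //; [by case=> -> ->|by case=> ->].
  by move=> z i; rewrite /G; case: unliftP.
have mG : measurable_fun setT G by case: gG.
have mcol k (j : 'I_k) : measurable_fun setT
    (fun w : vect (I * 'I_k)%type => (fun i => w (i, j)) : vect I).
  by apply: measurable_vect => i; exact: measurable_coord.
pose h k (w : vect (I * 'I_k)%type) := (\prod_(j < k) f (fun i => w (i, j)))%E.
have h0 k w : (0 <= h k w)%E by apply: prode_ge0 => j _; exact: f0.
have mh k : measurable_fun setT (h k).
  by apply: emeasurable_prod => j; exact: (measurableT_comp mf (mcol k j)).
rewrite (gauss_law gF gG (mh _) (h0 _)).
have mhG : measurable_fun setT (@h n.+1 \o G) by exact: measurableT_comp.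
rewrite (@fubini_tonelli1 _ _ _ _ R P' P1 _ mhG (fun z => h0 _ (G z))).
have mF1 : measurable_fun setT (fun y => h n (F1 y)).
  by apply: (measurableT_comp (mh n)); case: gF1.
have mF' : measurable_fun setT (fun y => f (F' y)).
  by apply: (measurableT_comp mf); case: gF'.
have E1 x : (\int[P1]_y (h n.+1 (G (x, y))) =
    (\int[P1]_y h n (F1 y)) * f (F' x))%E.
  rewrite muleC.
  rewrite -(@ge0_integralZl _ _ R P1 setT measurableT _ mF1 _ (fun y _ => h0 _ _) (f0 _)).
  apply: eq_integral => y _; rewrite /h big_ord_recl /G/= unlift_none.
  congr (_ * _)%E; apply: eq_bigr => j _; congr f.
  by apply/funext => i; rewrite liftK.
have KI0 : (0 <= \int[P1]_y h n (F1 y))%E by exact: integral_ge0.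
transitivity (\int[P']_x ((\int[P1]_y h n (F1 y)) * f (F' x)))%E.
  by apply: eq_integral => x _; exact: E1.
rewrite (@ge0_integralZl _ _ R P' setT measurableT _ mF' _ (fun y _ => f0 _) KI0).
by rewrite (IHn _ _ _ _ gF1) muleC big_ord_recl.
Qed.

End gauss_integrals.

(** * Linear algebra *)

Local Open Scope complex_scope.
Local Open Scope sesquilinear_scope.
Local Open Scope ring_scope.

Section posdef.
Context {R : rcfType}.
Local Notation C := R[i].

Lemma trmxC_mul m n p (A : 'M[C]_(m, n)) (B : 'M[C]_(n, p)) :
  (A *m B) ^t* = B ^t* *m A ^t*.
Proof. by rewrite trmx_mul map_mxM. Qed.

Lemma trmxCE m n (A : 'M[C]_(m, n)) i j : (A ^t*) i j = (A j i)^*.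
Proof. by rewrite !mxE. Qed.

Definition posdef n (M : 'M[C]_n) :=
  M ^t* = M /\ forall x : 'rV[C]_n, x != 0 -> 0 < (x *m M *m x ^t*) 0 0.

Definition schur n (M : 'M[C]_(1 + n)) : 'M[C]_n :=
  drsubmx M - (M 0 0)^-1 *: (dlsubmx M *m ursubmx M).

(** One step of block elimination. The form of the Schur complement at y is the form of M at the row
    (x, y), with x chosen to annihilate the first block. *)
Lemma posdef_schur n (M : 'M[C]_(1 + n)) : posdef M ->
  let S := schur M in
  [/\ 0 < M 0 0, posdef S & \det M = M 0 0 * \det S].
Proof.
move=> [MH Mpos] S; set a := M 0 0.
have a0 : 0 < a.
  pose e : 'rV[C]_(1 + n) := delta_mx 0 0.
  have := Mpos e; rewrite -rowE.
  have -> : (row 0 M *m e ^t*) 0 0 = a.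
    rewrite mxE (bigD1 ord0)//= big1 ?addr0.
      by rewrite /e !mxE !eqxx/= rmorph1 mulr1.
    by move=> i /negbTE i0; rewrite /e !mxE i0 andbF/= rmorph0 mulr0.
  apply; apply/eqP => /matrixP/(_ 0 0); rewrite /e !mxE !eqxx => /eqP.
  by rewrite oner_eq0.
have an0 : a != 0 by rewrite gt_eqF.
have aC : a^* = a by rewrite /a -trmxCE MH.
set b := ursubmx M; set c := dlsubmx M; set D := drsubmx M.
have cb : c = b ^t*.
  by apply/matrixP => i j; rewrite trmxCE !mxE -trmxCE MH.
have ME : M = block_mx (a%:M) b c D.
  rewrite -[LHS]submxK; congr block_mx; apply/matrixP => i j.
  by rewrite !ord1 !mxE eqxx mulr1n /a; congr (M _ _); apply/val_inj.
have SE : S = D - a^-1 *: (c *m b) by [].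
split=> //; last first.
  rewrite {1}ME.
  have -> : block_mx a%:M b c D = block_mx 1%:M 0 (a^-1 *: c) 1%:M *m
      block_mx a%:M b 0 S.
    rewrite mulmx_block !mul1mx !mul0mx !addr0; congr block_mx.
      by rewrite mul_mx_scalar scalerA mulfV// scale1r.
    by rewrite SE -scalemxAl addrC subrK.
  by rewrite det_mulmx det_lblock det_ublock !det1 !mul1r det_scalar1.
split.
  rewrite SE; apply/matrixP => i j.
  have DH i' j' : (D j' i')^* = D i' j' by rewrite !mxE -trmxCE MH.
  rewrite trmxCE !mxE rmorphB rmorphM fmorphV/= aC; congr (_ - _ * _).
    by have := DH i j; rewrite !mxE.
  rewrite rmorph_sum/=; apply: eq_bigr => k _; rewrite rmorphM/= cb !trmxCE mulrC.
  by rewrite conjCK.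
move=> y y0.
pose x : 'rV[C]_1 := - a^-1 *: (y *m c).
have xy0 : row_mx x y != 0.
  by apply: contraNneq y0; rewrite -row_mx0 => /eq_row_mx[_ ->].
have := Mpos _ xy0; rewrite {1}ME.
have -> : (row_mx x y) ^t* = col_mx (x ^t*) (y ^t*).
  by rewrite tr_row_mx map_col_mx.
rewrite mul_row_block mul_row_col.
have -> : x *m a%:M + y *m c = 0.
  by rewrite mul_mx_scalar scalerA mulrN mulfV// scaleN1r addNr.
rewrite mul0mx add0r.
have -> : x *m b + y *m D = y *m S.
  by rewrite SE mulmxBr addrC -scalemxAl scaleNr -scalemxAr mulmxA.
by [].
Qed.

Lemma posdef_det n (M : 'M[C]_n) : posdef M -> 0 < \det M.
Proof.
elim: n M => [|n IHn] M pM; first by rewrite det_mx00 ltr01.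
have [a0 pS ->] := @posdef_schur n M pM.
by rewrite mulr_gt0// IHn.
Qed.

Definition qf n (M : 'M[C]_n) (g : 'I_n -> R) : R :=
  \sum_i \sum_j complex.Re (M i j) * (g i * g j).

(** Eliminating the first coordinate of the complex form subtracts the squares of both the real part
    b and the imaginary part b' of the first row applied to y, while integrating over one real
    coordinate gives back b^2 / a only. The square of b' is discarded, so the determinant bound for
    gaussian integrals becomes an inequality. *)
Lemma qf_schur n (M : 'M[C]_(1 + n)) (g : 'I_n.+1 -> R) : posdef M ->
  let S := schur M in
  let a := complex.Re (M 0 0) in
  let y j := g (lift ord0 j) in
  exists b, b = \sum_j complex.Re (M 0 (lift ord0 j)) * y j /\
    qf M g = a * g ord0 ^+ 2 + 2 * b * g ord0 + qf (drsubmx M) y /\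
    qf S y + b ^+ 2 / a <= qf (drsubmx M) y.
Proof.
move=> pM S a y; have [a0 _ _] := posdef_schur pM.
have [MH _] := pM.
have ReMC i j : complex.Re (M i j) = complex.Re (M j i).
  by rewrite -[in LHS]MH trmxCE; case: (M j i).
have aE : M 0 0 = a%:C.
  by move: a0; rewrite /a; case: (M 0 0) => u v; rewrite ltcE/= => /andP[/eqP-> _].
have a_gt0 : 0 < a by move: a0; rewrite aE ltcR.
exists (\sum_j complex.Re (M 0 (lift ord0 j)) * y j); split=> //; split.
  rewrite /qf big_ord_recl big_ord_recl -!addrA; congr (_ + _).
  have -> : \sum_(j < n) complex.Re (M ord0 (lift ord0 j)) *
      (g ord0 * g (lift ord0 j)) =
      (\sum_j complex.Re (M 0 (lift ord0 j)) * y j) * g ord0.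
    by rewrite mulr_suml; apply: eq_bigr => j _; rewrite /y; ring.
  set b := \sum_j complex.Re (M 0 _) * y j.
  have -> : \sum_(i < n) \sum_(j < n.+1) complex.Re (M (lift ord0 i) j) *
      (g (lift ord0 i) * g j) = b * g ord0 + qf (drsubmx M) y.
    rewrite /b mulr_suml -big_split; apply: eq_bigr => i _ /=.
    rewrite big_ord_recl ReMC; congr (_ + _); first by rewrite /y; ring.
    by apply: eq_bigr => j _; rewrite !mxE !rshift1.
  by rewrite /qf; ring.
set b := \sum_j _.
pose b' := \sum_j complex.Im (M 0 (lift ord0 j)) * y j.
have -> : qf (drsubmx M) y = qf S y + b ^+ 2 / a + b' ^+ 2 / a.
  have qfB (A B : 'M[C]_n) : qf (A - B) y = qf A y - qf B y.
    rewrite /qf -sumrB; apply: eq_bigr => i _; rewrite -sumrB.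
    by apply: eq_bigr => j _; rewrite !mxE raddfB mulrBl.
  suff -> : qf S y = qf (drsubmx M) y - (b ^+ 2 / a + b' ^+ 2 / a).
    by rewrite -addrA subrK.
  rewrite /S /schur qfB; congr (_ - _).
  rewrite -mulrDl !expr2 /b /b' !mulr_suml -big_split/= mulr_suml.
  apply: eq_bigr => i _; rewrite !mulr_sumr -big_split/= mulr_suml.
  apply: eq_bigr => j _.
  rewrite !mxE big_ord_recl big_ord0 addr0 !mxE !rshift1.
  have -> : M (lift ord0 i) (lshift n 0) = (M 0 (lift ord0 i))^*.
    rewrite -trmxCE MH; congr (M _ _); exact/val_inj.
  have -> : M (lshift n 0) (lift ord0 j) = M 0 (lift ord0 j).
    by congr (M _ _); exact/val_inj.
  rewrite aE; case: (M 0 (lift ord0 i)) => u v; case: (M 0 (lift ord0 j)) => u' v'.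
  by rewrite /=; field; rewrite gt_eqF.
by rewrite lerDl divr_ge0 ?sqr_ge0// ltW.
Qed.
End posdef.

(** * The determinant bound *)

Section gauss_quadratic.
Context {R : realType}.
Local Notation C := R[i].
Local Notation vect I := (vect R I).

Lemma measurable_qf n (M : 'M[C]_n) : measurable_fun setT (qf M : vect 'I_n -> R).
Proof.
apply: measurable_sum => i; apply: measurable_sum => j.
by apply: measurable_funM => //; apply: measurable_funM; exact: measurable_coord.
Qed.

(** The squared norm compensates the gaussian weight, so that the expectation is a normalised
    Lebesgue integral of exp (- qf M w / 2). *)
Definition gint n (M : 'M[C]_n) (w : 'I_n -> R) : \bar R :=
  (expR ((\sum_i w i ^+ 2 - qf M w) / 2))%:E.

Lemma measurable_gint n (M : 'M[C]_n) :
  measurable_fun setT (gint M : vect 'I_n -> \bar R).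
Proof.
apply/measurable_EFinP; apply: measurableT_comp => //.
apply: measurable_funM => //; apply: measurable_funB; last exact: measurable_qf.
by apply: measurable_sum => i; apply: measurable_funX; exact: measurable_coord.
Qed.

Lemma gint_ge0 n (M : 'M[C]_n) w : (0 <= gint M w)%E.
Proof. by rewrite lee_fin expR_ge0. Qed.

(* Integrating out the first coordinate replaces M by its Schur complement. *)
Lemma gauss_qf_le n (M : 'M[C]_n) d (T : measurableType d) (P : probability T R)
    (F : T -> vect 'I_n) : posdef M -> gauss_map P F ->
  (\int[P]_x gint M (F x) <= ((Num.sqrt (complex.Re (\det M)))^-1)%:E)%E.
Proof.
elim: n M d T P F => [|n IHn] M d T P F pM gF.
  rewrite det_mx00/= sqrtr1 invr1.
  rewrite (_ : (\int[P]_x _)%E = (\int[P]_x (cst 1%E x))%E); last first.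
    by apply: eq_integral => x _; rewrite /gint /qf !big_ord0 subr0 mul0r expR0.
  by rewrite integral_cst// mul1e; apply: probability_le1.
have [d1 [T1 [P1 [F1 gF1]]]] := @gauss_exists R 'I_n.
rewrite (gauss_consE gF gF1 (@measurable_gint _ M) (gint_ge0 M)).
have [a0 pS detE] := @posdef_schur _ n M pM.
set S := schur _ in pS detE.
set a := complex.Re (M 0 0).
have aE : M 0 0 = a%:C.
  by move: a0; rewrite /a; case: (M 0 0) => u v; rewrite ltcE/= => /andP[/eqP-> _].
have a_gt0 : 0 < a by move: a0; rewrite aE ltcR.
have detS := posdef_det pS.
have detSE : \det S = (complex.Re (\det S))%:C.
  by move: detS; case: (\det S) => u v; rewrite ltcE/= => /andP[/eqP-> _].
have detS_gt0 : 0 < complex.Re (\det S).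
  by move: detS; rewrite {1}detSE ltcR.
rewrite detE detSE aE.
have -> : complex.Re (a%:C * (complex.Re (\det S))%:C) = a * complex.Re (\det S).
  by rewrite /= mul0r subr0.
rewrite (sqrtrM _ (ltW a_gt0)) invfM EFinM.
have mg1 : measurable_fun setT (fun y => gint S (F1 y)).
  by apply: (measurableT_comp (measurable_gint S)); case: gF1.
have s0 : (0 <= ((Num.sqrt a)^-1)%:E)%E by rewrite lee_fin invr_ge0 sqrtr_ge0.
apply: le_trans (lee_wpmul2l s0 (IHn S _ _ _ _ pS gF1)).
rewrite -(@ge0_integralZl _ _ R P1 setT measurableT _ mg1 _
  (fun y _ => gint_ge0 S _) s0).
have mcons : measurable_fun setT (fun z : T1 * R => gint M (vcons z.2 (F1 z.1))).
  apply: (measurableT_comp (@measurable_gint _ M)).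
  apply: measurable_vect => i; rewrite /vcons.
  case: (unlift ord0 i) => [j|]; last exact: measurable_snd.
  apply: (measurableT_comp (gauss_measurable j gF1)); exact: measurable_fst.
apply: ge0_le_integral.
- exact: measurableT.
- by move=> y _; apply: integral_ge0 => x _; exact: gint_ge0.
- exact: (@measurable_fun_fubini_tonelli_F _ _ _ _ R (gam R) _ mcons
    (fun z => gint_ge0 M _)).
- by apply: emeasurable_funM.
move=> y _.
have vc0 x : vcons x (F1 y) ord0 = x by rewrite /vcons unlift_none.
have vcl x j : vcons x (F1 y) (lift ord0 j) = F1 y j by rewrite /vcons liftK.
have [b [bE _]] := @qf_schur R n M (vcons 0 (F1 y)) pM.
pose e : R := expR ((\sum_j F1 y j ^+ 2 - qf (drsubmx (M : 'M[C]_(1 + n))) (F1 y)) / 2).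
have gE x : gint M (vcons x (F1 y)) =
    (e%:E * (expR (x ^+ 2 / 2 - a * x ^+ 2 / 2 - b * x))%:E)%E.
  have [b' [b'E [qE _]]] := @qf_schur R n M (vcons x (F1 y)) pM.
  have bb : b' = b.
    by rewrite b'E bE; apply: eq_bigr => j _; rewrite !vcl.
  rewrite /gint -EFinM -expRD; congr (expR _)%:E.
  rewrite qE bb big_ord_recl vc0 -/a.
  under eq_bigr do rewrite vcl.
  have -> : (fun j => vcons x (F1 y) (lift ord0 j)) = F1 y.
    by apply/funext => j; rewrite vcl.
  by field.
have me : measurable_fun setT
    (fun x : R => (expR (x ^+ 2 / 2 - a * x ^+ 2 / 2 - b * x))%:E).
  have mX : measurable_fun setT (fun x : R => x ^+ 2) by exact: measurable_funX.
  apply/measurable_EFinP; apply: measurableT_comp => //.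
  apply: measurable_funB; last exact: measurable_funM.
  by apply: measurable_funB; do !apply: measurable_funM => //.
have e0 : (0 <= e%:E)%E by rewrite lee_fin expR_ge0.
have -> : (\int[gam R]_x gint M (vcons x (F1 y)) =
    e%:E * \int[gam R]_x (expR (x ^+ 2 / 2 - a * x ^+ 2 / 2 - b * x))%:E)%E.
  apply: etrans (@ge0_integralZl _ _ R (gam R) setT measurableT _ me _ _ e0).
    by apply: eq_integral => x _; exact: gE.
  by move=> x _; rewrite lee_fin expR_ge0.
rewrite gam_exp// -EFinM /gint -EFinM lee_fin mulrCA ler_pM2l ?invr_gt0 ?sqrtr_gt0//.
rewrite /e -expRD ler_expR.
have [b' [b'E [_]]] := @qf_schur R n M (vcons 0 (F1 y)) pM.
have -> : (fun j => vcons 0 (F1 y) (lift ord0 j)) = F1 y.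
  by apply/funext => j; rewrite vcl.
rewrite -/S -/a b'E -bE => le1.
have -> : b ^+ 2 / (2 * a) = (b ^+ 2 / a) / 2 by field; rewrite gt_eqF.
by move: le1; move: (b ^+ 2 / a) => u; lra.
Qed.

End gauss_quadratic.

Section hermitian.
Context {R : rcfType}.
Local Notation C := R[i].

Lemma trmxCK m n (A : 'M[C]_(m, n)) : A ^t* ^t* = A.
Proof. by apply/matrixP => i j; rewrite !trmxCE conjCK. Qed.

Lemma trmxCD m n (A B : 'M[C]_(m, n)) : (A + B) ^t* = A ^t* + B ^t*.
Proof. by apply/matrixP => i j; rewrite !mxE rmorphD. Qed.

Lemma trmxCB m n (A B : 'M[C]_(m, n)) : (A - B) ^t* = A ^t* - B ^t*.
Proof. by apply/matrixP => i j; rewrite !mxE rmorphB. Qed.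

Lemma trmxCZ m n (a : C) (A : 'M[C]_(m, n)) : (a *: A) ^t* = a^* *: A ^t*.
Proof. by apply/matrixP => i j; rewrite !mxE rmorphM. Qed.

Lemma trmxC1 n : (1%:M : 'M[C]_n) ^t* = 1%:M.
Proof. by rewrite trmx1 map_mx1. Qed.

Lemma det_trmxC n (A : 'M[C]_n) : \det (A ^t*) = (\det A)^*.
Proof. by rewrite det_map_mx det_tr. Qed.

Definition dotc n (x y : 'rV[C]_n) : C := (x *m y ^t*) 0 0.

Lemma dotcBl n (x x' y : 'rV[C]_n) : dotc (x - x') y = dotc x y - dotc x' y.
Proof. by rewrite /dotc mulmxBl [LHS]mxE [X in _ + X = _]mxE. Qed.

Lemma dotcZl n a (x y : 'rV[C]_n) : dotc (a *: x) y = a * dotc x y.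
Proof. by rewrite /dotc -scalemxAl [LHS]mxE. Qed.

Lemma dotcC n (x y : 'rV[C]_n) : dotc y x = (dotc x y)^*.
Proof. by rewrite /dotc -trmxCE trmxC_mul trmxCK. Qed.

Lemma dotcBr n (x y y' : 'rV[C]_n) : dotc x (y - y') = dotc x y - dotc x y'.
Proof. by rewrite dotcC dotcBl rmorphB/= -!dotcC. Qed.

Lemma dotcZr n a (x y : 'rV[C]_n) : dotc x (a *: y) = a^* * dotc x y.
Proof. by rewrite dotcC dotcZl rmorphM/= -dotcC. Qed.

Definition nrm2 n (x : 'rV[C]_n) : C := (x *m x ^t*) 0 0.

Lemma nrm2E n (x : 'rV[C]_n) : nrm2 x = \sum_j `|x 0 j| ^+ 2.
Proof.
rewrite /nrm2 mxE; apply: eq_bigr => j _.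
by rewrite trmxCE normCK.
Qed.

Lemma nrm2_ge0 n (x : 'rV[C]_n) : 0 <= nrm2 x.
Proof. by rewrite nrm2E sumr_ge0// => j _; rewrite exprn_ge0. Qed.

Lemma nrm2_eq0 n (x : 'rV[C]_n) : (nrm2 x == 0) = (x == 0).
Proof.
apply/idP/eqP => [|->]; last by rewrite /nrm2 mul0mx mxE.
rewrite nrm2E psumr_eq0; last by move=> j _; rewrite exprn_ge0.
move=> /allP x0; apply/rowP => j; apply/eqP.
by have := x0 j (mem_index_enum _); rewrite /= sqrf_eq0 normr_eq0 mxE.
Qed.

Lemma nrm2_gt0 n (x : 'rV[C]_n) : (0 < nrm2 x) = (x != 0).
Proof. by rewrite lt_def nrm2_ge0 andbT nrm2_eq0. Qed.

Lemma cauchy_schwarz n (x y : 'rV[C]_n) :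
  `|(x *m y ^t*) 0 0| ^+ 2 <= nrm2 x * nrm2 y.
Proof.
have [->|y0] := eqVneq y 0.
  by rewrite /nrm2 linear0 map_mx0 !mulmx0 !mxE normr0 expr0n mulr0.
have ny : 0 < nrm2 y by rewrite nrm2_gt0.
set s := (x *m y ^t*) 0 0; rewrite -[s]/(dotc x y).
have nyC : (nrm2 y)^* = nrm2 y by apply/CrealP; rewrite realE ltW.
have : 0 <= nrm2 (nrm2 y *: x - s *: y) by exact: nrm2_ge0.
have -> : nrm2 (nrm2 y *: x - s *: y) =
    nrm2 y * (nrm2 x * nrm2 y - `|dotc x y| ^+ 2).
  rewrite [LHS](_ : _ = dotc (nrm2 y *: x - s *: y) (nrm2 y *: x - s *: y))//.
  rewrite !(dotcBl, dotcBr, dotcZl, dotcZr) nyC (dotcC x y) normCK.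
  rewrite -[s]/(dotc x y) -[dotc x x]/(nrm2 x) -[dotc y y]/(nrm2 y); ring.
by rewrite pmulr_rge0// subr_ge0.
Qed.

(** One block matrix is factored in two ways, eliminating either diagonal block. *)
Lemma sylvester m n (A : 'M[C]_(m, n)) (B : 'M[C]_(n, m)) :
  \det (1%:M - A *m B) = \det (1%:M - B *m A).
Proof.
pose X := block_mx (1%:M : 'M[C]_n) B A (1%:M : 'M[C]_m).
have X1 : X = block_mx 1%:M 0 A 1%:M *m block_mx 1%:M B 0 (1%:M - A *m B).
  rewrite mulmx_block !mul1mx !mul0mx !mulmx1 !addr0 ?mulmx0 ?addr0.
  by rewrite addrC subrK.
have X2 : X = block_mx (1%:M - B *m A) B 0 1%:M *m block_mx 1%:M 0 A 1%:M.
  rewrite mulmx_block !mul0mx !mulmx1 ?mulmx0 !mul1mx !add0r.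
  by rewrite subrK.
have := X1; rewrite [in LHS]X2 => /(congr1 determinant).
by rewrite !det_mulmx !det_lblock !det_ublock !det1 !mul1r !mulr1 => ->.
Qed.

End hermitian.

Section adjugate_inverse.
Context {R : rcfType}.
Local Notation C := R[i].

(* The inverse of S, continued by 0 to singular S. *)
Definition pinvd k (S : 'M[C]_k) : 'M[C]_k := (\det S)^-1 *: \adj S.

Lemma pinvd_singular k (S : 'M[C]_k) : \det S = 0 -> pinvd S = 0.
Proof. by rewrite /pinvd => ->; rewrite invr0 scale0r. Qed.

Lemma mul_pinvd k (S : 'M[C]_k) : \det S != 0 -> pinvd S *m S = 1%:M.
Proof.
by move=> S0; rewrite -scalemxAl mul_adj_mx scale_scalar_mx mulVf.
Qed.

Lemma mulV_pinvd k (S : 'M[C]_k) : \det S != 0 -> S *m pinvd S = 1%:M.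
Proof.
by move=> S0; rewrite -scalemxAr mul_mx_adj scale_scalar_mx mulVf.
Qed.

Lemma pinvd_mulV k (S : 'M[C]_k) : pinvd S *m S *m pinvd S = pinvd S.
Proof.
have [S0|S0] := eqVneq (\det S) 0; first by rewrite pinvd_singular// mulmx0.
by rewrite mul_pinvd// mul1mx.
Qed.

Lemma pinvd_herm k (S : 'M[C]_k) : S ^t* = S -> (pinvd S) ^t* = pinvd S.
Proof.
move=> SH; rewrite /pinvd trmxCZ fmorphV/= -det_trmxC SH; congr (_ *: _).
by rewrite trmx_adj map_mx_adj SH.
Qed.

End adjugate_inverse.

(** * Kernel projectors and their tilts *)

Section projection.
Context {R : rcfType}.
Local Notation C := R[i].

Definition gramm k d (O : 'M[C]_(k, d)) : 'M[C]_k := O *m O ^t*.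

(* The orthogonal projector onto the kernel of [O] if [gramm O] is regular. *)
Definition kproj k d (O : 'M[C]_(k, d)) : 'M[C]_d :=
  1%:M - O ^t* *m pinvd (gramm O) *m O.

Lemma gramm_herm k d (O : 'M[C]_(k, d)) : (gramm O) ^t* = gramm O.
Proof. by rewrite /gramm trmxC_mul trmxCK. Qed.

Lemma proj_herm k d (O : 'M[C]_(k, d)) : (kproj O) ^t* = kproj O.
Proof.
have := pinvd_herm (gramm_herm O); rewrite /kproj; move: (pinvd _) => X XH.
by rewrite trmxCB trmxC1 !trmxC_mul trmxCK XH mulmxA.
Qed.

Lemma proj_idem k d (O : 'M[C]_(k, d)) : kproj O *m kproj O = kproj O.
Proof.
have := pinvd_mulV (gramm O); rewrite /kproj; move: (pinvd _) => X XX.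
set P := O ^t* *m X *m O.
have PP : P *m P = P.
  rewrite /P -[in RHS]XX /gramm; move: (O ^t*) => B; rewrite !mulmxA.
  by [].
by move: P PP => P PP; rewrite mulmxBl mul1mx mulmxBr mulmx1 PP subrr subr0.
Qed.

Lemma mul_proj k d (O : 'M[C]_(k, d)) : \det (gramm O) != 0 -> O *m kproj O = 0.
Proof.
move=> O0; have := mulV_pinvd O0; rewrite /kproj /gramm; move: (pinvd _) => X OX.
by rewrite mulmxBr mulmx1 !mulmxA OX mul1mx subrr.
Qed.

Section tilted.
Variables (d : nat) (H : 'M[C]_d) (w : 'rV[C]_d).
Hypotheses (HH : H ^t* = H) (H2 : H *m H = H).

(** Three quarters of the component along w are removed from the form of H. By Cauchy-Schwarz a
    quarter remains, so positivity is kept and the determinant loses at most a factor 4, while 3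
    [tilt] may take the place of H in the bound of the residual. For w = 0 the coefficient is 0 and
    H is unchanged. *)
Definition tilt : 'M[C]_d :=
  H - (3 / 4 / nrm2 w) *: ((H *m w ^t*) *m (w *m H)).

Lemma proj_form (x : 'rV[C]_d) : (x *m H *m x ^t*) 0 0 = nrm2 (x *m H).
Proof. by rewrite /nrm2 trmxC_mul HH !mulmxA -[in RHS](mulmxA x) H2. Qed.

Lemma tilt_form (x : 'rV[C]_d) :
  (x *m tilt *m x ^t*) 0 0 =
  nrm2 (x *m H) - 3 / 4 / nrm2 w * `|dotc (x *m H) w| ^+ 2.
Proof.
rewrite /tilt; move: (3 / 4 / nrm2 w) => c.
rewrite mulmxBr mulmxBl [LHS]mxE proj_form; congr (_ + _).
rewrite [LHS]mxE -scalemxAr -scalemxAl [in LHS]mxE; congr (- (_ * _)).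
have -> : x *m (H *m w ^t* *m (w *m H)) *m x ^t* =
    (x *m (H *m w ^t*)) *m (w *m H *m x ^t*) by rewrite !mulmxA.
rewrite [LHS]mxE big_ord1 normCK; congr (_ * _); first by rewrite /dotc mulmxA.
by rewrite -dotcC /dotc trmxC_mul HH !mulmxA.
Qed.

Lemma tilt_form_ge (x : 'rV[C]_d) :
  4^-1 * nrm2 (x *m H) <= (x *m tilt *m x ^t*) 0 0.
Proof.
rewrite tilt_form.
have := cauchy_schwarz (x *m H) w; rewrite -[(_ *m w ^t*) 0 0]/(dotc _ w).
move: (nrm2_ge0 (x *m H)) (nrm2_ge0 w); move: (nrm2 _) (nrm2 w) => a b a0 b0.
move: (`|_| ^+ 2) => u CS.
have : 3 / 4 / b * u <= 3 / 4 * a.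
  have [->|b_n0] := eqVneq b 0.
    by rewrite invr0 mulr0 mul0r mulr_ge0.
  have bp : 0 < b by rewrite lt_def b_n0 b0.
  by rewrite -!mulrA ler_pM2l// ler_pM2l ?invr_gt0// mulrC ler_pdivrMr.
move: (_ * u) => e ea.
rewrite -subr_ge0; rewrite -subr_ge0 in ea; congr (0 <= _) : ea; by field.
Qed.

Lemma tilt_herm : tilt ^t* = tilt.
Proof.
have : (3 / 4 / nrm2 w)^* = 3 / 4 / nrm2 w.
  by apply/CrealP; rewrite realE mulr_ge0// ?invr_ge0 ?nrm2_ge0.
rewrite /tilt; move: (3 / 4 / nrm2 w) => c cC.
by rewrite trmxCB HH trmxCZ cC !trmxC_mul trmxCK HH.
Qed.

Lemma tilt_posdef (s : C) : 0 <= s -> posdef (1%:M + s *: tilt).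
Proof.
move=> s0; have sC : s^* = s by apply/CrealP; rewrite realE s0.
have := tilt_form_ge; have := tilt_herm; move: tilt => N NH N_ge.
split; first by rewrite trmxCD trmxC1 trmxCZ NH sC.
move=> x x0; rewrite mulmxDr mulmx1 mulmxDl [X in _ < X]mxE.
rewrite -[X in X + _]/(nrm2 x) ltr_wpDr ?nrm2_gt0//.
rewrite -scalemxAr -scalemxAl mxE mulr_ge0//.
by apply: le_trans (N_ge x); rewrite mulr_ge0 ?nrm2_ge0.
Qed.

Lemma nrm2_proj_le : nrm2 (w *m H) <= nrm2 w.
Proof.
rewrite -proj_form -subr_ge0.
have -> : nrm2 w - (w *m H *m w ^t*) 0 0 = nrm2 (w - w *m H).
  rewrite /nrm2 trmxCB trmxC_mul HH mulmxBr !mulmxBl.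
  rewrite !mulmxA -[w *m H *m H]mulmxA H2 subrr subr0.
  by rewrite [RHS]mxE [X in _ = _ + X]mxE.
exact: nrm2_ge0.
Qed.

(* The rank-one tilt costs a factor of at least 1/4: with M = 1 + s H one has
   M (1 - (b / (1 + s)) a a^H) = M - b a a^H for a = H w^H. *)
Lemma tilt_det (s : C) : 0 <= s ->
  4^-1 * \det (1%:M + s *: H) <= \det (1%:M + s *: tilt).
Proof.
move=> s0; have s1 : 0 < 1 + s by rewrite ltr_pwDl.
pose c := s * (3 / 4 / nrm2 w) / (1 + s).
have -> : 1%:M + s *: tilt = (1%:M + s *: H) *m
    (1%:M - (c *: (H *m w ^t*)) *m (w *m H)).
  rewrite /tilt /c; move: (3 / 4 / nrm2 w) => e.
  rewrite mulmxBr mulmx1 scalerBr -addrA; congr (_ + (_ - _)).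
  rewrite -[in RHS]scalemxAl; set B := H *m w ^t* *m (w *m H).
  have HB : H *m B = B by rewrite /B !mulmxA H2.
  move: B HB => B HB; rewrite -scalemxAr mulmxDl mul1mx -scalemxAl HB.
  rewrite -{2}[B]scale1r -scalerDl !scalerA; congr (_ *: _).
  by rewrite divfK// gt_eqF.
have dM : 0 < \det (1%:M + s *: H).
  apply: posdef_det; split.
    by rewrite trmxCD trmxC1 trmxCZ HH; congr (_ + _ *: _); apply/CrealP; rewrite realE s0.
  move=> x x0; rewrite mulmxDr mulmx1 mulmxDl [X in _ < X]mxE.
  rewrite -[X in X + _]/(nrm2 x) ltr_wpDr ?nrm2_gt0//.
  by rewrite -scalemxAr -scalemxAl mxE proj_form mulr_ge0 ?nrm2_ge0.
rewrite det_mulmx sylvester mulrC ler_pM2l//.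
have -> : w *m H *m (c *: (H *m w ^t*)) = (c * nrm2 (w *m H))%:M.
  rewrite -scalemxAr mulmxA -[w *m H *m H]mulmxA H2 [_ *m w ^t*]mx11_scalar.
  by rewrite proj_form scale_scalar_mx.
rewrite -raddfB/= det_scalar1.
have c_le : c * nrm2 (w *m H) <= 3 / 4.
  rewrite /c; have := nrm2_proj_le.
  move: (nrm2_ge0 (w *m H)) (nrm2_ge0 w); move: (nrm2 _) (nrm2 w) => a b a0 b0 ab.
  have [->|b_n0] := eqVneq b 0.
    by rewrite invr0 !(mulr0, mul0r).
  have bp : 0 < b by rewrite lt_def b_n0 b0.
  have -> : s * (3 / 4 / b) / (1 + s) * a = 3 / 4 * ((s / (1 + s)) * (a / b)).
    by field; rewrite b_n0 gt_eqF.
  rewrite -[leRHS]mulr1 ler_pM2l//; apply: mulr_ile1.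
  - by rewrite divr_ge0// ltW.
  - by rewrite divr_ge0.
  - by rewrite ler_pdivrMr// mul1r lerDr.
  - by rewrite ler_pdivrMr// mul1r.
have -> : 4^-1 = 1 - 3 / 4 :> C by field.
by rewrite lerD2l lerN2.
Qed.
End tilted.

End projection.

Section projection2.
Context {R : rcfType}.
Local Notation C := R[i].

(** If the Gram matrix is regular, [kproj O] has rank d - k and equality holds; otherwise [pinvd] is
    0, the projector is replaced by the identity and the determinant is only larger. The multiplied
    form avoids the exponent d - k. *)
Lemma proj_det k d (O : 'M[C]_(k, d)) (s : C) : 0 <= s ->
  (1 + s) ^+ d <= (1 + s) ^+ k * \det (1%:M + s *: kproj O).
Proof.
move=> s0; have s1 : 0 < 1 + s by rewrite ltr_pwDl.
have [ O0|O0] := eqVneq (\det (gramm O)) 0.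
  rewrite /kproj pinvd_singular// mulmx0 mul0mx subr0 scalemx1 -raddfD/=.
  rewrite det_scalar; apply: ler_peMl; first by rewrite exprn_ge0 ?ltW.
  by rewrite exprn_ege1 ?lerDl.
have := mulV_pinvd O0; rewrite /kproj /gramm; move: (pinvd _) => X OX.
pose c := s / (1 + s).
have -> : 1%:M + s *: (1%:M - O ^t* *m X *m O) =
    (1 + s) *: (1%:M - (c *: (O ^t* *m X)) *m O).
  rewrite scalerBr -[in RHS]scalemxAl scalerBr scalerDl scale1r scalerA addrA.
  by rewrite /c mulrC divfK// gt_eqF.
rewrite detZ sylvester -scalemxAr mulmxA OX -{1}[1%:M]scale1r -scalerBl.
rewrite scalemx1 det_scalar mulrCA -exprMn.
have -> : (1 + s) * (1 - c) = 1 by rewrite /c; field; rewrite gt_eqF.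
by rewrite expr1n mulr1.
Qed.

Section equivariance.
Variables (k d : nat) (O : 'M[C]_(k, d)) (w : 'rV[C]_d) (U : 'M[C]_d).
Hypothesis UU : U *m U ^t* = 1%:M.

Lemma proj_unitary : kproj (O *m U) = U ^t* *m kproj O *m U.
Proof.
have gE : gramm (O *m U) = gramm O.
  by rewrite /gramm trmxC_mul !mulmxA -[(O) *m U *m _]mulmxA UU mulmx1.
rewrite /kproj gE trmxC_mul; move: (pinvd _) => X.
rewrite mulmxBr mulmxBl mulmx1 (mulmx1C UU); congr (_ - _).
by rewrite !mulmxA.
Qed.

Lemma nrm2_unitary (x : 'rV[C]_d) : nrm2 (x *m U) = nrm2 x.
Proof.
by rewrite /nrm2 trmxC_mul !mulmxA -[x *m U *m _]mulmxA UU mulmx1.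
Qed.

Lemma tilt_unitary :
  tilt (kproj (O *m U)) (w *m U) = U ^t* *m tilt (kproj O) w *m U.
Proof.
rewrite /tilt nrm2_unitary proj_unitary trmxC_mul.
move: (kproj O) (3 / 4 / nrm2 w) => H c.
rewrite mulmxBr mulmxBl; congr (_ - _).
rewrite -scalemxAr -scalemxAl; congr (_ *: _).
rewrite !mulmxA -[U ^t* *m H *m U *m U ^t*]mulmxA UU mulmx1.
by rewrite -[U ^t* *m H *m w ^t* *m w *m U *m U ^t*]mulmxA UU mulmx1.
Qed.

End equivariance.

Section extra_column.
Variables (k l : nat) (O : 'M[C]_(k, l)) (y : 'cV[C]_k).
Variables (w : 'rV[C]_l) (z : 'M[C]_1).
Hypothesis O0 : \det (gramm O) != 0.

Let O1 := row_mx O y.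
Let w1 := row_mx w z.
Let H := kproj O1.
Let u : 'rV[C]_(l + 1) := row_mx 0 1%:M.

Lemma gramm_row_mx_regular : \det (gramm O1) != 0.
Proof.
apply: contraNneq O0 => /eqP /det0P[x x0 xO1]; apply/det0P; exists x => //.
have : nrm2 (x *m O1) = 0.
  by rewrite /nrm2 trmxC_mul !mulmxA -[x *m O1 *m _]mulmxA -/(gramm O1) xO1
    mul0mx mxE.
move=> /eqP; rewrite nrm2_eq0 mul_mx_row -row_mx0 => /eqP/eq_row_mx[xO _].
by rewrite /gramm mulmxA xO mul0mx.
Qed.

(** H u^H lies in the kernel of [O1] and equals u^H - [O1]^H q for some q. Its last entry is b, and
    being annihilated by [O1] forces q = b (O O^H)^-1 y. Hence the last column of the projector is b
    times the column (-O^H (O O^H)^-1 y, 1). If b were 0, then q = 0 and the last entry would be 1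
    as well. *)
Lemma extra_column : let b := nrm2 (u *m H) in
  0 < b /\ (w1 *m H *m u ^t*) 0 0 = b * (z - w *m O ^t* *m pinvd (gramm O) *m y) 0 0.
Proof.
move=> b.
have HH : H ^t* = H by exact: proj_herm.
have H2 : H *m H = H by exact: proj_idem.
have O1H : O1 *m H = 0 by exact: mul_proj gramm_row_mx_regular.
have bE : (u *m H *m u ^t*) 0 0 = b by rewrite (proj_form HH H2).
have := mulV_pinvd O0; have := mul_pinvd O0.
move: (pinvd (gramm O)) => X XS SX.
have uT : u ^t* = col_mx 0 1%:M.
  by rewrite /u tr_row_mx map_col_mx trmx0 map_mx0 trmxC1.
have [q HuE] : exists q : 'cV[C]_k, H *m u ^t* = u ^t* - O1 ^t* *m q.
  exists (pinvd (gramm O1) *m O1 *m u ^t*).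
  by rewrite /H /kproj mulmxBl mul1mx !mulmxA.
have O1T : O1 ^t* = col_mx (O ^t*) (y ^t*) by rewrite tr_row_mx map_col_mx.
have HuE2 : H *m u ^t* = col_mx (- (O ^t* *m q)) (1%:M - y ^t* *m q).
  by rewrite HuE uT O1T mul_col_mx opp_col_mx add_col_mx add0r.
have bE2 : 1%:M - y ^t* *m q = b%:M.
  rewrite [LHS]mx11_scalar -bE -mulmxA HuE2 /u mul_row_col mul0mx add0r mul1mx.
  by [].
have qE : q = X *m y *m b%:M.
  have : O1 *m (H *m u ^t*) = 0 by rewrite mulmxA O1H mul0mx.
  rewrite HuE2 bE2 mul_row_col mulmxN mulmxA -/(gramm O).
  move=> /eqP; rewrite addrC subr_eq0 => /eqP yb.
  by rewrite -mulmxA yb mulmxA XS mul1mx.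
have wE : w1 *m H *m u ^t* = b *: (z - w *m O ^t* *m X *m y).
  rewrite -mulmxA HuE2 bE2 qE /w1 mul_row_col !mul_mx_scalar -scalemxAr -scalerN.
  by rewrite -scalemxAr mulmxN -scalerDr addrC !mulmxA.
split; last by rewrite wE [LHS]mxE.
rewrite lt_def nrm2_ge0 andbT /b nrm2_eq0; apply/eqP => uH0.
have Hu0 : H *m u ^t* = 0 by rewrite -HH -trmxC_mul uH0 linear0 map_mx0.
have b0 : b = 0 by rewrite /b uH0 /nrm2 mul0mx mxE.
have : 1%:M - y ^t* *m q = 0 by rewrite bE2 b0 raddf0.
rewrite qE b0 raddf0 mulmx0 mulmx0 subr0 => /matrixP/(_ 0 0).
by rewrite !mxE eqxx => /eqP; rewrite oner_eq0.
Qed.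

(* With rho = |w1 H u|^2 / (b A0) the product is 3 rho (1 - 3 rho / 4) <= 1. *)
Lemma extra_column_le :
  let q := (u *m tilt H w1 *m u ^t*) 0 0 in
  [/\ 0 < q,
    `|(z - w *m O ^t* *m pinvd (gramm O) *m y) 0 0| ^+ 2 * (3 * q / nrm2 w1) <= 1
    & w1 = 0 -> (z - w *m O ^t* *m pinvd (gramm O) *m y) 0 0 = 0].
Proof.
have [] := extra_column; set b := nrm2 (u *m H); set r := (z - _) 0 0.
move=> b0 wHu q.
have HH : H ^t* = H by exact: proj_herm.
have H2 : H *m H = H by exact: proj_idem.
have qge : 4^-1 * b <= q by exact: tilt_form_ge.
split.
- by apply: lt_le_trans qge; rewrite mulr_gt0.
- have qE : q = b - 3 / 4 / nrm2 w1 * `|b * r| ^+ 2.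
    rewrite /q tilt_form// -wHu; congr (_ - _ * _).
    rewrite dotcC norm_conjC /dotc trmxC_mul HH mulmxA.
    by [].
  have [->|A0] := eqVneq (nrm2 w1) 0; first by rewrite invr0 !mulr0.
  have Ap : 0 < nrm2 w1 by rewrite lt_def A0 nrm2_ge0.
  rewrite qE normrM exprMn (gtr0_norm b0); move: (nrm2 w1) Ap => A Ap.
  have: 0 <= `|r| ^+ 2 by rewrite exprn_ge0.
  move: (`|r| ^+ 2) => x x0.
  have -> : x * (3 * (b - 3 / 4 / A * (b ^+ 2 * x)) / A) =
      1 - (1 - 3 / 2 * (b * x / A)) ^+ 2.
    by field; rewrite gt_eqF.
  rewrite gerBl real_exprn_even_ge0//.
  by rewrite realB// ger0_real// !mulr_ge0// ?invr_ge0 ltW.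
- move=> w10; move: wHu; rewrite w10 !mul0mx mxE => /esym/eqP.
  by rewrite mulf_eq0 gt_eqF//= => /eqP.
Qed.

End extra_column.
End projection2.

(** * Measurability of complex matrix expressions *)

Section complex_measurability.
Context {R : realType} d (T : measurableType d).
Local Notation C := R[i].
Implicit Types f g : T -> C.

(** The inverse is total, with value 0 at 0. Written as h (h^2)^-1 it only involves a real power of
    a nonnegative function. *)
Lemma measurable_invr (h : T -> R) :
  measurable_fun setT h -> measurable_fun setT (fun x => (h x)^-1).
Proof.
move=> mh.
rewrite (_ : (fun x => _) = (fun x => h x * (h x ^+ 2) `^ (-1))); last first.
  apply/funext => x; rewrite powR_inv1 ?sqr_ge0// expr2 invfM mulrA.
  have [->|h0] := eqVneq (h x) 0; first by rewrite invr0 !mulr0.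
  by rewrite mulfV// mul1r.
apply: measurable_funM => //.
have := measurableT_comp (@measurable_powR R (-1)) (measurable_funX 2 mh).
exact.
Qed.

Definition cmeas f := measurable_fun setT (fun x => complex.Re (f x)) /\
  measurable_fun setT (fun x => complex.Im (f x)).

Lemma cmeas_cst c : cmeas (fun=> c).
Proof. by split; exact: measurable_cst. Qed.

Lemma cmeas_real (h : T -> R) : measurable_fun setT h -> cmeas (fun x => (h x)%:C).
Proof. by move=> mh; split => //=; exact: measurable_cst. Qed.

Lemma cmeasD f g : cmeas f -> cmeas g -> cmeas (fun x => f x + g x).
Proof.
move=> [fr fi] [gr gi]; split.
  rewrite (_ : (fun x => _) = (fun x => complex.Re (f x) + complex.Re (g x))).
    exact: measurable_funD.
  by apply/funext => x; case: (f x) (g x) => ? ? [].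
rewrite (_ : (fun x => _) = (fun x => complex.Im (f x) + complex.Im (g x))).
  exact: measurable_funD.
by apply/funext => x; case: (f x) (g x) => ? ? [].
Qed.

Lemma cmeasM f g : cmeas f -> cmeas g -> cmeas (fun x => f x * g x).
Proof.
move=> [fr fi] [gr gi]; split.
  rewrite (_ : (fun x => _) = (fun x => complex.Re (f x) * complex.Re (g x) -
      complex.Im (f x) * complex.Im (g x))).
    by apply: measurable_funB; exact: measurable_funM.
  by apply/funext => x; case: (f x) (g x) => ? ? [].
rewrite (_ : (fun x => _) = (fun x => complex.Re (f x) * complex.Im (g x) +
    complex.Im (f x) * complex.Re (g x))).
  by apply: measurable_funD; exact: measurable_funM.
by apply/funext => x; case: (f x) (g x) => ? ? [].
Qed.

Lemma cmeas_conj f : cmeas f -> cmeas (fun x => (f x)^*).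
Proof.
move=> [fr fi]; split.
  rewrite (_ : (fun x => _) = (fun x => complex.Re (f x)))//.
  by apply/funext => x; case: (f x).
rewrite (_ : (fun x => _) = (fun x => - complex.Im (f x))).
  by apply: (measurableT_comp (@oppr_measurable R setT)).
by apply/funext => x; case: (f x).
Qed.

Lemma cmeasV f : cmeas f -> cmeas (fun x => (f x)^-1).
Proof.
move=> [fr fi].
have mn : measurable_fun setT
    (fun x => (complex.Re (f x) ^+ 2 + complex.Im (f x) ^+ 2)^-1).
  apply: measurable_invr; apply: measurable_funD; exact: measurable_funX.
split.
  rewrite (_ : (fun x => _) = (fun x => complex.Re (f x) *
      (complex.Re (f x) ^+ 2 + complex.Im (f x) ^+ 2)^-1)).
    exact: measurable_funM.
  by apply/funext => x; case: (f x).
rewrite (_ : (fun x => _) = (fun x => - (complex.Im (f x) *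
    (complex.Re (f x) ^+ 2 + complex.Im (f x) ^+ 2)^-1))).
  apply: (measurableT_comp (@oppr_measurable R setT)); exact: measurable_funM.
by apply/funext => x; case: (f x) => a b /=; rewrite ?mulNr ?mulrN.
Qed.

Lemma cmeas_sum I (s : seq I) (P : pred I) (f : I -> T -> C) :
  (forall i, cmeas (f i)) -> cmeas (fun x => \sum_(i <- s | P i) f i x).
Proof.
move=> mf; elim: s => [|i s IHs].
  rewrite (_ : (fun x => _) = (fun=> 0)); first exact: cmeas_cst.
  by apply/funext => x; rewrite big_nil.
rewrite (_ : (fun x => _) = (fun x => if P i then f i x +
    \sum_(j <- s | P j) f j x else \sum_(j <- s | P j) f j x)).
  by case: (P i) => //; exact: cmeasD.
by apply/funext => x; rewrite big_cons.
Qed.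

Lemma cmeas_prod I (s : seq I) (P : pred I) (f : I -> T -> C) :
  (forall i, cmeas (f i)) -> cmeas (fun x => \prod_(i <- s | P i) f i x).
Proof.
move=> mf; elim: s => [|i s IHs].
  rewrite (_ : (fun x => _) = (fun=> 1)); first exact: cmeas_cst.
  by apply/funext => x; rewrite big_nil.
rewrite (_ : (fun x => _) = (fun x => if P i then f i x *
    \prod_(j <- s | P j) f j x else \prod_(j <- s | P j) f j x)).
  by case: (P i) => //; exact: cmeasM.
by apply/funext => x; rewrite big_cons.
Qed.

Definition mmeas m n (A : T -> 'M[C]_(m, n)) := forall i j, cmeas (fun x => A x i j).

Lemma mmeas_cst m n (A : 'M[C]_(m, n)) : mmeas (fun=> A).
Proof. by move=> i j; exact: cmeas_cst. Qed.

Lemma mmeasM m n p (A : T -> 'M[C]_(m, n)) (B : T -> 'M[C]_(n, p)) :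
  mmeas A -> mmeas B -> mmeas (fun x => A x *m B x).
Proof.
move=> mA mB i j; rewrite (_ : (fun x => _) = (fun x => \sum_k A x i k * B x k j)).
  by apply: cmeas_sum => k; exact: cmeasM.
by apply/funext => x; rewrite mxE.
Qed.

Lemma mmeas_trmxC m n (A : T -> 'M[C]_(m, n)) :
  mmeas A -> mmeas (fun x => (A x) ^t*).
Proof.
move=> mA i j; rewrite (_ : (fun x => _) = (fun x => (A x j i)^*)).
  exact: cmeas_conj.
by apply/funext => x; rewrite trmxCE.
Qed.

Lemma mmeasZ m n (a : T -> C) (A : T -> 'M[C]_(m, n)) :
  cmeas a -> mmeas A -> mmeas (fun x => a x *: A x).
Proof.
move=> ma mA i j; rewrite (_ : (fun x => _) = (fun x => a x * A x i j)).
  exact: cmeasM.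
by apply/funext => x; rewrite mxE.
Qed.

Lemma mmeasB m n (A B : T -> 'M[C]_(m, n)) :
  mmeas A -> mmeas B -> mmeas (fun x => A x - B x).
Proof.
move=> mA mB i j; rewrite (_ : (fun x => _) = (fun x => A x i j + -1 * B x i j)).
  by apply: cmeasD => //; apply: cmeasM => //; exact: cmeas_cst.
by apply/funext => x; rewrite !mxE mulN1r.
Qed.

Lemma cmeas_det n (A : T -> 'M[C]_n) : mmeas A -> cmeas (fun x => \det (A x)).
Proof.
move=> mA; apply: cmeas_sum => s; apply: cmeasM; first exact: cmeas_cst.
by apply: cmeas_prod => i; exact: mA.
Qed.

Lemma mmeas_adj n (A : T -> 'M[C]_n) : mmeas A -> mmeas (fun x => \adj (A x)).
Proof.
move=> mA i j; rewrite (_ : (fun x => _) = (fun x => cofactor (A x) j i)).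
  rewrite /cofactor; apply: cmeasM; first exact: cmeas_cst.
  apply: cmeas_det => a b.
  rewrite (_ : (fun x => _) = (fun x => A x (lift j a) (lift i b)))//.
  by apply/funext => x; rewrite !mxE.
by apply/funext => x; rewrite mxE.
Qed.

Lemma mmeas_pinvd n (A : T -> 'M[C]_n) : mmeas A -> mmeas (fun x => pinvd (A x)).
Proof.
by move=> mA; apply: mmeasZ; [apply: cmeasV; exact: cmeas_det|exact: mmeas_adj].
Qed.

Lemma mmeas_kproj k n (O : T -> 'M[C]_(k, n)) :
  mmeas O -> mmeas (fun x => kproj (O x)).
Proof.
move=> mO; apply: mmeasB; first exact: mmeas_cst.
apply: mmeasM => //; apply: mmeasM; first exact: mmeas_trmxC.
by apply: mmeas_pinvd; apply: mmeasM => //; exact: mmeas_trmxC.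
Qed.

Lemma cmeas_nrm2 n (w : T -> 'rV[C]_n) : mmeas w -> cmeas (fun x => nrm2 (w x)).
Proof.
by move=> mw; apply: (mmeasM mw (mmeas_trmxC mw) 0 0).
Qed.

Lemma mmeas_tilt n (H : T -> 'M[C]_n) (w : T -> 'rV[C]_n) :
  mmeas H -> mmeas w -> mmeas (fun x => tilt (H x) (w x)).
Proof.
move=> mH mw; apply: mmeasB => //; apply: mmeasZ.
  apply: cmeasM; first exact: cmeas_cst.
  by apply: cmeasV; exact: cmeas_nrm2.
apply: mmeasM; first by apply: mmeasM => //; exact: mmeas_trmxC.
exact: mmeasM.
Qed.

End complex_measurability.

(** * Gaussian matrices *)

Section column_rotations.
Context {R : realType} (n d : nat).
Local Notation C := R[i].
Local Notation vect I := (vect R I).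

Definition cgivens (i j : 'I_d) (c s : R) (f : 'I_n * 'I_d -> R) :
  'I_n * 'I_d -> R := fun ab => givens i j c s (fun b => f (ab.1, b)) ab.2.

(** Rotating two columns means rotating two entries in each row. The rows are treated one at a time;
    [G l] is the state after those in l. *)
Lemma gauss_cgivens d0 (T : measurableType d0) (P : probability T R)
    (F : T -> vect ('I_n * 'I_d)%type) (i j : 'I_d) (c s : R) :
  i != j -> c ^+ 2 + s ^+ 2 = 1 -> gauss_map P F ->
  gauss_map P (fun x => cgivens i j c s (F x) : vect ('I_n * 'I_d)%type).
Proof.
move=> ij cs1 gF.
pose G (l : seq 'I_n) x : vect ('I_n * 'I_d)%type := fun ab =>
  if ab.1 \in l then cgivens i j c s (F x) ab else F x ab.
suff H l : gauss_map P (G l).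
  have := H (enum 'I_n); congr gauss_map; apply/funext => x; apply/funext => ab.
  by rewrite /G mem_enum.
elim: l => [|a l IHl]; first exact: gF.
have [al|al] := boolP (a \in l).
  rewrite (_ : G (a :: l) = G l)//; apply/funext => x; apply/funext => ab.
  rewrite /G inE; have [->|//] := eqVneq ab.1 a.
  by rewrite al.
have aij : (a, i) != (a, j) by apply: contra ij => /eqP[->].
have := gauss_rot aij cs1 IHl.
congr gauss_map; apply/funext => x; apply/funext => -[b k].
rewrite /givens /G /cgivens/= inE !xpair_eqE (negbTE al).
have [->|ba] := eqVneq b a.
  by rewrite (negbTE al)/= /givens.
by [].
Qed.

Definition Wm (f : 'I_n * 'I_d -> R) : 'M[C]_(n, d) :=
  \matrix_(i, j) (f (i, j))%:C.

Definition rowc (g : 'I_d -> R) : 'rV[C]_d := \row_j (g j)%:C.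

Definition Gm (i j : 'I_d) (c s : R) : 'M[C]_d :=
  \matrix_(a, b) (givens i j c s (fun k => (k == a)%:R) b)%:C.

Lemma givensE (i j : 'I_d) (c s : R) (g : 'I_d -> R) b :
  givens i j c s g b = \sum_a g a * givens i j c s (fun k => (k == a)%:R) b.
Proof.
have pick k : g k = \sum_a g a * (k == a)%:R.
  rewrite (bigD1 k)//= eqxx mulr1 big1 ?addr0// => a ak.
  by rewrite eq_sym (negbTE ak) mulr0.
rewrite /givens; case: ifP => _; [|case: ifP => _].
- rewrite (pick i) (pick j) !mulr_sumr -sumrB; apply: eq_bigr => a _.
  by rewrite mulrBr !mulrA ![g a * _]mulrC.
- rewrite (pick i) (pick j) !mulr_sumr -big_split; apply: eq_bigr => a _ /=.
  by rewrite mulrDr !mulrA ![g a * _]mulrC.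
- by rewrite {1}(pick b).
Qed.

Lemma rowc_givens i j c s g : rowc (givens i j c s g) = rowc g *m Gm i j c s.
Proof.
apply/rowP => b; rewrite !mxE givensE raddf_sum; apply: eq_bigr => a _.
by rewrite !mxE; exact: (rmorphM (real_complex R)).
Qed.

Lemma Wm_cgivens i j c s f : Wm (cgivens i j c s f) = Wm f *m Gm i j c s.
Proof.
apply/matrixP => a b; rewrite !mxE /cgivens/= givensE raddf_sum.
by apply: eq_bigr => e _; rewrite !mxE; exact: (rmorphM (real_complex R)).
Qed.

Lemma Gm_unitary i j c s : i != j -> c ^+ 2 + s ^+ 2 = 1 ->
  Gm i j c s *m (Gm i j c s) ^t* = 1%:M.
Proof.
move=> ij cs1; apply/matrixP => a b; rewrite !mxE.
transitivity ((dot (givens i j c s (fun k => (k == a)%:R))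
                   (givens i j c s (fun k => (k == b)%:R)))%:C).
  rewrite /dot raddf_sum; apply: eq_bigr => e _.
  rewrite trmxCE !mxE; apply: etrans (esym (rmorphM (real_complex R) _ _)).
  by congr (_ * _); apply/eqP; rewrite eq_complex/= oppr0 !eqxx.
rewrite dot_rot// /dot (bigD1 a)//= eqxx mul1r big1 ?addr0.
  by case: eqP.
by move=> e ea; rewrite (negbTE ea) mul0r.
Qed.

Lemma qf_rowc (M : 'M[C]_d) g :
  qf M g = complex.Re ((rowc g *m M *m (rowc g) ^t*) 0 0).
Proof.
rewrite /qf exchange_big mxE raddf_sum; apply: eq_bigr => j _ /=.
rewrite trmxCE !mxE mulr_suml raddf_sum; apply: eq_bigr => i _ /=.
by rewrite !mxE; case: (M i j) => a b /=; ring.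
Qed.

Lemma mmeas_Wm : mmeas (Wm : vect ('I_n * 'I_d)%type -> _).
Proof.
move=> i j; rewrite (_ : (fun x => _) = (fun x => (x (i, j))%:C)).
  by apply: cmeas_real; exact: measurable_coord.
by apply/funext => x; rewrite mxE.
Qed.

End column_rotations.

(** * The exponential integrals and their rotation invariance *)

Section Phi.
Context {R : realType} (n k d : nat).
Local Notation C := R[i].
Local Notation vect I := (vect R I).
Variables (V : 'M[C]_(n, k)) (v : 'cV[C]_n).

Definition Ov (f : 'I_n * 'I_d -> R) : 'M[C]_(k, d) := V ^t* *m Wm f.
Definition wv (f : 'I_n * 'I_d -> R) : 'rV[C]_d := v ^t* *m Wm f.
Definition Nf f := tilt (kproj (Ov f)) (wv f).
Definition Af f : R := complex.Re (nrm2 (wv f)).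

(* The value 0 at a = 0 is that of the excess, which vanishes there. *)
Definition pexp (l a q : R) : \bar R :=
  if a == 0 then 0%E else (expR (- (l * q / a)))%:E.

Lemma pexpM l a u q : pexp l a (u * q) = pexp (l * u) a q.
Proof. by rewrite /pexp mulrA. Qed.

(** The direction g is kept as an argument, instead of being fixed as the last unit vector, so that
    matrix and direction can be rotated together. *)
Definition psi (l : R) f (g : 'I_d -> R) : \bar R :=
  pexp l (Af f) (qf (Nf f) g).

Lemma Af_cgivens i j c s f : i != j -> c ^+ 2 + s ^+ 2 = 1 ->
  Af (cgivens i j c s f) = Af f.
Proof.
move=> ij cs1; have wE : wv (cgivens i j c s f) = wv f *m Gm i j c s.
  by rewrite /wv Wm_cgivens; exact: mulmxA.
by rewrite /Af wE nrm2_unitary//; exact: Gm_unitary.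
Qed.

Lemma Nf_cgivens i j c s f : i != j -> c ^+ 2 + s ^+ 2 = 1 ->
  Nf (cgivens i j c s f) = (Gm i j c s) ^t* *m Nf f *m Gm i j c s.
Proof.
move=> ij cs1; have UU := Gm_unitary ij cs1.
have OE : Ov (cgivens i j c s f) = Ov f *m Gm i j c s.
  by rewrite /Ov Wm_cgivens; exact: mulmxA.
have wE : wv (cgivens i j c s f) = wv f *m Gm i j c s.
  by rewrite /wv Wm_cgivens; exact: mulmxA.
by rewrite /Nf OE wE; exact: tilt_unitary.
Qed.

Lemma qf_cgivens i j c s f g : i != j -> c ^+ 2 + s ^+ 2 = 1 ->
  qf (Nf (cgivens i j c s f)) (givens i j c s g) = qf (Nf f) g.
Proof.
move=> ij cs1; have UU := Gm_unitary ij cs1.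
rewrite Nf_cgivens//; move: (Nf f) => N.
rewrite [LHS]qf_rowc [RHS]qf_rowc rowc_givens.
move: (Gm i j c s) UU => U UU; move: (rowc g) => x.
rewrite trmxC_mul !mulmxA -[x *m U *m U ^t*]mulmxA UU mulmx1.
by rewrite -[x *m N *m U *m U ^t*]mulmxA UU mulmx1.
Qed.

Lemma psi_cgivens l i j c s f g : i != j -> c ^+ 2 + s ^+ 2 = 1 ->
  psi l (cgivens i j c s f) (givens i j c s g) = psi l f g.
Proof.
move=> ij cs1.
exact: (f_equal2 (pexp l) (Af_cgivens f ij cs1) (qf_cgivens f g ij cs1)).
Qed.

Lemma mmeas_Nf : mmeas (Nf : vect ('I_n * 'I_d)%type -> _).
Proof.
apply: mmeas_tilt; last by apply: mmeasM; [exact: mmeas_cst|exact: mmeas_Wm].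
by apply: mmeas_kproj; apply: mmeasM; [exact: mmeas_cst|exact: mmeas_Wm].
Qed.

Lemma measurable_Af : measurable_fun setT (Af : vect ('I_n * 'I_d)%type -> R).
Proof.
have [] : cmeas (fun f : vect ('I_n * 'I_d)%type => nrm2 (wv f)); last by [].
by apply: cmeas_nrm2; apply: mmeasM; [exact: mmeas_cst|exact: mmeas_Wm].
Qed.

Lemma measurable_psi l : measurable_fun setT
  (fun z : vect ('I_n * 'I_d)%type * vect 'I_d => psi l z.1 z.2).
Proof.
have m1 (h : vect ('I_n * 'I_d)%type -> R) : measurable_fun setT h ->
    measurable_fun setT (fun z : vect ('I_n * 'I_d)%type * vect 'I_d => h z.1).
  by move=> mh; apply: measurableT_comp.
have m2 j : measurable_fun setT
    (fun z : vect ('I_n * 'I_d)%type * vect 'I_d => z.2 j).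
  apply: (@measurableT_comp _ _ _ _ _ _ (fun f : vect 'I_d => f j)).
    exact: measurable_coord.
  exact: measurable_snd.
have mA := m1 _ measurable_Af.
rewrite /psi /pexp; apply: measurable_fun_ifT.
- exact: measurable_fun_eqr.
- exact: measurable_cst.
- apply/measurable_EFinP; apply: measurableT_comp => //.
  apply: (measurableT_comp (@oppr_measurable R setT)).
  apply: measurable_funM; last exact: measurable_invr.
  apply: measurable_funM => //.
  apply: measurable_sum => i; apply: measurable_sum => j.
  apply: measurable_funM; last exact: measurable_funM.
  exact: (m1 (fun f => complex.Re (Nf f i j)) (mmeas_Nf i j).1).
Qed.

Lemma psi_ge0 l f g : (0 <= psi l f g)%E.
Proof. by rewrite /psi /pexp; case: ifP => // _; rewrite lee_fin expR_ge0. Qed.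

Lemma measurable_psi1 l g : measurable_fun setT
  (fun f : vect ('I_n * 'I_d)%type => psi l f g).
Proof.
have mp : measurable_fun setT
    (fun f : vect ('I_n * 'I_d)%type => (f, (g : vect 'I_d))).
  by apply/measurable_fun_pairP; split; [exact: measurable_id|exact: measurable_cst].
exact: (measurableT_comp (measurable_psi l) mp).
Qed.

Variables (d0 : measure_display) (T : measurableType d0) (P : probability T R).
Variables (F : T -> vect ('I_n * 'I_d)%type).
Hypothesis gF : gauss_map P F.

Definition Phi (i0 : 'I_d) (s : R) : \bar R :=
  \int[P]_x psi (3 * s) (F x) (fun j => (j == i0)%:R).

Lemma qf_line (N : 'M[C]_d) (i0 : 'I_d) g : (forall i, i != i0 -> g i = 0) ->
  qf N g = g i0 ^+ 2 * complex.Re (N i0 i0).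
Proof.
move=> g0; rewrite /qf (bigD1 i0)//= (bigD1 i0)//= big1 ?addr0.
  rewrite big1 ?addr0; first by ring.
  move=> i ii0; rewrite big1// => j _; by rewrite (g0 i)// mul0r mulr0.
by move=> j ji0; rewrite (g0 j)// !mulr0.
Qed.

(** Rotating g onto the axis i0 and the columns of the matrix along with it changes neither [psi]
    nor the law, so only the norm of g matters. [rot_reduce] is used with a [K] that ignores its
    second vector. *)
Lemma Phi_rot (i0 : 'I_d) s g :
  (\int[P]_x psi (3 * s) (F x) g = Phi i0 (s * \sum_i g i ^+ 2))%E.
Proof.
pose K (g h : 'I_d -> R) := (\int[P]_x psi (3 * s) (F x) g)%E.
have invK i j c u a b : i \in [set: 'I_d]%SET -> j \in [set: 'I_d]%SET ->
    i != j -> c ^+ 2 + u ^+ 2 = 1 ->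
    K (givens i j c u a) (givens i j c u b) = K a b.
  move=> _ _ ij cu1; rewrite /K.
  rewrite (gauss_law gF (gauss_cgivens ij cu1 gF) (measurable_psi1 _ _)
    (fun f => psi_ge0 _ f _)).
  by apply: eq_integral => x _; exact: (psi_cgivens (3 * s) (F x) a ij cu1).
have [a [b [Ka a0 sa _ _]]] := rot_reduce (finset.in_setT i0) invK g g.
have {}a0 i : i != i0 -> a i = 0 by apply: a0; rewrite finset.in_setT.
rewrite -[LHS]/(K g g) -Ka /K /Phi; apply: eq_integral => x _.
rewrite /psi (qf_line _ a0) (@qf_line _ i0); last by move=> i /negbTE->.
rewrite eqxx expr1n mul1r pexpM -mulrA.
apply: (f_equal (fun e => pexp (3 * (s * e)) _ _)).
rewrite -big_fin_setT -sa (bigD1 i0)/= ?finset.in_setT// big1 ?addr0//.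
by move=> i /andP[_ /a0->]; rewrite expr0n.
Qed.

End Phi.

Section Phi_bound.
Context {R : realType}.
Local Notation C := R[i].
Local Notation vect I := (vect R I).

Lemma measurable_sqrtr : measurable_fun setT (@Num.sqrt R).
Proof. by apply: continuous_measurable_fun; exact: sqrt_continuous. Qed.

Lemma delta_form d (N : 'M[C]_d) i :
  let e : 'rV[C]_d := delta_mx 0 i in (e *m N *m e ^t*) 0 0 = N i i.
Proof.
move=> e; rewrite -rowE mxE (bigD1 i)//= big1 ?addr0.
  by rewrite /e !mxE !eqxx/= rmorph1 mulr1.
by move=> j /negbTE ji; rewrite /e !mxE ji andbF/= rmorph0 mulr0.
Qed.

Lemma RecR (x : R) (z : C) : x%:C <= z -> x <= complex.Re z.
Proof. by case: z => a b; rewrite lecE/= => /andP[]. Qed.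

Lemma ge0_ReE (z : C) : 0 <= z -> z = (complex.Re z)%:C.
Proof. by case: z => a b; rewrite lecE/= => /andP[/eqP-> _]. Qed.

(* 1 + 2 t <= exp (2 t) in each coordinate *)
Lemma gauss_exp_ge d d0 (T : measurableType d0) (P : probability T R)
    (F : T -> vect 'I_d) (t : R) : gauss_map P F -> 0 <= t ->
  ((expR (- (t * d%:R)))%:E <= \int[P]_x (expR (- (t * \sum_j F x j ^+ 2)))%:E)%E.
Proof.
move=> gF t0.
pose F1 x : vect (unit * 'I_d)%type := fun uj => F x uj.2.
have gF1 : gauss_map P F1.
  by apply: (gauss_sub (e := fun uj : unit * 'I_d => uj.2) _ _ gF) => // -[[] i] [[] j] /= ->.
have gU := @gauss_normal R unit card_unit.
pose f (w : vect unit) := (expR (- (t * w tt ^+ 2)))%:E.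
have mf : measurable_fun setT f.
  apply/measurable_EFinP; apply: measurableT_comp => //.
  apply: (measurableT_comp (@oppr_measurable R setT)); apply: measurable_funM => //.
  by apply: measurable_funX; exact: measurable_coord.
have f0 w : (0 <= f w)%E by rewrite lee_fin expR_ge0.
have E1 : (\int[P]_x (expR (- (t * \sum_j F x j ^+ 2)))%:E =
    \prod_(j < d) \int[gam R]_x f (fun=> x))%E.
  rewrite -(gauss_prodE gF1 gU mf f0); apply: eq_integral => x _.
  rewrite /f /F1/= prodEFin -expR_sum; congr (expR _)%:E.
  by rewrite mulr_sumr sumrN.
have m0 : 0 < 1 + 2 * t by rewrite ltr_pwDl// mulr_ge0.
have E2 : (\int[gam R]_x f (fun=> x) = ((Num.sqrt (1 + 2 * t))^-1)%:E)%E.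
  have := gam_exp 0 m0; rewrite expr0n mul0r expR0 mulr1 => <-.
  by apply: eq_integral => x _; rewrite /f; congr (expR _)%:E; field.
rewrite E1 E2 prodEFin lee_fin prodr_const card_ord -mulNr mulrC.
rewrite expRM_natl lerXn2r ?nnegrE ?expR_ge0 ?invr_ge0 ?sqrtr_ge0//.
rewrite expRN lef_pV2 ?posrE ?expR_gt0 ?sqrtr_gt0//.
have -> : expR t = Num.sqrt (expR (2 * t)).
  by rewrite mulr_natl mulr2n expRD -expr2 sqrtr_sqr ger0_norm// expR_ge0.
by apply: ler_wsqrtr; exact: expR_ge1Dx.
Qed.

(** The summand 1 of the base is dropped; the factor 2 is the square root of the 4 lost by the
    tilt. *)
Lemma det_sqrt_bound (D A s : R) m : 0 < A -> 0 < s ->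
  4^-1 * (1 + 6 * s / A) ^+ m <= D ->
  (Num.sqrt D)^-1 <= 2 * Num.sqrt ((A / (6 * s)) ^+ m).
Proof.
move=> A0 s0 le_D; set q := 6 * s / A in le_D.
have q0 : 0 < q by rewrite divr_gt0// mulr_gt0.
have -> : A / (6 * s) = q^-1 by rewrite invf_div.
have qm0 : 0 <= q ^+ m by rewrite exprn_ge0 ?ltW.
rewrite exprVn (sqrtrV qm0).
have -> : 2 = (Num.sqrt (4^-1))^-1 :> R.
  rewrite (_ : 4^-1 = 2^-1 ^+ 2); last by field.
  by rewrite sqrtr_sqr ger0_norm ?invr_ge0// invrK.
rewrite -invfM -sqrtrM ?invr_ge0// lef_pV2 ?posrE ?sqrtr_gt0.
- apply: ler_wsqrtr; apply: le_trans le_D; rewrite ler_pM2l ?invr_gt0//.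
  by rewrite lerXn2r ?nnegrE ?addr_ge0 ?ltW// ltrDr.
- apply: lt_le_trans le_D; rewrite mulr_gt0 ?invr_gt0// exprn_gt0//.
  by rewrite addr_gt0.
- by rewrite mulr_gt0 ?invr_gt0// exprn_gt0.
Qed.

Section bound.
Variables (n k m d : nat) (V : 'M[C]_(n, k)) (v : 'cV[C]_n).
Hypothesis dE : d = (k + m)%N.

Lemma Af_ge0 f : 0 <= @Af R n d v f.
Proof. by apply: RecR; exact: nrm2_ge0. Qed.

(** Of the d = k + m dimensions the projector keeps at least m, each contributing 1 + s to the
    determinant; 1/4 is the cost of the tilt. *)
Lemma Nf_det f (s : R) : 0 <= s ->
  4^-1 * (1 + s) ^+ m <= complex.Re (\det (1%:M + s%:C *: @Nf R n k d V v f)).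
Proof.
move=> s0; apply: RecR.
have sC : 0 <= s%:C by rewrite lecR.
have HH := proj_herm (Ov V f); have H2 := proj_idem (Ov V f).
have := tilt_det (wv v f) HH H2 sC; apply: le_trans.
have := proj_det (Ov V f) sC; rewrite {1}dE exprD.
have s1 : 0 < (1 + s%:C) ^+ k by rewrite exprn_gt0// ltr_pwDl.
rewrite ler_pM2l// => le1; apply: le_trans (ler_wpM2l _ le1) => //.
by rewrite rmorphM rmorphXn rmorphD rmorph1 fmorphV/= rmorph_nat.
Qed.

Lemma psi_int_le f s d0 (T : measurableType d0) (P : probability T R)
    (F : T -> vect 'I_d) : gauss_map P F -> 0 < s ->
  (\int[P]_y psi V v (3 * s) f (F y) <=
   (2 * Num.sqrt ((Af v f / (6 * s)) ^+ m))%:E)%E.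
Proof.
move=> gF s0; have [A0|A0] := eqVneq (Af v f) 0.
  rewrite [leLHS]integral0_eq; first by rewrite lee_fin mulr_ge0 ?sqrtr_ge0.
  by move=> y _; rewrite /psi /pexp A0 eqxx.
have Ap : 0 < Af v f by rewrite lt_def A0 Af_ge0.
(* [gint] halves its exponent, so the coefficient 3 s / A of [psi] becomes 6 s / A in the matrix. *)
pose q := 6 * s / Af v f.
have q0 : 0 < q by rewrite divr_gt0// mulr_gt0.
pose M := 1%:M + q%:C *: Nf V v f.
have pM : posdef M.
  apply: tilt_posdef; [exact: proj_herm|exact: proj_idem|].
  by rewrite lecR ltW.
have := gauss_qf_le pM gF.
have -> : (\int[P]_x gint M (F x) = \int[P]_y psi V v (3 * s) f (F y))%E.
  apply: eq_integral => y _; rewrite /psi /pexp (negbTE A0) /gint.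
  congr (expR _)%:E.
  have -> : qf M (F y) = \sum_j F y j ^+ 2 + q * qf (Nf V v f) (F y).
    rewrite /qf /M; move: (Nf V v f) => N; rewrite mulr_sumr -big_split.
    apply: eq_bigr => i _ /=; rewrite mulr_sumr.
    rewrite (bigD1 i)//= [X in _ = _ + X](bigD1 i)//= addrA; congr (_ + _).
      by rewrite !mxE eqxx; case: (N i i) => a b /=; ring.
    apply: eq_bigr => j /negbTE ji; rewrite !mxE eq_sym ji mulr0n.
    by case: (N i j) => a b /=; ring.
  by rewrite /q; field.
move=> /le_trans; apply; rewrite lee_fin; apply: det_sqrt_bound => //.
by apply: Nf_det; exact: ltW.
Qed.

Variables (d0 : measure_display) (T : measurableType d0) (P : probability T R).
Variables (F : T -> vect ('I_n * 'I_d)%type).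
Hypothesis gF : gauss_map P F.

(** A fixed vector of squared norm d is exchanged for one on the same axis with the length of a
    gaussian vector, whose mean squared norm is d; as the exponential is convex, the integral can
    only grow. By rotation invariance the vector may then be given the direction of the gaussian
    vector too, and integrating over the latter yields a determinant. *)
Lemma Phi_le (i0 : 'I_d) (s : R) : 0 < s ->
  (Phi V v P F i0 (s * d%:R) <=
   \int[P]_x (2 * Num.sqrt ((Af v (F x) / (6 * s)) ^+ m))%:E)%E.
Proof.
move=> s0.
have [d1 [T1 [P1 [F1 gF1]]]] := @gauss_exists R 'I_d.
have mF : measurable_fun setT F by case: gF.
have mF1 : measurable_fun setT F1 by case: gF1.
pose l (a : R) : vect 'I_d := fun j => if j == i0 then a else 0.
pose h y := l (Num.sqrt (\sum_j F1 y j ^+ 2)).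
have sum_l a : \sum_j l a j ^+ 2 = a ^+ 2.
  rewrite (bigD1 i0)//= /l eqxx big1 ?addr0// => j /negbTE->.
  by rewrite expr0n.
have sum0 y : 0 <= \sum_j F1 y j ^+ 2 by apply: sumr_ge0 => j _; exact: sqr_ge0.
have mh : measurable_fun setT h.
  apply: measurable_vect => j; rewrite /h /l; case: (j == i0); last exact: measurable_cst.
  apply: (measurableT_comp measurable_sqrtr).
  by apply: measurable_sum => i; apply: measurable_funX; exact: (gauss_measurable i gF1).
have mG (G : T1 -> vect 'I_d) : measurable_fun setT G ->
    measurable_fun setT (fun z : T * T1 => psi V v (3 * s) (F z.1) (G z.2)).
  move=> mG; have mp : measurable_fun setT (fun z : T * T1 => (F z.1, G z.2)).
    apply/measurable_fun_pairP; split.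
      by apply: (measurableT_comp mF); exact: measurable_fst.
    by apply: (measurableT_comp mG); exact: measurable_snd.
  exact: (measurableT_comp (measurable_psi V v (3 * s)) mp).
have swap (G : T1 -> vect 'I_d) : measurable_fun setT G ->
  (\int[P]_x \int[P1]_y psi V v (3 * s) (F x) (G y) =
   \int[P1]_y \int[P]_x psi V v (3 * s) (F x) (G y))%E.
  move=> /mG mG'.
  exact: (@fubini_tonelli _ _ _ _ R P P1 _ mG' (fun z => psi_ge0 V v _ _ _)).
have mint (G : T1 -> vect 'I_d) : measurable_fun setT G ->
    measurable_fun setT (fun x => \int[P1]_y psi V v (3 * s) (F x) (G y))%E.
  move=> /mG mG'.
  exact: (@measurable_fun_fubini_tonelli_F _ _ _ _ R P1 _ mG'
    (fun z => psi_ge0 V v _ _ _)).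
pose g0 := l (Num.sqrt d%:R).
have <- : (\int[P]_x psi V v (3 * s) (F x) g0 = Phi V v P F i0 (s * d%:R))%E.
  rewrite (Phi_rot V v gF i0 s g0) /g0 sum_l sqr_sqrtr ?ler0n//.
apply: (@le_trans _ _ (\int[P]_x \int[P1]_y psi V v (3 * s) (F x) (h y))%E).
  apply: ge0_le_integral.
  - exact: measurableT.
  - by move=> x _; exact: psi_ge0.
  - exact: (measurableT_comp (measurable_psi1 V v _ _) mF).
  - exact: mint.
  move=> x _; have psil a : psi V v (3 * s) (F x) (l a) =
      pexp (3 * s * a ^+ 2) (Af v (F x)) (complex.Re (Nf V v (F x) i0 i0)).
    rewrite /psi (@qf_line _ _ _ i0); last by move=> i /negbTE il; rewrite /l il.
    by rewrite {1}/l eqxx pexpM.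
  rewrite /g0 psil /h; under eq_integral do rewrite psil.
  rewrite sqr_sqrtr ?ler0n//.
  have N0 : 0 <= complex.Re (Nf V v (F x) i0 i0).
    apply: RecR; have := tilt_form_ge (wv v (F x)) (proj_herm (Ov V (F x)))
      (proj_idem (Ov V (F x))) (delta_mx 0 i0 : 'rV[C]_d).
    rewrite delta_form -/(Nf V v (F x)).
    by apply: le_trans; rewrite mulr_ge0 ?nrm2_ge0.
  move: (Af _ _) (Af_ge0 (F x)) (complex.Re _) N0 => A A0 q q0.
  rewrite /pexp; case: eqVneq => [_|An0]; first by rewrite integral0_eq.
  have tq0 : 0 <= 3 * s * q / A.
    by rewrite !mulr_ge0 ?invr_ge0// ltW.
  apply: le_trans (_ : _ <= (expR (- (3 * s * q / A * d%:R)))%:E)%E _.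
    by rewrite lee_fin ler_expR lerN2 le_eqVlt; apply/orP; left; apply/eqP; field.
  apply: le_trans (gauss_exp_ge gF1 tq0) _.
  rewrite le_eqVlt; apply/orP; left; apply/eqP; apply: eq_integral => y _.
  by rewrite sqr_sqrtr//; congr (expR (- _))%:E; field.
rewrite (swap h mh).
have -> : (\int[P1]_y \int[P]_x psi V v (3 * s) (F x) (h y) =
    \int[P1]_y \int[P]_x psi V v (3 * s) (F x) (F1 y))%E.
  apply: eq_integral => y _.
  rewrite (Phi_rot V v gF i0 s (h y)) (Phi_rot V v gF i0 s (F1 y)).
  by rewrite /h sum_l sqr_sqrtr.
rewrite -(swap F1 mF1); apply: ge0_le_integral.
- exact: measurableT.
- by move=> x _; apply: integral_ge0 => y _; exact: psi_ge0.
- exact: mint.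
- have mA := measurableT_comp (measurable_Af v) mF.
  apply/measurable_EFinP; apply: measurable_funM => //.
  apply: (measurableT_comp measurable_sqrtr).
  by apply: measurable_funX; apply: measurable_funM.
- by move=> x _; exact: psi_int_le.
Qed.

End bound.
End Phi_bound.

(** * Moments of the squared norm of a gaussian row *)

Section moment.
Context {R : realType}.
Local Notation C := R[i].
Local Notation vect I := (vect R I).

(** The inequality of arithmetic and geometric means for m numbers 1/2 and k numbers 1. *)
Lemma half_expn_le (m k : nat) : (0 < m)%N ->
  2^-1 ^+ m <= (1 - m%:R / (2 * (m + k)%:R)) ^+ (m + k) :> R.
Proof.
move=> m0; pose E (i : 'I_(m + k)) : R := if (i < m)%N then 2^-1 else 1.
have E0 : {in 'I_(m + k), forall i, 0 <= E i}.
  by move=> i _; rewrite /E; case: ifP => // _; rewrite invr_ge0.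
have [+ _] := leif_AGM E0; rewrite card_ord.
rewrite !big_split_ord/= (eq_bigr (fun=> 2^-1)); last first.
  by move=> i _; rewrite /E/= ltn_ord.
rewrite [X in _ * X]big1 ?mulr1; last first.
  by move=> i _; rewrite /E/= ltnNge leq_addr.
rewrite prodr_const card_ord => /le_trans; apply.
rewrite (eq_bigr (fun=> 2^-1)); last by move=> i _; rewrite /E/= ltn_ord.
rewrite [X in _ + X](eq_bigr (fun=> 1)); last first.
  by move=> i _; rewrite /E/= ltnNge leq_addr.
rewrite !sumr_const !card_ord le_eqVlt; apply/orP; left; apply/eqP.
have d0 : (m%:R + k%:R : R) != 0 by rewrite -natrD pnatr_eq0 addn_eq0 negb_and -lt0n m0.
by congr (_ ^+ _); rewrite -mulr_natr natrD; field.
Qed.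

Lemma expR_tangent (y : R) : expR 1 * y <= expR y.
Proof.
have := expR_ge1Dx (y - 1); rewrite addrC subrK => /(ler_wpM2l (expR_ge0 1)).
by rewrite -expRD addrC subrK.
Qed.

(** The inequality e y <= e^y at y = 2 s A / m, raised to the power m / 2. *)
Lemma sqrtX_le_exp (A s : R) m : 0 <= A -> 0 < s -> (0 < m)%N ->
  Num.sqrt (A ^+ m) <=
  Num.sqrt ((m%:R / (2 * expR 1 * s)) ^+ m) * expR (s * A).
Proof.
move=> A0 s0 m0; have m0' : 0 < m%:R :> R by rewrite ltr0n.
set c := m%:R / _.
have e0 := expR_gt0 (1 : R).
have c0 : 0 <= c by rewrite divr_ge0 ?mulr_ge0 ?ltW.
have -> : expR (s * A) = Num.sqrt (expR (2 * s * A / m%:R) ^+ m).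
  rewrite -expRM_natl (_ : m%:R * _ = s * A + s * A); last first.
    by field; rewrite gt_eqF.
  by rewrite expRD -expr2 sqrtr_sqr ger0_norm// expR_ge0.
rewrite -sqrtrM ?exprn_ge0// -exprMn; apply: ler_wsqrtr.
apply: lerXn2r; [by []|by rewrite nnegrE; apply: mulr_ge0 => //; exact: expR_ge0|].
have := expR_tangent (2 * s * A / m%:R) => /(ler_wpM2l c0); apply: le_trans.
rewrite le_eqVlt; apply/orP; left; apply/eqP; rewrite /c; field.
by rewrite !gt_eqF.
Qed.

Variables (n d : nat) (v : 'cV[C]_n).
Hypothesis v1 : v ^t* *m v = 1%:M.

Let N : 'M[C]_n := (v^T) ^t* *m v^T.

Lemma rank_one_form (x : 'rV[C]_n) :
  (x *m N *m x ^t*) 0 0 = `|dotc x v^T| ^+ 2.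
Proof.
rewrite /N; move: (v^T) => u.
have -> : x *m (u ^t* *m u) *m x ^t* = (x *m u ^t*) *m (u *m x ^t*).
  by rewrite !mulmxA.
by rewrite [LHS]mxE big_ord1 normCK -dotcC.
Qed.

Lemma Af_sum (f : 'I_n * 'I_d -> R) : Af v f = \sum_j qf N (fun i => f (i, j)).
Proof.
rewrite /Af nrm2E raddf_sum; apply: eq_bigr => j _.
rewrite qf_rowc rank_one_form; congr complex.Re.
have -> : wv v f 0 j = dotc (rowc (fun i => f (i, j))) v^T; last by [].
rewrite /wv /dotc !mxE; apply: eq_bigr => i _.
by rewrite !trmxCE !mxE mulrC.
Qed.

Lemma rank_one_posdef (s : R) : 0 <= s < 1 ->
  posdef (1%:M - s%:C *: N) /\ \det (1%:M - s%:C *: N) = (1 - s)%:C.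
Proof.
move=> /andP[s0 s1].
have vT1 : v^T *m (v^T) ^t* = 1%:M.
  rewrite -[RHS]trmx1 -v1 trmx_mul; congr (_ *m _).
  by apply/matrixP => i j; rewrite !mxE.
have nv : nrm2 v^T = 1 by rewrite /nrm2 vT1 mxE eqxx.
have sC : (s%:C)^* = s%:C by apply/eqP; rewrite eq_complex/= oppr0 !eqxx.
split.
  split; first by rewrite trmxCB trmxC1 trmxCZ sC /N trmxC_mul trmxCK.
  move=> x x0; rewrite mulmxBr mulmx1 mulmxBl [X in _ < X]mxE.
  rewrite -[X in X + _]/(nrm2 x) [X in _ + X]mxE subr_gt0.
  rewrite -scalemxAr -scalemxAl [X in X < _]mxE rank_one_form.
  have := cauchy_schwarz x v^T; rewrite nv mulr1 -[(x *m _) 0 0]/(dotc _ _) => CS.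
  have nx : 0 < nrm2 x by rewrite nrm2_gt0.
  have sC0 : 0 <= s%:C by rewrite lecR.
  apply: le_lt_trans (ler_wpM2l sC0 CS) _.
  by rewrite gtr_pMl// ltcR.
rewrite scalemxAl sylvester -scalemxAr vT1 scalemx1 -raddfB/= det_scalar1.
by rewrite rmorphB rmorph1.
Qed.

Variables (d0 : measure_display) (T : measurableType d0) (P : probability T R).
Variables (F : T -> vect ('I_n * 'I_d)%type).
Hypothesis gF : gauss_map P F.

(** The moment is dominated by an exponential moment. As A = |v^H W|^2 is a sum over independent
    columns, E e^(s A) is at most (1 - 2 s)^(-d / 2): each column contributes the determinant of a
    rank-one perturbation of the identity. *)
Lemma moment_le (k m : nat) : (0 < m)%N -> d = (m + k)%N ->
  (\int[P]_x (Num.sqrt (Af v (F x) ^+ m))%:E <=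
   (Num.sqrt ((4 * d%:R / expR 1) ^+ m))%:E)%E.
Proof.
move=> m0 dE; have d_gt0 : 0 < d%:R :> R by rewrite ltr0n dE addn_gt0 m0.
have m0' : 0 < m%:R :> R by rewrite ltr0n.
have mF : measurable_fun setT F by case: gF.
have mA : measurable_fun setT (fun x => Af v (F x)).
  exact: (measurableT_comp (measurable_Af v) mF).
(* For this s, (1 - 2 s)^d is at least 2^-m by [half_expn_le], and the base m / (2 e s) in
   [sqrtX_le_exp] is 2 d / e; together they give 4 d / e. *)
pose s : R := m%:R / (4 * d%:R).
have s0 : 0 < s by rewrite divr_gt0// mulr_gt0.
have s21 : 0 <= 2 * s < 1.
  rewrite mulr_ge0 ?ltW//= /s mulrA ltr_pdivrMr ?mulr_gt0// mul1r.
  have : m%:R <= d%:R :> R by rewrite ler_nat dE leq_addr.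
  by move: d_gt0; lra.
have [pM detM] := rank_one_posdef s21; set M := 1%:M - _ in pM detM.
have [d1 [T1 [P1 [F1 gF1]]]] := @gauss_exists R 'I_n.
have gintE w : gint M w = (expR (s * qf N w))%:E.
  rewrite /gint; congr (expR _)%:E.
  have -> : qf M w = \sum_j w j ^+ 2 - 2 * s * qf N w.
    rewrite /qf /M mulr_sumr -sumrB; apply: eq_bigr => i _; rewrite mulr_sumr.
    rewrite (bigD1 i)//= [X in _ = _ - X](bigD1 i)//= opprD addrA -sumrN.
    congr (_ + _).
      by rewrite !mxE eqxx; case: (\sum_j _) => a b /=; ring.
    apply: eq_bigr => j /negbTE ji; rewrite !mxE eq_sym ji mulr0n.
    by case: (\sum_j _) => a b /=; ring.
  by field.
set c := m%:R / (2 * expR 1 * s).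
have c0 : 0 <= Num.sqrt (c ^+ m) by exact: sqrtr_ge0.
apply: (@le_trans _ _ (\int[P]_x ((Num.sqrt (c ^+ m))%:E *
    \prod_(j < d) gint M (fun i => F x (i, j))))%E).
  apply: ge0_le_integral.
  - exact: measurableT.
  - by move=> x _; rewrite lee_fin sqrtr_ge0.
  - apply/measurable_EFinP; apply: (measurableT_comp measurable_sqrtr).
    exact: measurable_funX.
  - apply: emeasurable_funM; first exact: measurable_cst.
    apply: emeasurable_prod => j.
    have mc : measurable_fun setT (fun x => (fun i => F x (i, j)) : vect 'I_n).
      by apply: measurable_vect => i; exact: (gauss_measurable (i, j) gF).
    exact: (measurableT_comp (measurable_gint M) mc).
  move=> x _; rewrite (eq_bigr (fun j => (expR (s * qf N (fun i => F x (i, j))))%:E)).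
    rewrite prodEFin -expR_sum -mulr_sumr -Af_sum -EFinM lee_fin.
    by apply: sqrtX_le_exp => //; exact: Af_ge0.
  by move=> j _; rewrite gintE.
have mp : measurable_fun setT (fun x => \prod_(j < d) gint M (fun i => F x (i, j)))%E.
  apply: emeasurable_prod => j.
  have mc : measurable_fun setT (fun x => (fun i => F x (i, j)) : vect 'I_n).
    by apply: measurable_vect => i; exact: (gauss_measurable (i, j) gF).
  exact: (measurableT_comp (measurable_gint M) mc).
have p0 x : setT x -> (0 <= \prod_(j < d) gint M (fun i => F x (i, j)))%E.
  by move=> _; apply: prode_ge0 => j _; exact: gint_ge0.
have cE : (0 <= (Num.sqrt (c ^+ m))%:E)%E by rewrite lee_fin.
rewrite (@ge0_integralZl _ _ R P setT measurableT _ mp _ p0 cE).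
rewrite (gauss_prodE gF gF1 (measurable_gint M) (gint_ge0 M)).
have := gauss_qf_le pM gF1; rewrite detM [complex.Re _]/= => le1.
set x := 1 - 2 * s in le1.
have x0 : 0 < x by move: s21 => /andP[_]; rewrite subr_gt0.
apply: (@le_trans _ _ ((Num.sqrt (c ^+ m))%:E * \prod_(j < d) ((Num.sqrt x)^-1)%:E)%E).
  apply: lee_wpmul2l => //; have I0 : (0 <= \int[P1]_y gint M (F1 y))%E.
    by apply: integral_ge0 => y _; exact: gint_ge0.
  elim: (d) => [|e IHe]; first by rewrite !big_ord0.
  by rewrite !big_ord_recl; apply: lee_pmul => //; apply: prode_ge0.
rewrite prodEFin -EFinM lee_fin prodr_const card_ord.
have -> : (Num.sqrt x)^-1 ^+ d = Num.sqrt (x^-1 ^+ d).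
  by rewrite -sqrtrV ?ltW// -[LHS]ger0_norm ?exprn_ge0 ?sqrtr_ge0//
    -sqrtr_sqr exprAC sqr_sqrtr ?invr_ge0 ?ltW.
have e0 := expR_gt0 (1 : R).
have cE' : c = 2 * d%:R / expR 1.
  by rewrite /c /s; field; rewrite !gt_eqF.
have c0' : 0 <= c by rewrite cE' divr_ge0 ?mulr_ge0 ?ltW.
rewrite -sqrtrM ?exprn_ge0//; apply: ler_wsqrtr.
have -> : 4 * d%:R / expR 1 = c * 2 by rewrite cE'; field; rewrite gt_eqF.
rewrite [(c * 2) ^+ m]exprMn; apply: ler_wpM2l; first exact: exprn_ge0.
rewrite exprVn -[leRHS]invrK -[(2 ^+ m)^-1]exprVn.
rewrite lef_pV2 ?posrE ?exprn_gt0 ?invr_gt0//.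
have := half_expn_le k m0; rewrite -dE.
rewrite (_ : m%:R / (2 * d%:R) = 2 * s)//.
by rewrite /s; field; rewrite gt_eqF.
Qed.

End moment.

(** * Tail integrals of exponentials and powers *)

Section tail_integrals.
Context {R : realType}.
Local Notation mu := (@lebesgue_measure R).

Lemma integral_expRN (y T : R) : 0 < y ->
  (\int[mu]_(s in `[T, +oo[) (expR (- (s * y)))%:E = (expR (- (T * y)) / y)%:E)%E.
Proof.
move=> y0; pose G s := - (expR (- (s * y)) / y).
have dG (s : R) : is_derive s 1 G (expR (- (s * y))).
  apply: is_derive_eq; rewrite /GRing.scale /=.
  by set e := expR _; field; rewrite gt_eqF.
have cont : continuous (fun s : R => expR (- (s * y))).
  move=> s; apply: continuous_comp; last exact: continuous_expR.
  by apply: (@cvgN R R^o); apply: (@cvgM R); [exact: cvg_id|exact: cvg_cst].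
rewrite (@ge0_continuous_FTC2y R _ G T 0).
- by rewrite /G -EFinB sub0r opprK.
- by move=> s _; exact: expR_ge0.
- by apply: continuous_subspaceT.
- rewrite -[X in _ --> X]oppr0; apply: (@cvgN R R^o).
  rewrite -[X in _ --> X](mul0r y^-1); apply: (@cvgM R); last exact: cvg_cst.
  apply: (cvg_comp (fun s : R => s * y) (fun u => expR (- u))).
    exact: gt0_cvgMly.
  exact: cvgr_expR.
- by move=> s _; exact: ex_derive.
- apply: cvg_at_right_filter; apply: (@differentiable_continuous R R^o R^o).
  by apply/derivable1_diffP; exact: ex_derive.
- by move=> s _; rewrite derive1E; exact: derive_val.
Qed.

(* r (1 - t y) <= exp (r (1 - t y) - 1), divided by r y *)
Lemma tail_exp (a y t r : R) : 0 < y -> a * y <= 1 -> 0 < r ->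
  ((Num.max 0 (a - t))%:E <= (expR (r - 1) / r)%:E *
     \int[mu]_(s in `[(r * t)%R, +oo[) (expR (- (s * y)))%:E)%E.
Proof.
move=> y0 ay r0; rewrite integral_expRN// -EFinM lee_fin ge_max.
have -> /= : 0 <= expR (r - 1) / r * (expR (- (r * t * y)) / y).
  by rewrite mulr_ge0 ?divr_ge0 ?expR_ge0 ?ltW.
have -> : expR (r - 1) / r * (expR (- (r * t * y)) / y) =
    expR (r * (1 - t * y) - 1) / (r * y).
  have -> : expR (r * (1 - t * y) - 1) = expR (r - 1) * expR (- (r * t * y)).
    by rewrite -expRD; congr expR; ring.
  by field; rewrite !gt_eqF.
rewrite ler_pdivlMr ?mulr_gt0//; apply: le_trans (_ : r * (1 - t * y) <= _).
  rewrite (_ : (a - t) * (r * y) = r * (a * y - t * y)); last by ring.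
  by rewrite ler_pM2l// lerD2r.
by have := expR_ge1Dx (r * (1 - t * y) - 1); rewrite addrC subrK.
Qed.

Lemma sqrtX_expR (x : R) m : 0 < x ->
  Num.sqrt (x ^+ m) = expR (m%:R / 2 * ln x).
Proof.
move=> x0; rewrite -{1}[x]lnK ?posrE// -expRM_natl.
rewrite (_ : m%:R * ln x = m%:R / 2 * ln x + m%:R / 2 * ln x); last by field.
by rewrite expRD -expr2 sqrtr_sqr ger0_norm// expR_ge0.
Qed.

Lemma cvg_lny : (@ln R x) @[x --> +oo] --> +oo.
Proof.
apply/cvgryPge => A; near=> x.
have xA : expR A <= x by near: x; exact: nbhs_pinfty_ge.
by rewrite -(expRK A) ler_ln ?posrE ?expR_gt0// (lt_le_trans _ xA) ?expR_gt0.
Unshelve. all: by end_near. Qed.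

(** The antiderivative is -2 / (m - 2) s (c / s)^(m / 2), written through logarithms because of the
    half-integer power. It tends to 0 at infinity since m > 2; for m = p + 1 this is the assumption
    p >= 2. *)
Lemma integral_sqrtXV (c T : R) m : 0 < c -> 0 < T -> (2 < m)%N ->
  (\int[mu]_(s in `[T, +oo[) (Num.sqrt ((c / s) ^+ m))%:E =
   (2 / (m%:R - 2) * T * Num.sqrt ((c / T) ^+ m))%:E)%E.
Proof.
move=> c0 T0 m2; have m20 : 0 < m%:R - 2 :> R by rewrite subr_gt0 ltr_nat.
pose h s := m%:R / 2 * (ln c - ln s).
have hE s : 0 < s -> Num.sqrt ((c / s) ^+ m) = expR (h s).
  by move=> s0; rewrite sqrtX_expR ?divr_gt0// ln_div ?posrE.
pose G s := - (2 / (m%:R - 2) * expR (ln s + h s)).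
have dG (s : R) : 0 < s -> is_derive s 1 G (expR (h s)).
  move=> s0; have dl := is_derive1_ln s0.
  apply: is_derive_eq; rewrite /GRing.scale /=.
  rewrite expRD lnK ?posrE//; set e := expR (h s).
  by field; rewrite !gt_eqF.
have eqI : (\int[mu]_(s in `[T, +oo[) (Num.sqrt ((c / s) ^+ m))%:E =
    \int[mu]_(s in `[T, +oo[) (expR (h s))%:E)%E.
  apply: eq_integral => s; rewrite inE/= in_itv/= andbT => Ts.
  by rewrite hE// (lt_le_trans T0).
rewrite eqI (@ge0_continuous_FTC2y R _ G T 0).
- by rewrite /G -EFinB sub0r opprK expRD lnK ?posrE// hE// mulrA.
- by move=> s _; exact: expR_ge0.
- apply: continuous_in_subspaceT => s; rewrite inE/= in_itv/= andbT => Ts.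
  have s0 : 0 < s by exact: lt_le_trans Ts.
  apply: continuous_comp; last exact: continuous_expR.
  apply: (@cvgM R); first exact: cvg_cst.
  by apply: (@cvgB R R^o); [exact: cvg_cst|exact: continuous_ln].
- rewrite -[X in _ --> X]oppr0; apply: (@cvgN R R^o).
  rewrite -[X in _ --> X](mulr0 (2 / (m%:R - 2))); apply: (@cvgM R).
    exact: cvg_cst.
  have -> : (fun s : R => expR (ln s + h s)) = (fun s => expR (m%:R / 2 * ln c) *
      expR (- ((m%:R / 2 - 1) * ln s))).
    by apply/funext => s; rewrite -expRD; congr expR; rewrite /h; ring.
  rewrite -[X in _ --> X](mulr0 (expR (m%:R / 2 * ln c))); apply: (@cvgM R).
    exact: cvg_cst.
  apply: (cvg_comp (fun s : R => (m%:R / 2 - 1) * ln s) (fun u => expR (- u))).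
    apply: (cvg_comp (@ln R) (fun u => (m%:R / 2 - 1) * u)).
      exact: cvg_lny.
    apply: gt0_cvgMry; [by rewrite subr_gt0 ltr_pdivlMr// mul1r -subr_gt0|exact: cvg_id].
  exact: cvgr_expR.
- by move=> s Ts; have := dG s (lt_trans T0 Ts) => ?; exact: ex_derive.
- apply: cvg_at_right_filter; apply: (@differentiable_continuous R R^o R^o).
  by apply/derivable1_diffP; have := dG T T0 => ?; exact: ex_derive.
- move=> s; rewrite in_itv/= andbT => Ts; rewrite derive1E.
  by have := dG s (lt_trans T0 Ts) => ?; exact: derive_val.
Qed.

End tail_integrals.

(** * A fresh column *)

Section fresh_column.
Context {R : realType}.
Local Notation C := R[i].
Local Notation vect I := (vect R I).
Variables (n k l : nat) (V : 'M[C]_(n, k)) (v : 'cV[C]_n).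

Definition colc (w : 'I_n -> R) : 'cV[C]_n := \col_i (w i)%:C.

Definition xi (f : 'I_n * 'I_l -> R) : 'rV[C]_k :=
  wv v f *m (Ov V f) ^t* *m pinvd (gramm (Ov V f)).

Definition rres (f : 'I_n * 'I_l -> R) (w : 'I_n -> R) : C :=
  ((v ^t* - xi f *m V ^t*) *m colc w) 0 0.

Definition excess (t : R) f w : R :=
  Num.max 0 (complex.Re (rres f w) ^+ 2 + complex.Im (rres f w) ^+ 2 - t).

Definition Xf f : R := complex.Re (nrm2 (xi f)).

Hypotheses (VV : V ^t* *m V = 1%:M) (vv : v ^t* *m v = 1%:M)
  (Vv : V ^t* *m v = 0).

Lemma nrm2_res f : nrm2 (v ^t* - xi f *m V ^t*) = (1 + Xf f)%:C.
Proof.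
have xE : nrm2 (xi f) = (Xf f)%:C by exact: ge0_ReE (nrm2_ge0 _).
rewrite rmorphD rmorph1/= -xE; move: (xi f) => x.
have vV : v ^t* *m V = 0 by rewrite -[LHS]trmxCK trmxC_mul trmxCK Vv linear0 map_mx0.
have E1 : x *m V ^t* *m v = 0 by rewrite -mulmxA Vv mulmx0.
have E2 : v ^t* *m (V *m x ^t*) = 0 by rewrite mulmxA vV mul0mx.
have E3 : x *m V ^t* *m (V *m x ^t*) = x *m x ^t*.
  by rewrite mulmxA -(mulmxA x) VV mulmx1.
rewrite /nrm2 trmxCB trmxC_mul !trmxCK mulmxBr !mulmxBl vv E1 E2 E3.
by rewrite subr0 sub0r opprK [LHS]mxE [X in X + _]mxE eqxx.
Qed.

Lemma Xf_ge0 f : 0 <= Xf f.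
Proof. by apply: RecR; exact: nrm2_ge0. Qed.

(** The residual is a complex linear form in the real vector w. By orthonormality the squared norms
    of its real and imaginary parts add up to 1 + [Xf]. The condition n > 1 provides the two
    coordinates for the reduction to the plane. *)
Lemma fresh_column_ge d1 (T1 : measurableType d1) (P1 : probability T1 R)
    (F1 : T1 -> vect 'I_n) (t : R) f : gauss_map P1 F1 -> (1 < n)%N -> 0 <= t ->
  (((1 + Xf f) * expR (- (t / (1 + Xf f))))%:E <=
   \int[P1]_y (excess t f (F1 y))%:E)%E.
Proof.
move=> gF1 n1 t0; set g := v ^t* - xi f *m V ^t*.
pose a i := complex.Re (g 0 i); pose b i := complex.Im (g 0 i).
have sE : \sum_i a i ^+ 2 + \sum_i b i ^+ 2 = 1 + Xf f.
  have := nrm2_res f; rewrite -/g nrm2E.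
  under eq_bigr do rewrite normCK.
  move=> /(congr1 (@complex.Re R)) /= <-.
  rewrite raddf_sum -big_split; apply: eq_bigr => i _ /=.
  by rewrite /a /b; case: (g 0 i) => u u' /=; ring.
have s0 : 0 < \sum_i a i ^+ 2 + \sum_i b i ^+ 2.
  by rewrite sE ltr_pwDl// Xf_ge0.
pose i0 : 'I_n := Ordinal (ltnW n1); pose i1 : 'I_n := Ordinal n1.
have := @gauss_form_tail R _ _ _ P1 F1 a b t i0 i1 isT gF1 t0 s0.
rewrite sE => /le_trans; apply; rewrite le_eqVlt; apply/orP; left; apply/eqP.
apply: eq_integral => y _; congr (Num.max 0 (_ ^+ 2 + _ ^+ 2 - t))%:E.
  rewrite /dot /rres -/g mxE raddf_sum; apply: eq_bigr => i _ /=.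
  by rewrite [colc _ _ _]mxE /a; case: (g 0 i) => u u' /=; ring.
rewrite /dot /rres -/g mxE raddf_sum; apply: eq_bigr => i _ /=.
by rewrite [colc _ _ _]mxE /b; case: (g 0 i) => u u' /=; ring.
Qed.

Definition addcol (f : 'I_n * 'I_l -> R) (w : 'I_n -> R) :
    'I_n * 'I_(l + 1) -> R :=
  fun ij => match fintype.split ij.2 with inl j => f (ij.1, j) | inr _ => w ij.1 end.

Lemma Wm_addcol f w : Wm (addcol f w) = row_mx (Wm f) (colc w).
Proof.
apply/matrixP => i j; rewrite !mxE /addcol/=.
by case: (fintype.split j) => j'; rewrite !mxE.
Qed.

Let last : 'I_(l + 1) := rshift l (0 : 'I_1).

(** [extra_column_le] bounds |r|^2 by 1 / y for y = 3 q / A, which is the rate of decay of [psi] in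
    s; [tail_exp] applies with this y. *)
Lemma excess_le t r f w : \det (gramm (Ov V f)) != 0 -> 0 < r -> 0 <= t ->
  ((excess t f w)%:E <= (expR (r - 1) / r)%:E *
   \int[lebesgue_measure]_(s in `[(r * t)%R, +oo[)
     psi V v (3 * s) (addcol f w) (fun j => (j == last)%:R))%E.
Proof.
move=> det0 r0 t0; set g := addcol f w.
have OE : Ov V g = row_mx (Ov V f) (V ^t* *m colc w).
  by rewrite /Ov /g Wm_addcol mul_mx_row.
have wE : wv v g = row_mx (wv v f) (v ^t* *m colc w).
  by rewrite /wv /g Wm_addcol mul_mx_row.
have rE : (v ^t* *m colc w - wv v f *m (Ov V f) ^t* *m pinvd (gramm (Ov V f)) *m
    (V ^t* *m colc w)) 0 0 = rres f w.
  by rewrite /rres /xi mulmxBl !mulmxA.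
have [q0 le1 z0] := extra_column_le (V ^t* *m colc w) (wv v f) (v ^t* *m colc w) det0.
rewrite rE -wE -OE in q0 le1 z0.
have uE : row_mx 0 1%:M = delta_mx 0 last :> 'rV[C]_(l + 1).
  apply/rowP => j; rewrite !mxE; case: fintype.splitP => j' jE; rewrite !mxE.
    by rewrite (_ : (j == last) = false)//; apply/negbTE/eqP => jl;
      move: (ltn_ord j'); rewrite -jE jl /= addn0 ltnn.
  rewrite !ord1/= (_ : (j == last) = true)//; apply/eqP/val_inj => /=.
  by rewrite jE ord1.
rewrite uE delta_form -/(Nf V v g) in q0 le1.
have qE := ge0_ReE (ltW q0); set q := complex.Re _ in qE.
rewrite qE in q0 le1; have q0' : 0 < q by rewrite ltcR in q0.
have AE := ge0_ReE (nrm2_ge0 (wv v g)); rewrite -/(Af v g) in AE.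
have psiE s : psi V v (3 * s) g (fun j => (j == last)%:R) = pexp (3 * s) (Af v g) q.
  rewrite /psi (@qf_line _ _ _ last); last by move=> i /negbTE->.
  by rewrite eqxx expr1n mul1r.
have integral0 : (0 <= (expR (r - 1) / r)%:E *
   \int[lebesgue_measure]_(s in `[(r * t)%R, +oo[)
     psi V v (3 * s) g (fun j => (j == last)%:R))%E.
  apply: mule_ge0; first by rewrite lee_fin divr_ge0 ?expR_ge0// ltW.
  by apply: integral_ge0 => s _; exact: psi_ge0.
(* If the extended row vanishes, so does the residual, in agreement with the default value of
   [pexp]. *)
have [A0|A0] := eqVneq (Af v g) 0.
  rewrite /excess z0.
    rewrite /= expr0n/= addr0 sub0r.
    by rewrite [Num.max _ _](_ : _ = 0)//; apply/max_idPl; rewrite oppr_le0.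
  by apply/eqP; rewrite -nrm2_eq0 AE A0.
have Ap : 0 < Af v g by rewrite lt_def A0 Af_ge0.
have y0 : 0 < 3 * q / Af v g by rewrite divr_gt0// mulr_gt0.
have nE : `|rres f w| ^+ 2 =
    (complex.Re (rres f w) ^+ 2 + complex.Im (rres f w) ^+ 2)%:C.
  rewrite normCK; case: (rres f w) => u u'.
  by apply/eqP; rewrite eq_complex/=; apply/andP; split; apply/eqP; ring.
have ay : (complex.Re (rres f w) ^+ 2 + complex.Im (rres f w) ^+ 2) *
    (3 * q / Af v g) <= 1.
  move: le1; rewrite nE AE; move: (_ + _) => e le1.
  by rewrite -lecR rmorphM/= fmorph_div/= rmorphM/= rmorph_nat rmorph1.
have := tail_exp t y0 ay r0; rewrite -/(excess t f w) => /le_trans; apply.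
rewrite le_eqVlt; apply/orP; left; apply/eqP; congr (_ * _)%E.
apply: eq_integral => s _; rewrite psiE /pexp (negbTE A0).
by congr (expR (- _))%:E; field.
Qed.

End fresh_column.

(** * The mean excess over matrix and fresh column *)

Section fresh_moment.
Context {R : realType}.
Local Notation C := R[i].
Local Notation vect I := (vect R I).
Local Notation mu := (@lebesgue_measure R).

Lemma integral_indicM (D : set R) (f : R -> \bar R) :
  (\int[mu]_(s in D) f s = \int[mu]_s (f s * (\1_D s)%:E))%E.
Proof.
rewrite integral_mkcond; apply: eq_integral => s _.
rewrite patchE indicE; case: ifPn => [sD|sD].
  by rewrite mule1.
by rewrite mule0.
Qed.

Lemma mmeas_mulWm n l p (A : 'M[C]_(p, n)) :
  mmeas (fun f : vect ('I_n * 'I_l)%type => A *m Wm f).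
Proof. by apply: mmeasM; [exact: mmeas_cst|exact: mmeas_Wm]. Qed.

Lemma mmeas_comp d1 d2 (T1 : measurableType d1) (T2 : measurableType d2) p q
    (A : T2 -> 'M[C]_(p, q)) (G : T1 -> T2) :
  measurable_fun setT G -> mmeas A -> mmeas (fun x => A (G x)).
Proof.
move=> mG mA i j; case: (mA i j) => h1 h2.
by split; [exact: (measurableT_comp h1 mG)|exact: (measurableT_comp h2 mG)].
Qed.

Section measurability.
Variables (d0 : measure_display) (T : measurableType d0) (n k l : nat).
Variables (V : 'M[C]_(n, k)) (v : 'cV[C]_n) (F : T -> vect ('I_n * 'I_l)%type).
Hypothesis mF : measurable_fun setT F.

Let mO : mmeas (fun x => Ov V (F x)).
Proof. exact: (mmeas_comp mF (@mmeas_mulWm n l k (V ^t*))). Qed.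

Lemma mmeas_xi : mmeas (fun x => xi V v (F x)).
Proof.
apply: mmeasM; last first.
  by apply: mmeas_pinvd; apply: mmeasM => //; exact: mmeas_trmxC.
apply: mmeasM; last exact: mmeas_trmxC.
exact: (mmeas_comp mF (@mmeas_mulWm n l 1 (v ^t*))).
Qed.

Lemma measurable_det0 :
  measurable_fun setT (fun x => \det (gramm (Ov V (F x))) == 0).
Proof.
have mdet : cmeas (fun x => \det (gramm (Ov V (F x)))).
  by apply: cmeas_det; apply: mmeasM => //; exact: mmeas_trmxC.
rewrite (_ : (fun x => _) = (fun x =>
  (complex.Re (\det (gramm (Ov V (F x)))) == 0) &&
  (complex.Im (\det (gramm (Ov V (F x)))) == 0))).
  by case: mdet => m1 m2'; apply: measurable_and; exact: measurable_fun_eqr.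
by apply/funext => x; case: (\det _) => a b; rewrite eq_complex.
Qed.

Lemma measurable_fresh t d1 (T1 : measurableType d1) (F1 : T1 -> vect 'I_n) :
  measurable_fun setT F1 ->
  measurable_fun setT (fun z : T * T1 =>
    if \det (gramm (Ov V (F z.1))) == 0 then 0%E
    else (excess V v t (F z.1) (F1 z.2))%:E).
Proof.
move=> mF1; apply: measurable_fun_ifT.
- exact: (measurableT_comp measurable_det0 measurable_fst).
- exact: measurable_cst.
have [h1 h2] : cmeas (fun z : T * T1 => rres V v (F z.1) (F1 z.2)).
  have mm : mmeas (fun z : T * T1 => (v ^t* - xi V v (F z.1) *m V ^t*) *m
      colc (F1 z.2)).
    apply: mmeasM.
      apply: mmeasB; first exact: mmeas_cst.
      apply: mmeasM; last exact: mmeas_cst.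
      exact: (mmeas_comp (@measurable_fst _ _ T T1) mmeas_xi).
    move=> i j; rewrite (_ : (fun z => _) = (fun z : T * T1 => (F1 z.2 i)%:C)).
      apply: cmeas_real.
      exact: (measurableT_comp (measurableT_comp (measurable_coord i) mF1) measurable_snd).
    by apply/funext => z; rewrite mxE.
  exact: mm.
apply/measurable_EFinP; apply: measurable_maxr => //.
by apply: measurable_funB => //; apply: measurable_funD; exact: measurable_funX.
Qed.

End measurability.

Variables (n k l m : nat) (V : 'M[C]_(n, k)) (v : 'cV[C]_n).
Hypotheses (vv : v ^t* *m v = 1%:M) (dE : (l + 1 = k + m)%N) (m2 : (2 < m)%N).

(** With d = l + 1 columns, [Phi_le] at s / d contributes d / 6 and [moment_le] contributes 4 d / e.
    The 3 in the denominator stems from the tilt. *)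
Definition kap : R := 2 * (l + 1)%:R ^+ 2 / (3 * expR 1).

(* [excess_le] with r = m / 2, then [integral_sqrtXV] on [m t / 2, + oo[. *)
Definition Bt (t : R) : R := expR (m%:R / 2 - 1) / (m%:R / 2) *
  (2 * (2 / (m%:R - 2) * (m%:R / 2 * t) * Num.sqrt ((kap / (m%:R / 2 * t)) ^+ m))).

Lemma Phi_le_explicit d0 (T : measurableType d0) (P : probability T R)
    (F : T -> vect ('I_n * 'I_(l + 1))%type) i0 (s : R) :
  gauss_map P F -> 0 < s ->
  (Phi V v P F i0 s <= (2 * Num.sqrt ((kap / s) ^+ m))%:E)%E.
Proof.
move=> gF s0; set d : R := (l + 1)%:R.
have d0' : 0 < d by rewrite ltr0n addn1.
have e0 := expR_gt0 (1 : R).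
have sd0 : 0 < s / d by rewrite divr_gt0.
have := @Phi_le R n k m (l + 1) V v dE _ _ P F gF i0 (s / d) sd0.
rewrite -/d divfK ?gt_eqF// => /le_trans; apply.
have mF : measurable_fun setT F by case: gF.
have mA : measurable_fun setT (fun x => (Num.sqrt (Af v (F x) ^+ m))%:E).
  apply/measurable_EFinP; apply: (measurableT_comp measurable_sqrtr).
  apply: measurable_funX; exact: (measurableT_comp (measurable_Af v) mF).
have sA0 x : setT x -> (0 <= (Num.sqrt (Af v (F x) ^+ m))%:E)%E.
  by move=> _; rewrite lee_fin sqrtr_ge0.
pose c := 2 * Num.sqrt ((6 * (s / d))^-1 ^+ m).
have c0 : (0 <= c%:E)%E by rewrite lee_fin mulr_ge0 ?sqrtr_ge0.
have q0 : 0 <= (6 * (s / d))^-1 by rewrite invr_ge0 mulr_ge0// ltW.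
have -> : (\int[P]_x (2 * Num.sqrt ((Af v (F x) / (6 * (s / d))) ^+ m))%:E =
    c%:E * \int[P]_x (Num.sqrt (Af v (F x) ^+ m))%:E)%E.
  rewrite -(@ge0_integralZl _ _ R P setT measurableT _ mA _ sA0 c0).
  apply: eq_integral => x _; rewrite -EFinM /c -mulrA -sqrtrM ?exprn_ge0//.
  by rewrite -exprMn [_^-1 * _]mulrC.
have m0 : (0 < m)%N by exact: ltn_trans m2.
have dE' : (l + 1 = m + k)%N by rewrite dE addnC.
apply: le_trans (lee_wpmul2l c0 (moment_le vv gF m0 dE')) _.
rewrite -EFinM lee_fin /c -[2 * _ * _]mulrA ler_pM2l// -sqrtrM ?exprn_ge0//.
apply: ler_wsqrtr; rewrite -exprMn le_eqVlt; apply/orP; left; apply/eqP.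
by congr (_ ^+ _); rewrite /kap -/d; field; rewrite !gt_eqF.
Qed.

(** The matrix with the fresh column appended is again gaussian, so once the integrals are
    exchanged, the expectation at each s is a value of [Phi]. Samples with a singular Gram matrix
    get the value 0, as [excess_le] says nothing about them. *)
Lemma fresh_moment_le d0 (T : measurableType d0) (P : probability T R)
    (F : T -> vect ('I_n * 'I_l)%type)
    d1 (T1 : measurableType d1) (P1 : probability T1 R) (F1 : T1 -> vect 'I_n)
    (t : R) :
  gauss_map P F -> gauss_map P1 F1 -> 0 < t ->
  (\int[P]_x \int[P1]_y (if \det (gramm (Ov V (F x))) == 0%R then 0
     else (excess V v t (F x) (F1 y))%:E) <= (Bt t)%:E)%E.
Proof.
move=> gF gF1 t0.
have mF : measurable_fun setT F by case: gF.
have mF1 : measurable_fun setT F1 by case: gF1.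
have m0 : 0 < m%:R / 2 :> R by rewrite divr_gt0// ltr0n (ltn_trans _ m2).
(* As a function of r the resulting bound is proportional to e^r / r^(m / 2), which is smallest at m
   / 2. *)
set r : R := m%:R / 2 in m0 *.
pose last : 'I_(l + 1) := rshift l (0 : 'I_1).
pose F2 (z : T * T1) : vect ('I_n * 'I_(l + 1))%type := addcol (F z.1) (F1 z.2).
have gF2 : gauss_map (P \x P1)%E F2.
  apply: (gauss_sub (e := fun ij : 'I_n * 'I_(l + 1) =>
      match fintype.split ij.2 with inl j => inl (ij.1, j) | inr _ => inr ij.1 end)
      _ _ (gauss_join gF gF1)).
    move=> [i j] [i' j']/=; case: fintype.splitP => a aE;
      case: fintype.splitP => b bE //.
      by case=> -> ab; rewrite (_ : j = j')//; apply/val_inj; rewrite /= aE bE ab.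
    by case=> ->; rewrite (_ : j = j')//; apply/val_inj; rewrite /= aE bE !ord1.
  by move=> z [i j]; rewrite /F2 /addcol/=; case: (fintype.split j).
have mF2 : measurable_fun setT F2 by case: gF2.
set D := `[(r * t)%R, +oo[%classic.
pose dl (j : 'I_(l + 1)) : R := (j == last)%:R.
(* The half-line enters as an indicator, so that Tonelli's theorem is applied on the whole line. *)
pose psi2 (w : (T * T1) * R) : \bar R :=
  (psi V v (3 * w.2) (F2 w.1) dl * (\1_D w.2)%:E)%E.
have psi20 w : (0 <= psi2 w)%E.
  by apply: mule_ge0; [exact: psi_ge0|exact: indic_ge0].
have mpsi2 : measurable_fun setT psi2.
  apply: emeasurable_funM; last first.
    apply/measurable_EFinP; apply: (measurableT_comp _ measurable_snd).
    by apply: measurable_indic; exact: measurable_itv.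
  have m1 (h : vect ('I_n * 'I_(l + 1))%type -> R) : measurable_fun setT h ->
      measurable_fun setT (fun w : (T * T1) * R => h (F2 w.1)).
    by move=> mh; apply: (measurableT_comp (measurableT_comp mh mF2) measurable_fst).
  have mA := m1 _ (measurable_Af v).
  rewrite /psi /pexp; apply: measurable_fun_ifT.
  - exact: measurable_fun_eqr.
  - exact: measurable_cst.
  - apply/measurable_EFinP; apply: measurableT_comp => //.
    apply: (measurableT_comp (@oppr_measurable R setT)).
    apply: measurable_funM; last exact: measurable_invr.
    apply: measurable_funM; first by apply: measurable_funM => //; exact: measurable_snd.
    apply: (m1 (fun f => qf (Nf V v f) dl)).
    apply: measurable_sum => i; apply: measurable_sum => j.
    by apply: measurable_funM => //; have [] := mmeas_Nf V v i j.
have mI1 := @measurable_fun_fubini_tonelli_F _ _ _ _ R mu psi2 mpsi2 psi20.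
have I10 z : (0 <= \int[mu]_s psi2 (z, s))%E by exact: integral_ge0.
pose c : \bar R := (expR (r - 1) / r)%:E.
have c0 : (0 <= c)%E by rewrite lee_fin divr_ge0 ?expR_ge0// ltW.
have step1 : (\int[P]_x \int[P1]_y (if \det (gramm (Ov V (F x))) == 0%R then 0
     else (excess V v t (F x) (F1 y))%:E) <=
     \int[P]_x \int[P1]_y (c * \int[mu]_s psi2 ((x, y), s)))%E.
  have mcI : measurable_fun setT (fun z => c * \int[mu]_s psi2 (z, s))%E.
    by apply: emeasurable_funM => //; exact: measurable_cst.
  have cI0 z : (0 <= c * \int[mu]_s psi2 (z, s))%E by exact: mule_ge0.
  have mint := measurable_fresh V v mF t mF1.
  have int0 z : (0 <= if \det (gramm (Ov V (F z.1))) == 0%R then 0%E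
      else (excess V v t (F z.1) (F1 z.2))%:E)%E.
    by case: ifP => // _; rewrite lee_fin le_max lexx.
  apply: ge0_le_integral.
  - exact: measurableT.
  - by move=> x _; apply: integral_ge0 => y _; exact: (int0 (x, y)).
  - exact: (@measurable_fun_fubini_tonelli_F _ _ _ _ R P1 _ mint int0).
  - exact: (@measurable_fun_fubini_tonelli_F _ _ _ _ R P1 _ mcI cI0).
  move=> x _; apply: ge0_le_integral.
  - exact: measurableT.
  - by move=> y _; exact: (int0 (x, y)).
  - exact: (measurableT_comp mint (pair1_measurable x)).
  - exact: (measurableT_comp mcI (pair1_measurable x)).
  move=> y _; case: eqVneq => [_|det0]; first exact: (cI0 (x, y)).
  have := excess_le v (F1 y) det0 m0 (ltW t0); rewrite integral_indicM.
  by [].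
apply: le_trans step1 _.
have mcI : measurable_fun setT (fun z => c * \int[mu]_s psi2 (z, s))%E.
  by apply: emeasurable_funM => //; exact: measurable_cst.
have cI0 z : (0 <= c * \int[mu]_s psi2 (z, s))%E by exact: mule_ge0.
pose Q : probability (T * T1)%type R := (P \x P1)%E.
have E2 : (\int[P]_x \int[P1]_y (c * \int[mu]_s psi2 ((x, y), s)) =
    \int[Q]_z (c * \int[mu]_s psi2 (z, s)))%E.
  exact: esym (@fubini_tonelli1 _ _ _ _ R P P1 _ mcI cI0).
rewrite [leLHS]E2.
rewrite (@ge0_integralZl _ _ R Q setT measurableT _ mI1 _ (fun z _ => I10 z) c0).
rewrite (@fubini_tonelli _ _ _ _ R Q mu psi2 mpsi2 psi20).
rewrite /Bt EFinM; apply: lee_wpmul2l => //.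
have mPhi := @measurable_fun_fubini_tonelli_G _ _ _ _ R Q psi2 mpsi2 psi20.
have T0 : 0 < r * t by rewrite mulr_gt0.
have kap0 : 0 < kap.
  by rewrite divr_gt0 ?mulr_gt0 ?expR_gt0// exprn_gt0// ltr0n addn1.
have msq : measurable_fun setT (fun s : R => (2 * Num.sqrt ((kap / s) ^+ m))%:E).
  apply/measurable_EFinP; apply: measurable_funM => //.
  apply: (measurableT_comp measurable_sqrtr); apply: measurable_funX.
  by apply: measurable_funM => //; exact: measurable_invr.
have sq0 s : (0 <= (2 * Num.sqrt ((kap / s) ^+ m))%:E)%E.
  by rewrite lee_fin mulr_ge0// sqrtr_ge0.
apply: (@le_trans _ _ (\int[mu]_(s in D) (2 * Num.sqrt ((kap / s) ^+ m))%:E)%E).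
  rewrite integral_indicM; apply: ge0_le_integral.
  - exact: measurableT.
  - by move=> s _; exact: integral_ge0.
  - exact: mPhi.
  - apply: emeasurable_funM => //; apply/measurable_EFinP.
    by apply: measurable_indic; exact: measurable_itv.
  move=> s _; rewrite indicE; case: (boolP (s \in D)) => sD /=.
    rewrite mule1.
    have s0 : 0 < s.
      by apply: lt_le_trans T0 _; move: sD; rewrite inE /D/= in_itv/= andbT.
    apply: le_trans (Phi_le_explicit last gF2 s0).
    rewrite /Phi le_eqVlt; apply/orP; left; apply/eqP; apply: eq_integral => z _.
    by rewrite /psi2/= indicE sD mule1.
  rewrite mule0 le_eqVlt; apply/orP; left; apply/eqP.
  by apply: integral0_eq => z _; rewrite /psi2/= indicE (negbTE sD) mule0.
have -> : (\int[mu]_(s in D) (2 * Num.sqrt ((kap / s) ^+ m))%:E =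
    2%:E * \int[mu]_(s in D) (Num.sqrt ((kap / s) ^+ m))%:E)%E.
  have mD : measurable D by exact: measurable_itv.
  have msq' : measurable_fun D (fun s : R => (Num.sqrt ((kap / s) ^+ m))%:E).
    apply: measurable_funTS; apply/measurable_EFinP.
    apply: (measurableT_comp measurable_sqrtr); apply: measurable_funX.
    by apply: measurable_funM => //; exact: measurable_invr.
  have sq0' s : D s -> (0 <= (Num.sqrt ((kap / s) ^+ m))%:E)%E.
    by move=> _; rewrite lee_fin sqrtr_ge0.
  by rewrite -(@ge0_integralZl _ _ R mu D mD _ msq' _ sq0').
by rewrite integral_sqrtXV// -EFinM.
Qed.

End fresh_moment.

(** * Markov's inequality for the weighted average *)

Section bad_event.
Context {R : realType}.
Local Notation C := R[i].
Local Notation vect I := (vect R I).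
Variables (n k l m : nat) (J : finType).
Variables (V : J -> 'M[C]_(n, k)) (v : J -> 'cV[C]_n) (a : J -> R).
Hypotheses (VV : forall j, (V j) ^t* *m V j = 1%:M)
  (vv : forall j, (v j) ^t* *m v j = 1%:M)
  (Vv : forall j, (V j) ^t* *m v j = 0).
Hypotheses (n1 : (1 < n)%N) (dE : (l + 1 = k + m)%N) (m2 : (2 < m)%N).
Hypotheses (a0 : forall j, 0 <= a j) (a_gt0 : 0 < \sum_j a j).

Variables (d0 : measure_display) (T : measurableType d0) (P : probability T R).
Variables (F : T -> vect ('I_n * 'I_l)%type).
Hypothesis gF : gauss_map P F.

Definition bad (x0 : R) : set T :=
  [set x | (forall j, \det (gramm (Ov (V j) (F x))) != 0) /\
    x0 * \sum_j a j < \sum_j a j * (1 + Xf (V j) (v j) (F x))].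

Let mF : measurable_fun setT F. Proof. by case: gF. Qed.

Lemma measurable_bad x0 : measurable (bad x0).
Proof.
have -> : bad x0 =
    \big[setI/setT]_(j in J) [set x | \det (gramm (Ov (V j) (F x))) != 0] `&`
    [set x | x0 * \sum_j a j < \sum_j a j * (1 + Xf (V j) (v j) (F x))].
  rewrite -bigcap_seq; apply/seteqP; split=> x [/= h1 h2]; split=> // j.
    by move=> _; exact: h1.
  by apply: h1; rewrite /= mem_index_enum.
apply: measurableI.
  apply: bigsetI_measurable => j _.
  have mb := @measurable_det0 R _ _ _ _ _ (V j) F mF.
  rewrite (_ : [set x | _] = [set: T] `&`
      (fun x => \det (gramm (Ov (V j) (F x))) == 0) @^-1` [set false]).
    exact: mb.
  by rewrite setTI; apply/seteqP; split=> x /=; case: (_ == _).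
have ms : measurable_fun setT
    (fun x => \sum_j a j * (1 + Xf (V j) (v j) (F x))).
  apply: measurable_sum => j; apply: measurable_funM => //.
  apply: measurable_funD => //.
  have [] : cmeas (fun x => nrm2 (xi (V j) (v j) (F x))); last by [].
  by apply: cmeas_nrm2; exact: mmeas_xi.
rewrite (_ : [set x | _] = [set: T] `&`
  (fun x => \sum_j a j * (1 + Xf (V j) (v j) (F x))) @^-1`
    `](x0 * \sum_j a j), +oo[).
  by apply: ms => //; exact: measurable_itv.
by rewrite setTI; apply/seteqP; split=> x /=; rewrite in_itv/= andbT.
Qed.

(* e^(-c) ((1 + c) s - t) is tangent to the convex function s e^(-t/s) *)
Lemma tangent_bound (c s t : R) : 0 < s ->
  expR (- c) * ((1 + c) * s - t) <= s * expR (- (t / s)).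
Proof.
move=> s0; have := expR_ge1Dx (c - t / s).
have -> : expR (- (t / s)) = expR (- c) * expR (c - t / s).
  by rewrite -expRD; congr expR; ring.
have e0 := expR_gt0 (- c).
move=> le1; rewrite mulrCA ler_pM2l//.
apply: le_trans (_ : s * (1 + (c - t / s)) <= _); last by rewrite ler_pM2l.
by rewrite le_eqVlt; apply/orP; left; apply/eqP; field; rewrite gt_eqF.
Qed.

(** Markov's inequality for the a-weighted sum of the mean excesses over a fresh column. On the bad
    event [fresh_column_ge] and [tangent_bound] make this sum at least e^(-c) ((1 + c) x0 - t) times
    the total weight, and t = c x0 leaves e^(-c) x0. *)
Lemma bad_prob (x0 : R) : 0 < x0 ->
  (P (bad x0) <= (expR (m%:R / 2 - 1) * @Bt R l m ((m%:R / 2 - 1) * x0) / x0)%:E)%E.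
Proof.
(* [Bt] is proportional to t^(1 - m / 2), so the final bound is proportional to e^c c^(1 - m / 2),
   which is smallest at this c. *)
move=> x00; set c : R := m%:R / 2 - 1; set t := c * x0.
have c0 : 0 < c.
  by rewrite subr_gt0 ltr_pdivlMr// mul1r ltr_nat.
have t0 : 0 < t by rewrite mulr_gt0.
have [d1 [T1 [P1 [F1 gF1]]]] := @gauss_exists R 'I_n.
have mF1 : measurable_fun setT F1 by case: gF1.
pose h j (z : T * T1) : \bar R := if \det (gramm (Ov (V j) (F z.1))) == 0 then 0%E
  else (excess (V j) (v j) t (F z.1) (F1 z.2))%:E.
have h0 j z : (0 <= h j z)%E.
  by rewrite /h; case: ifP => // _; rewrite lee_fin le_max lexx.
have mh j : measurable_fun setT (h j) by exact: measurable_fresh.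
pose g j x := (\int[P1]_y h j (x, y))%E.
have g0 j x : (0 <= g j x)%E by apply: integral_ge0 => y _; exact: h0.
have mg j : measurable_fun setT (g j).
  exact: (@measurable_fun_fubini_tonelli_F _ _ _ _ R P1 _ (mh j) (h0 j)).
have gB j : (\int[P]_x g j x <= (@Bt R l m t)%:E)%E.
  exact: (fresh_moment_le (V j) (vv j) dE m2 gF gF1 t0).
pose W := \sum_j a j; have W0 : 0 < W by exact: a_gt0.
pose G x := (\sum_j (a j)%:E * g j x)%E.
have ag0 j x : (0 <= (a j)%:E * g j x)%E by rewrite mule_ge0// lee_fin.
have mag j : measurable_fun setT (fun x => (a j)%:E * g j x)%E.
  by apply: emeasurable_funM => //; exact: measurable_cst.
have mG : measurable_fun setT G by exact: emeasurable_sum.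
have key x : ((expR (- c) * x0 * W)%:E * (\1_(bad x0) x)%:E <= G x)%E.
  rewrite indicE; case: (boolP (x \in bad x0)) => xb; last first.
    by rewrite mule0; apply: sume_ge0 => j _; exact: ag0.
  rewrite mule1; move: xb; rewrite inE => -[/= dx xW].
  apply: (@le_trans _ _ (\sum_j (a j * (expR (- c) *
      ((1 + c) * (1 + Xf (V j) (v j) (F x)) - t)))%:E)%E).
    rewrite sumEFin lee_fin.
    have -> : \sum_j a j * (expR (- c) * ((1 + c) * (1 + Xf (V j) (v j) (F x)) - t))
        = expR (- c) * ((1 + c) * (\sum_j a j * (1 + Xf (V j) (v j) (F x))) - t * W).
      rewrite /W !mulr_sumr -sumrB mulr_sumr; apply: eq_bigr => j _.
      by ring.
    rewrite -mulrA ler_pM2l ?expR_gt0//.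
    apply: le_trans (_ : (1 + c) * (x0 * W) - t * W <= _).
      by rewrite le_eqVlt; apply/orP; left; apply/eqP; rewrite /t; ring.
    by rewrite lerD2r ler_pM2l ?ltW// addr_gt0.
  apply: lee_sum => j _; rewrite EFinM; apply: lee_wpmul2l; first by rewrite lee_fin.
  have s0 : 0 < 1 + Xf (V j) (v j) (F x) by rewrite ltr_pwDl// Xf_ge0.
  apply: le_trans (_ : _ <= ((1 + Xf (V j) (v j) (F x)) *
      expR (- (t / (1 + Xf (V j) (v j) (F x)))))%:E)%E _.
    by rewrite lee_fin; exact: tangent_bound.
  apply: le_trans (fresh_column_ge (VV j) (vv j) (Vv j) (F x) gF1 n1 (ltW t0)) _.
  rewrite le_eqVlt; apply/orP; left; apply/eqP; apply: eq_integral => y _.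
  by rewrite /h/= (negbTE (dx j)).
have e0 := expR_gt0 (- c).
have q0 : 0 < expR (- c) * x0 * W by rewrite !mulr_gt0.
have mbad := measurable_bad x0.
have step : ((expR (- c) * x0 * W)%:E * P (bad x0) <= (W * @Bt R l m t)%:E)%E.
  rewrite (measure_int_indic P mbad).
  have qE : (0 <= (expR (- c) * x0 * W)%:E)%E by rewrite lee_fin ltW.
  rewrite -(@ge0_integralZl _ _ R P setT measurableT _ (measurable_EFin_indic mbad) _
    (fun x _ => indic_ge0 _ x) qE).
  apply: (@le_trans _ _ (\int[P]_x G x)%E).
    apply: ge0_le_integral.
    - exact: measurableT.
    - by move=> x _; apply: mule_ge0 => //; exact: indic_ge0.
    - apply: emeasurable_funM; first exact: measurable_cst.
      exact: measurable_EFin_indic.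
    - exact: mG.
    - by move=> x _; exact: key.
  rewrite /G ge0_integral_sum//.
  rewrite /W mulr_suml -sumEFin; apply: lee_sum => j _.
  have ajE : (0 <= (a j)%:E)%E by rewrite lee_fin.
  rewrite (@ge0_integralZl _ _ R P setT measurableT _ (mg j) _ (fun x _ => g0 j x) ajE).
  by rewrite EFinM; apply: lee_wpmul2l => //; exact: gB.
have Pfin : P (bad x0) = (fine (P (bad x0)))%:E.
  by rewrite fineK// fin_num_measure.
rewrite Pfin -EFinM lee_fin in step; rewrite Pfin lee_fin.
rewrite ler_pdivlMr// mulrC -(ler_pM2l (expR_gt0 (- c))) mulrA.
rewrite -(ler_pM2l W0) mulrA (_ : expR (- c) * (expR c * @Bt R l m t) = @Bt R l m t).
  by rewrite [W * _]mulrC.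
by rewrite mulrA -expRD addNr expR0 mul1r.
Qed.

End bad_event.

(** * The constant *)

Section constants.
Context {R : realType}.

(** Five squarings of 1 + 1/32 <= e^(1/32), with rounding down in between. *)
Lemma expR1_ge : 8 / 3 <= expR 1 :> R.
Proof.
pose a (i : nat) : R := expR ((2^-1 : R) ^+ i).
have aS i : a i = a i.+1 * a i.+1.
  by rewrite /a -expRD exprS; congr expR; field.
have a5 : 33 / 32 <= a 5%N.
  by apply: le_trans (expR_ge1Dx _); lra.
have sq (x y z : R) : 0 <= x -> x <= y -> z <= x * x -> z <= y * y.
  by move=> x0 xy zx; apply: le_trans zx _; rewrite ler_pM.
have a4 : (53 * 100 + 17) / (50 * 100) <= a 4%N.
  by rewrite aS; apply: sq a5 _; lra.
have a3 : (56 * 100 + 53) / (50 * 100) <= a 3%N.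
  by rewrite aS; apply: sq a4 _; lra.
have a2 : (6 * 100 + 39) / (5 * 100) <= a 2%N.
  by rewrite aS; apply: sq a3 _; lra.
have a1 : (16 * 100 + 33) / (10 * 100) <= a 1%N.
  by rewrite aS; apply: sq a2 _; lra.
have -> : expR 1 = a 0%N by rewrite /a expr0.
by rewrite aS; apply: sq a1 _; lra.
Qed.

Lemma ln2_ge : 2^-1 <= ln 2 :> R.
Proof.
rewrite -(expRK 2^-1) ler_ln ?posrE ?expR_gt0//.
have := expR_ge1Dx (- 2^-1 : R); rewrite expRN => le1.
have e0 := expR_gt0 (2^-1 : R).
rewrite -[leRHS]invrK -lef_pV2 ?posrE ?invr_gt0 ?invrK//.
by apply: le_trans le1; lra.
Qed.

(* For m = 3 this is 27 <= e^4, otherwise it follows from ln x <= x - 1. *)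
Lemma sqrtX_ratio_le (m : nat) : (2 < m)%N ->
  Num.sqrt ((m%:R / (m%:R - 2)) ^+ m) <= expR 2 :> R.
Proof.
move=> m2; have e83 := expR1_ge.
have [->|m3] := eqVneq m 3%N.
  have -> : expR 2 = Num.sqrt (expR 2 ^+ 2) :> R.
    by rewrite sqrtr_sqr ger0_norm// expR_ge0.
  apply: ler_wsqrtr.
  have -> : expR 2 = expR 1 ^+ 2 :> R by rewrite -expRM_natl mulr1.
  rewrite -exprM; apply: le_trans (_ : (8 / 3) ^+ 4 <= _).
    by rewrite (_ : 3 - 2 = 1 :> R) ?divr1; lra.
  by apply: lerXn2r; rewrite ?nnegrE ?expR_ge0.
have m4 : (3 < m)%N by rewrite ltn_neqAle eq_sym m3.
have m20 : 0 < m%:R - 2 :> R by rewrite subr_gt0 ltr_nat.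
have m0 : 0 < m%:R :> R by rewrite ltr0n (ltn_trans _ m2).
have q0 : 0 < m%:R / (m%:R - 2) :> R by rewrite divr_gt0.
rewrite sqrtX_expR// ler_expR.
have := expR_ge1Dx (ln (m%:R / (m%:R - 2)) : R); rewrite lnK ?posrE// => le1.
have le2 : ln (m%:R / (m%:R - 2)) <= 2 / (m%:R - 2) :> R.
  have -> : 2 / (m%:R - 2) = m%:R / (m%:R - 2) - 1 :> R by field; rewrite gt_eqF.
  by rewrite lerBrDl.
apply: le_trans (_ : m%:R / 2 * (2 / (m%:R - 2)) <= _).
  by rewrite ler_pM2l// divr_gt0.
have -> : m%:R / 2 * (2 / (m%:R - 2)) = m%:R / (m%:R - 2) :> R.
  by field; rewrite gt_eqF.
rewrite ler_pdivrMr//.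
have : 4 <= m%:R :> R by rewrite ler_nat.
by lra.
Qed.

(** With l = k + p, the product of sqrt l and the bracket of [C_delta] is at least l + 1: the
    summand sqrt l yields l, and the logarithmic one at least 1, because 2 ln (2 / delta) >= 2 ln 2
    >= 1. The same l + 1 is the number of columns in [kap]. *)
Lemma C_delta_sqr_ge (n k p : nat) (delta : R) :
  (1 <= k)%N -> (2 <= p)%N -> 0 < delta < 1 ->
  expR 1 ^+ 2 * (k + p + 1)%:R ^+ 2 / p.+1%:R ^+ 2 * ((2 / delta) `^ p.+1%:R^-1) ^+ 2
  <= C_delta n k p delta ^+ 2.
Proof.
move=> k1 p2 /andP[d0 d1].
rewrite /C_delta; set D := _ `^ _; set L := _ + _ + _.
have l3 : 3 <= (k + p)%:R :> R by rewrite ler_nat (leq_add k1 p2).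
set l : R := (k + p)%:R in l3 *.
have D0 : 0 <= D by exact: powR_ge0.
have e0 := expR_ge0 (1 : R).
have m0 : 0 < p.+1%:R :> R by rewrite ltr0n.
have ln_ge : 2^-1 <= ln (2 / delta) :> R.
  apply: le_trans ln2_ge _; rewrite ler_ln ?posrE ?divr_gt0//.
  by rewrite ler_pdivlMr// ger_pMr// ltW.
have sl0 : 0 <= Num.sqrt l by exact: sqrtr_ge0.
have slL : l + 1 <= Num.sqrt l * L.
  rewrite /L !mulrDr -/l -expr2 sqr_sqrtr; last by apply: le_trans l3.
  apply: lerD; first by rewrite lerDr mulr_ge0// sqrtr_ge0.
  rewrite -sqrtrM; last by apply: le_trans l3.
  rewrite -[leLHS]sqrtr1; apply: ler_wsqrtr.
  apply: le_trans (_ : l * (2 * 2^-1) <= _); first by move: l3; lra.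
  by rewrite ler_pM2l ?(lt_le_trans _ l3)// ler_pM2l.
have -> : expR 1 ^+ 2 * (k + p + 1)%:R ^+ 2 / p.+1%:R ^+ 2 * D ^+ 2 =
    (expR 1 / p.+1%:R * D * (l + 1)) ^+ 2.
  by rewrite natrD -/l; field; rewrite gt_eqF.
have -> : expR 1 * Num.sqrt l / p.+1%:R * D * L =
    expR 1 / p.+1%:R * D * (Num.sqrt l * L) by ring.
have c0 : 0 <= expR 1 / p.+1%:R * D.
  by rewrite mulr_ge0// divr_ge0.
have l10 : 0 <= l + 1 by rewrite addr_ge0// (le_trans _ l3).
apply: lerXn2r.
- by rewrite nnegrE; exact: mulr_ge0.
- by rewrite nnegrE; apply: mulr_ge0 => //; exact: le_trans slL.
- exact: ler_wpM2l.
Qed.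

(** Inserting [Bt] leaves 2 e^-2 (e^2 K / q)^(m / 2) with q = m c x0 / 2. The lower bound of x0
    makes the base at most m / (m - 2) / D^2, which is where 8/3 <= e enters. Finally D^m = 2 /
    delta, and [sqrtX_ratio_le] compensates e^-2. *)
Lemma bad_prob_bound (n k p : nat) (delta x0 : R) :
  (1 <= k)%N -> (2 <= p)%N -> 0 < delta < 1 -> x0 = C_delta n k p delta ^+ 2 ->
  0 < x0 /\
  expR (p.+1%:R / 2 - 1) * @Bt R (k + p) p.+1 ((p.+1%:R / 2 - 1) * x0) / x0 <= delta.
Proof.
move=> k1 p2 d01 x0E; have /andP[d0 d1] := d01.
have := C_delta_sqr_ge n k1 p2 d01; rewrite -x0E.
set D := _ `^ _; set d : R := (k + p + 1)%:R; set m := p.+1.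
move=> x0_ge.
have D0 : 0 < D by rewrite powR_gt0// divr_gt0.
have d0' : 0 < d by rewrite ltr0n addn1.
have e0 := expR_gt0 (1 : R).
have m2 : (2 < m)%N by [].
have m0 : 0 < m%:R :> R by rewrite ltr0n.
have m20 : 0 < m%:R - 2 :> R by rewrite subr_gt0 ltr_nat.
have low0 : 0 < expR 1 ^+ 2 * d ^+ 2 / m%:R ^+ 2 * D ^+ 2.
  by rewrite !mulr_gt0 ?invr_gt0 ?exprn_gt0.
have x00 : 0 < x0 by exact: lt_le_trans x0_ge.
split=> //.
pose c : R := m%:R / 2 - 1.
have cE : c = (m%:R - 2) / 2 by rewrite /c; field.
have c0 : 0 < c by rewrite cE divr_gt0.
pose K := @kap R (k + p).
have K0 : 0 < K by rewrite /K /kap divr_gt0 ?mulr_gt0 ?exprn_gt0// ltr0n addn1.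
pose q := m%:R / 2 * (c * x0).
have q0 : 0 < q by rewrite !mulr_gt0 ?invr_gt0.
have -> : expR (m%:R / 2 - 1) * @Bt R (k + p) m ((m%:R / 2 - 1) * x0) / x0 =
    2 * (expR (- 2) * Num.sqrt ((expR 2 * (K / q)) ^+ m)).
  rewrite [X in expR (- 2) * X](_ : _ = expR (m%:R) * Num.sqrt ((K / q) ^+ m)); last first.
    rewrite exprMn sqrtrM ?exprn_ge0 ?expR_ge0//; congr (_ * _).
    by rewrite -expRM_natl mulr_natr mulr2n expRD -expr2 sqrtr_sqr ger0_norm//.
  rewrite [expR (- 2) * _]mulrA -expRD.
  have -> : - 2 + m%:R = c + c :> R by rewrite /c; field.
  rewrite expRD /Bt -/c -/q -/K.
  move: (Num.sqrt _) (expR c) => S E; rewrite /q.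
  by rewrite cE; field; rewrite !gt_eqF.
have D2 : D ^+ m = 2 / delta.
  by rewrite /D -powR_mulrn ?powR_ge0// -powRrM mulVf ?gt_eqF// powRr1// divr_ge0// ltW.
have le1 : expR 2 * (K / q) <= m%:R / (m%:R - 2) / D ^+ 2.
  rewrite ler_pdivlMr ?exprn_gt0//.
  have -> : expR 2 * (K / q) * D ^+ 2 = expR 2 * K * D ^+ 2 / (m%:R / 2 * c) / x0.
    by rewrite /q; field; rewrite !gt_eqF.
  rewrite ler_pdivrMr//.
  have -> : expR 2 = expR 1 ^+ 2 :> R by rewrite -expRM_natl mulr1.
  apply: le_trans (ler_wpM2l _ x0_ge); last by rewrite divr_ge0 ?ltW.
  rewrite /K /kap -/d cE.
  have -> : expR 1 ^+ 2 * (2 * d ^+ 2 / (3 * expR 1)) * D ^+ 2 /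
      (m%:R / 2 * ((m%:R - 2) / 2)) =
      8 / 3 * (expR 1 * d ^+ 2 * D ^+ 2 / (m%:R * (m%:R - 2))).
    by field; rewrite !gt_eqF.
  have -> : m%:R / (m%:R - 2) * (expR 1 ^+ 2 * d ^+ 2 / m%:R ^+ 2 * D ^+ 2) =
      expR 1 * (expR 1 * d ^+ 2 * D ^+ 2 / (m%:R * (m%:R - 2))).
    by field; rewrite !gt_eqF.
  rewrite ler_pM2r; first exact: expR1_ge.
  by rewrite !mulr_gt0 ?invr_gt0 ?mulr_gt0 ?exprn_gt0.
have le2 : Num.sqrt ((expR 2 * (K / q)) ^+ m) <= expR 2 * (delta / 2).
  apply: le_trans (_ : Num.sqrt ((m%:R / (m%:R - 2) / D ^+ 2) ^+ m) <= _).
    apply: ler_wsqrtr; apply: lerXn2r => //.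
      by rewrite nnegrE mulr_ge0 ?expR_ge0// divr_ge0 ?ltW.
    by rewrite nnegrE !mulr_ge0 ?invr_ge0 ?exprn_ge0 ?ltW.
  rewrite exprMn sqrtrM; last by rewrite exprn_ge0 ?divr_ge0 ?ltW.
  have -> : Num.sqrt ((D ^+ 2)^-1 ^+ m) = delta / 2.
    rewrite -exprVn exprAC sqrtr_sqr ger0_norm ?exprn_ge0 ?invr_ge0 ?ltW//.
    by rewrite exprVn D2 invf_div.
  by rewrite ler_pM2r ?divr_gt0//; exact: sqrtX_ratio_le.
apply: le_trans (_ : 2 * (expR (- 2) * (expR 2 * (delta / 2))) <= _).
  by rewrite ler_pM2l// ler_pM2l ?expR_gt0.
rewrite [expR (- 2) * _]mulrA -expRD addNr expR0 mul1r.
by rewrite le_eqVlt; apply/orP; left; apply/eqP; field.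
Qed.

End constants.

(** * Almost sure regularity *)

Section multiaffine.
Context {R : realType}.
Local Notation C := R[i].
Local Notation vect I := (vect R I).

Definition upd (I : finType) (w : I -> R) (i : I) (x : R) : I -> R :=
  fun j => if j == i then x else w j.

(** Determinants are of this kind in the entries of a matrix, and the property passes to the
    coefficients when one variable is split off. *)
Definition multiaffine (I : finType) (p : (I -> R) -> C) :=
  forall w i x, p (upd w i x) =
    p (upd w i 0) + x%:C * (p (upd w i 1) - p (upd w i 0)).

Lemma gam_set1 (x : R) : gam R [set x] = 0.
Proof.
have := normal_prob_dominates (0 : R) 1.
move=> /null_content_dominatesP; apply => //.
exact: lebesgue_measure_set1.
Qed.

(** For fixed other coordinates, p is A + x B in the first one, with at most one zero unless A = B =
    0, and points are null. One of A and B is not identically zero and is multiaffine in one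
    variable less, so by induction the exceptional values are null too. *)
Lemma multiaffine_null_ord n (p : ('I_n -> R) -> C) d (T : measurableType d)
    (P : probability T R) (F : T -> vect 'I_n) :
  gauss_map P F -> multiaffine p -> cmeas (p : vect 'I_n -> C) ->
  (exists w, p w != 0) ->
  (\int[P]_x ((p (F x) == 0)%:R : R)%:E = 0)%E.
Proof.
elim: n p d T P F => [|n IHn] p d T P F gF pA mp [w pw].
  rewrite integral0_eq// => x _.
  by rewrite (_ : F x = w) ?(negbTE pw)//; apply/funext => -[].
have [d1 [T1 [P1 [F1 gF1]]]] := @gauss_exists R 'I_n.
pose ind m (q : ('I_m -> R) -> C) (w : vect 'I_m) : \bar R := ((q w == 0)%:R : R)%:E.
have mind m (q : ('I_m -> R) -> C) : cmeas (q : vect 'I_m -> C) ->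
    measurable_fun setT (ind m q).
  move=> [q1 q2]; apply/measurable_EFinP.
  rewrite (_ : (fun x => _) = (fun x : vect 'I_m =>
      if (complex.Re (q x) == 0) && (complex.Im (q x) == 0) then 1 else 0)).
    apply: measurable_fun_ifT => //.
    by apply: measurable_and; exact: measurable_fun_eqr.
  by apply/funext => x; case: (q x) => a b; rewrite eq_complex/=; case: (_ && _).
have ind0 m q (w' : vect 'I_m) : (0 <= ind m q w')%E by rewrite lee_fin ler0n.
rewrite (gauss_consE gF gF1 (mind _ _ mp) (ind0 _ p)).
have consE x y : vcons x y = upd (vcons 0 y) ord0 x :> ('I_n.+1 -> R).
  apply/funext => i; rewrite /upd /vcons; case: unliftP => [j ->|->].
    by rewrite eq_sym (negbTE (neq_lift _ _)).
  by rewrite eqxx.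
pose A (y : 'I_n -> R) := p (vcons 0 y).
pose B (y : 'I_n -> R) := p (vcons 1 y) - p (vcons 0 y).
have pE x y : p (vcons x y) = A y + x%:C * B y.
  by rewrite consE pA -!consE.
have updE x y i z : vcons x (upd y i z) = upd (vcons x y) (lift ord0 i) z :> ('I_n.+1 -> R).
  apply/funext => j; rewrite /upd /vcons; case: unliftP => [k ->|->].
    by rewrite (inj_eq lift_inj).
  by rewrite (negbTE (neq_lift _ _)).
have aA x : multiaffine (fun y => p (vcons x y)).
  by move=> y i z; rewrite !updE; exact: pA.
have aB : multiaffine B.
  by move=> y i z; rewrite /B (aA 1 y i z) (aA 0 y i z); ring.
have mcons x : measurable_fun setT ((fun y => vcons x y) : vect 'I_n -> vect 'I_n.+1).
  apply: measurable_vect => i; rewrite /vcons; case: (unlift ord0 i) => [j|].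
    exact: measurable_coord.
  exact: measurable_cst.
have mA x : cmeas ((fun y => p (vcons x y)) : vect 'I_n -> C).
  by case: mp => p1 p2; split; [exact: (measurableT_comp p1 (mcons x))|
    exact: (measurableT_comp p2 (mcons x))].
have mB : cmeas (B : vect 'I_n -> C).
  rewrite (_ : B = fun y => p (vcons 1 y) + (-1) * p (vcons 0 y)).
    by apply: cmeasD => //; apply: cmeasM => //; exact: cmeas_cst.
  by apply/funext => y; rewrite /B mulN1r.
have inner y : A y != 0 \/ B y != 0 ->
    (\int[gam R]_x ind n.+1 p (vcons x y) = 0)%E.
  move=> AB; have [B0|B0] := eqVneq (B y) 0.
    rewrite integral0_eq// => x _; rewrite /ind pE B0 mulr0 addr0.
    by case: AB => [/negbTE->//|]; rewrite B0 eqxx.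
  (* The only candidate for a real zero; there is none if -A / B is not real. *)
  pose x0 := complex.Re (- A y / B y).
  have le1 x : (ind n.+1 p (vcons x y) <= (\1_[set x0] x)%:E)%E.
    rewrite /ind pE lee_fin; case: eqP => [/eqP E|_]; last by rewrite indicE ler0n.
    rewrite indicE mem_set//= /x0; move: E; rewrite addr_eq0 => /eqP->.
    by rewrite opprK mulfK.
  apply/eqP; rewrite eq_le; apply/andP; split; last first.
    by apply: integral_ge0 => x _; exact: ind0.
  rewrite -(gam_set1 x0) (measure_int_indic (gam R) (measurable_set1 x0)).
  apply: ge0_le_integral.
  - exact: measurableT.
  - by move=> x _; exact: ind0.
  - have mv : measurable_fun setT ((fun x => vcons x y) : R -> vect 'I_n.+1).
      apply: measurable_vect => i; rewrite /vcons; case: (unlift ord0 i) => [j|].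
        exact: measurable_cst.
      exact: measurable_id.
    exact: (measurableT_comp (mind _ _ mp) mv).
  - exact: (measurable_EFin_indic (measurable_set1 x0)).
  - by move=> x _; exact: le1.
have [q [qA mq [w' qw'] qAB]] : exists q : ('I_n -> R) -> C,
    [/\ multiaffine q, cmeas (q : vect 'I_n -> C), exists w', q w' != 0 &
      forall y, q y != 0 -> A y != 0 \/ B y != 0].
  have wE : w = vcons (w ord0) (fun i => w (lift ord0 i)).
    by apply/funext => i; rewrite /vcons; case: unliftP => [j ->|->].
  rewrite wE pE in pw.
  have [A0|A0] := eqVneq (A (fun i => w (lift ord0 i))) 0.
    exists B; split=> //; last by move=> y; right.
    exists (fun i => w (lift ord0 i)); move: pw; rewrite A0 add0r.
    by apply: contraNneq => ->; rewrite mulr0.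
  exists A; split=> //; [exact: aA|exact: mA|by exists (fun i => w (lift ord0 i))|].
  by move=> y; left.
have q0 := IHn q _ _ _ _ gF1 qA mq (ex_intro _ w' qw').
apply/eqP; rewrite eq_le; apply/andP; split; last first.
  apply: integral_ge0 => y _; apply: integral_ge0 => x _; exact: ind0.
rewrite -[leRHS]q0; apply: ge0_le_integral.
- exact: measurableT.
- by move=> y _; apply: integral_ge0 => x _; exact: ind0.
- have mv : measurable_fun setT (fun z : T1 * R => vcons z.2 (F1 z.1) : vect 'I_n.+1).
    apply: measurable_vect => i; rewrite /vcons; case: (unlift ord0 i) => [j|].
      exact: (measurableT_comp (gauss_measurable j gF1) measurable_fst).
    exact: measurable_snd.
  exact: (@measurable_fun_fubini_tonelli_F _ _ _ _ R (gam R) _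
    (measurableT_comp (mind _ _ mp) mv) (fun z => ind0 _ p _)).
- by apply: (measurableT_comp (mind _ _ mq)); case: gF1.
move=> y _; have [qy|qy] := eqVneq (q (F1 y)) 0; last first.
  by rewrite inner//; exact: qAB.
apply: (@le_trans _ _ (\int[gam R]_x cst 1 x)%E).
  apply: ge0_le_integral.
  - exact: measurableT.
  - by move=> x _; exact: ind0.
  - have mv : measurable_fun setT ((fun x => vcons x (F1 y)) : R -> vect 'I_n.+1).
      apply: measurable_vect => i; rewrite /vcons; case: (unlift ord0 i) => [j|].
        exact: measurable_cst.
      exact: measurable_id.
    exact: (measurableT_comp (mind _ _ mp) mv).
  - exact: measurable_cst.
  - by move=> x _; rewrite lee_fin; case: (_ == _).
by rewrite integral_cst// mul1e; apply: probability_le1.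
Qed.

Lemma multiaffine_null (I : finType) (p : (I -> R) -> C) d (T : measurableType d)
    (P : probability T R) (F : T -> vect I) :
  gauss_map P F -> multiaffine p -> cmeas (p : vect I -> C) ->
  (exists w, p w != 0) ->
  (\int[P]_x ((p (F x) == 0)%:R : R)%:E = 0)%E.
Proof.
move=> gF pA mp [w pw].
pose e (y : 'I_#|I| -> R) : I -> R := fun i => y (enum_rank i).
pose e' (w : I -> R) : 'I_#|I| -> R := fun j => w (enum_val j).
have ee' w' : e (e' w') = w' by apply/funext => i; rewrite /e /e' enum_rankK.
have gF' : gauss_map P (fun x => e' (F x) : vect 'I_#|I|).
  exact: (gauss_sub (e := enum_val) enum_val_inj _ gF).
have me : measurable_fun setT (e : vect 'I_#|I| -> vect I).
  by apply: measurable_vect => i; exact: measurable_coord.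
have eupd y j z : e (upd y j z) = upd (e y) (enum_val j) z.
  apply/funext => i; rewrite /e /upd; congr (if _ then _ else _).
  by rewrite -(inj_eq enum_val_inj) enum_rankK.
have pA' : multiaffine (fun y => p (e y)).
  by move=> y j z; rewrite !eupd; exact: pA.
have mp' : cmeas ((fun y => p (e y)) : vect 'I_#|I| -> C).
  by case: mp => p1 p2; split; [exact: (measurableT_comp p1 me)|
    exact: (measurableT_comp p2 me)].
have ex : exists y, p (e y) != 0 by exists (e' w); rewrite ee'.
rewrite -[RHS](multiaffine_null_ord gF' pA' mp' ex).
by apply: eq_integral => x _; rewrite ee'.
Qed.

End multiaffine.

(** * Regularity of the Gram matrix *)

Section regular.
Context {R : realType}.
Local Notation C := R[i].
Local Notation vect I := (vect R I).
Variables (n k l : nat) (V : 'M[C]_(n, k)).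
Hypotheses (VV : V ^t* *m V = 1%:M) (kl : (k <= l)%N).

Definition Wk (f : 'I_n * 'I_l -> R) : 'M[C]_(n, k) :=
  \matrix_(i, j) (f (i, widen_ord kl j))%:C.

Definition minor (f : 'I_n * 'I_l -> R) : C := \det (V ^t* *m Wk f).

(** A null vector z of the Gram matrix satisfies |z O|^2 = 0, so it annihilates V^H W and in
    particular its first k columns. It therefore suffices to treat the minor of these columns. *)
Lemma gramm_minor f : \det (gramm (Ov V f)) = 0 -> minor f = 0.
Proof.
move=> /eqP/det0P[z z0 zO].
have zO0 : z *m Ov V f = 0.
  move: (Ov V f) zO => O zO; apply/eqP.
  rewrite -nrm2_eq0 /nrm2 trmxC_mul mulmxA -(mulmxA z).
  by rewrite -/(gramm O) zO mul0mx mxE.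
apply/eqP/det0P; exists z; first exact: z0.
have : z *m V ^t* *m Wm f = 0 by rewrite -mulmxA; exact: zO0.
rewrite mulmxA; move: (z *m V ^t*) => y yW; apply/rowP => j.
have := congr1 (fun M : 'rV[C]_l => M 0 (widen_ord kl j)) yW.
by rewrite !mxE => E; apply: etrans E; apply: eq_bigr => i _; rewrite !mxE.
Qed.

(** An entry outside the first k columns does not occur; any other one affects a single column of
    the product, and the determinant is linear in that column. *)
Lemma minor_multiaffine : multiaffine minor.
Proof.
move=> w [a b] x; have [kb|bk] := leqP k b.
  have E y : Wk (upd w (a, b) y) = Wk w.
    apply/matrixP => i j; rewrite !mxE /upd xpair_eqE.
    rewrite (_ : (widen_ord kl j == b) = false) ?andbF//.
    by apply/negbTE/eqP => jb; move: kb; rewrite -jb /= leqNgt ltn_ord.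
  by rewrite /minor !E subrr mulr0 addr0.
pose j0 := Ordinal bk.
pose M y := (V ^t* *m Wk (upd w (a, b) y))^T.
have detM y : minor (upd w (a, b) y) = \det (M y) by rewrite /minor det_tr.
rewrite !detM.
have rowM y : row' j0 (M y) = row' j0 (M x).
  apply/matrixP => i j; rewrite !mxE; apply: eq_bigr => e _; rewrite !mxE /upd.
  rewrite xpair_eqE (_ : (widen_ord kl (lift j0 i) == b) = false) ?andbF//.
  apply/negbTE/eqP => ib; have := neq_lift j0 i; rewrite eq_sym => /eqP; apply.
  by apply/val_inj; exact: (congr1 val ib).
have ringE (u y z : C) : y + u * (z - y) = (1 - u) * y + u * z by ring.
have entryE y j : M y j0 j =
    \sum_e (V ^t*) j e * (if e == a then y%:C else (w (e, b))%:C).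
  rewrite mxE mxE; apply: eq_bigr => e _; congr (_ * _).
  rewrite mxE /upd xpair_eqE (_ : widen_ord kl j0 = b); last exact/val_inj.
  by rewrite eqxx andbT; case: (e == a).
rewrite ringE; apply: (determinant_multilinear _ (rowM 0) (rowM 1)).
apply/rowP => j; rewrite mxE [RHS]mxE [X in _ = X + _]mxE [X in _ = _ + X]mxE.
rewrite [X in _ = _ * X + _]mxE [X in _ = _ + _ * X]mxE !entryE.
rewrite !mulr_sumr -big_split; apply: eq_bigr => e _ /=.
case: (e == a); last by rewrite -mulrDl subrK mul1r.
by rewrite rmorph0 rmorph1 !mulr0 add0r mulr1 mulrC.
Qed.

(** A 0-1 matrix can select k linearly independent columns of V^H. *)
Lemma minor_neq0 : exists w, minor w != 0.
Proof.
have fullV : row_full (V ^t*)^T.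
  rewrite /row_full mxrank_tr eqn_leq; apply/andP; split.
    exact: rank_leq_row.
  by apply: (@mulmx1_min_rank _ _ _ _ _ 1%:M V); rewrite mul1mx.
pose f := fullrankfun fullV.
exists (fun ij => if [exists j : 'I_k, (widen_ord kl j == ij.2) && (f j == ij.1)]
  then 1 else 0).
have := fullrowsub_unit fullV; rewrite -/f unitmxE unitfE.
rewrite /minor -[\det (V ^t* *m _)]det_tr; congr (\det _ != 0).
apply/matrixP => i j; rewrite !mxE (bigD1 (f i))//= big1 ?addr0.
  rewrite !mxE ifT ?rmorph1 ?mulr1//=.
  by apply/fintype.existsP; exists i; rewrite !eqxx.
move=> e ef; rewrite !mxE ifF ?rmorph0 ?mulr0//=.
apply/negbTE/negP => /fintype.existsP[i' /andP[/eqP/(congr1 val)/= ii' /eqP fe]].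
move: ef; rewrite -fe (_ : i' = i) ?eqxx//; exact/val_inj.
Qed.

Lemma cmeas_minor : cmeas (minor : vect ('I_n * 'I_l)%type -> C).
Proof.
apply: cmeas_det; apply: mmeasM; first exact: mmeas_cst.
move=> i j; rewrite (_ : (fun x => _) =
  (fun x : vect ('I_n * 'I_l)%type => (x (i, widen_ord kl j))%:C)).
  by apply: cmeas_real; exact: measurable_coord.
by apply/funext => x; rewrite mxE.
Qed.

Lemma gramm_singular_null d0 (T : measurableType d0) (P : probability T R)
    (F : T -> vect ('I_n * 'I_l)%type) : gauss_map P F ->
  P [set x | \det (gramm (Ov V (F x))) == 0] = 0%E.
Proof.
move=> gF; have mF : measurable_fun setT F by case: gF.
have mb := measurable_det0 V mF.
have mS : measurable [set x | \det (gramm (Ov V (F x))) == 0].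
  rewrite (_ : [set x | _] = [set: T] `&`
      (fun x => \det (gramm (Ov V (F x))) == 0) @^-1` [set true]).
    exact: mb.
  by rewrite setTI; apply/seteqP; split=> x /=; case: (_ == _).
apply/eqP; rewrite eq_le measure_ge0 andbT.
rewrite -(multiaffine_null gF minor_multiaffine cmeas_minor minor_neq0).
rewrite (measure_int_indic P mS).
have m0 : measurable_fun setT (fun x => minor (F x) == 0).
  rewrite (_ : (fun x => _) = (fun x => (complex.Re (minor (F x)) == 0) &&
      (complex.Im (minor (F x)) == 0))).
    have [p1 p2] := cmeas_minor.
    apply: measurable_and; apply: measurable_fun_eqr => //.
      exact: (measurableT_comp p1 mF).
    exact: (measurableT_comp p2 mF).
  by apply/funext => x; case: (minor _) => a b; rewrite eq_complex.
apply: ge0_le_integral.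
- exact: measurableT.
- by move=> x _; exact: indic_ge0.
- exact: measurable_EFin_indic.
- apply/measurable_EFinP.
  rewrite (_ : (fun x => _) = (fun x => if minor (F x) == 0 then 1 else 0)).
    exact: measurable_fun_ifT.
  by apply/funext => x; case: (_ == _).
move=> x _; rewrite lee_fin indicE; case: (boolP (_ \in _)) => [|_]; last exact: ler0n.
by rewrite inE/= => /eqP/gramm_minor ->; rewrite eqxx.
Qed.

End regular.

(** * The error of a slice *)

Section frobenius.
Context {R : rcfType}.
Local Notation C := R[i].

Definition fro2 m n (A : 'M[C]_(m, n)) : C := \tr (A *m A ^t*).

Lemma fro2E m n (A : 'M[C]_(m, n)) : fro2 A = \sum_a \sum_b `|A a b| ^+ 2.
Proof.
apply: eq_bigr => a _; rewrite mxE; apply: eq_bigr => b _.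
by rewrite trmxCE normCK.
Qed.

Lemma fro2_ge0 m n (A : 'M[C]_(m, n)) : 0 <= fro2 A.
Proof. by rewrite fro2E !sumr_ge0// => a _; rewrite sumr_ge0// => b _; rewrite exprn_ge0. Qed.

Lemma unitary_mulC n (U : 'M[C]_n) : U \is unitarymx -> U ^t* *m U = 1%:M.
Proof. by move=> /unitarymxP/mulmx1C. Qed.

Lemma fro2_unitary m n (U : 'M[C]_m) (V : 'M[C]_n) (A : 'M[C]_(m, n)) :
  U \is unitarymx -> V \is unitarymx -> fro2 (U *m A *m V ^t*) = fro2 A.
Proof.
move=> UU VV; rewrite /fro2 !trmxC_mul trmxCK !mulmxA.
rewrite -[_ *m V ^t* *m V]mulmxA (unitary_mulC VV) mulmx1.
by rewrite mxtrace_mulC !mulmxA (unitary_mulC UU) mul1mx.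
Qed.

Lemma fro2D m n (A B : 'M[C]_(m, n)) :
  \tr (A *m B ^t*) = 0 -> \tr (B *m A ^t*) = 0 -> fro2 (A + B) = fro2 A + fro2 B.
Proof.
move=> AB BA; rewrite /fro2 trmxCD mulmxDl !mulmxDr !mxtraceD AB BA.
by rewrite addr0 add0r.
Qed.

(* Q Q^H is the orthogonal projector onto the range of Q. *)
Lemma fro2_best m n c (Q : 'M[C]_(m, c)) (A : 'M[C]_(m, n)) (Z : 'M[C]_(c, n)) :
  Q ^t* *m Q = 1%:M -> fro2 (A - Q *m Q ^t* *m A) <= fro2 (A - Q *m Z).
Proof.
move=> QQ; set E := A - _; pose D := Q ^t* *m A - Z.
have QE : Q ^t* *m E = 0.
  by rewrite /E mulmxBr !mulmxA QQ mul1mx subrr.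
have -> : A - Q *m Z = E + Q *m D.
  by rewrite /E /D mulmxBr mulmxA addrA subrK.
have EQ : E ^t* *m Q = 0.
  by rewrite -[LHS]trmxCK trmxC_mul trmxCK QE linear0 map_mx0.
rewrite fro2D ?lerDl ?fro2_ge0//.
- by rewrite trmxC_mul mulmxA mxtrace_mulC mulmxA QE mul0mx mxtrace0.
- by rewrite mxtrace_mulC mulmxA EQ mul0mx mxtrace0.
Qed.

Definition power_iter m n l (X : 'M[C]_(m, n)) (W : 'M[C]_(n, l)) j : 'M[C]_(m, l) :=
  iter j (fun M => X *m (X ^t* *m M)) (X *m W).

(** The triangular factors are absorbed into N, so the plain power iterate lies in the range of Q
    whichever QR factorizations are chosen, deficient rank included. *)
Lemma subspace_iter_range m n l (X : 'M[C]_(m, n)) (W : 'M[C]_(n, l)) j c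
    (Q : 'M[C]_(m, c)) : subspace_iter X W j Q ->
  [/\ Q ^t* *m Q = 1%:M, (c <= l)%N & exists N, power_iter X W j = Q *m N].
Proof.
elim=> [{}Q [QQ [N [_ XW]]]|{}j {}c {}Q G Q' _ [_ cl [N IH]] [GG [N1 [_ E1]]] [QQ [N2 [_ E2]]]].
  by split=> //; [rewrite geq_minr|exists N].
split=> //; first by rewrite geq_min geq_min cl !orbT.
exists (N2 *m N1 *m N); rewrite /power_iter iterS -/(power_iter X W j) IH.
by rewrite !mulmxA -E2 -[X *m X ^t* *m Q]mulmxA E1 !mulmxA.
Qed.

Definition dgm m n (f : nat -> C) : 'M[C]_(m, n) :=
  \matrix_(a, b) (if a == b :> nat then f a else 0).

Lemma dgm_mulE m n p f (M : 'M[C]_(n, p)) (a : 'I_m) b (an : (a < n)%N) :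
  (dgm m n f *m M) a b = f a * M (Ordinal an) b.
Proof.
rewrite mxE (bigD1 (Ordinal an))//= big1 ?addr0; first by rewrite mxE eqxx.
move=> c ca; rewrite mxE ifN ?mul0r//; apply: contra ca => /eqP ac.
by apply/eqP/val_inj.
Qed.

Lemma dgm_mul0 m n p f (M : 'M[C]_(n, p)) (a : 'I_m) b :
  (n <= a)%N -> (dgm m n f *m M) a b = 0.
Proof.
move=> na; rewrite mxE big1// => c _; rewrite mxE ifN ?mul0r//.
by rewrite neq_ltn (leq_trans (ltn_ord c) na) orbT.
Qed.

Lemma dgm_mul m n p f g : (forall a, (n <= a)%N -> f a * g a = 0) ->
  dgm m n f *m dgm n p g = dgm m p (fun a => f a * g a).
Proof.
move=> fg0; apply/matrixP => a b; have [na|an] := leqP n a.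
  by rewrite dgm_mul0// mxE fg0// if_same.
by rewrite (dgm_mulE _ _ _ an) !mxE/=; case: ifP; rewrite ?mulr0.
Qed.

Lemma dgm_trmxC m n f : (forall a, (f a)^* = f a) -> (dgm m n f) ^t* = dgm n m f.
Proof.
move=> fC; apply/matrixP => a b; rewrite trmxCE !mxE eq_sym.
by case: eqP => [->|_]; [exact: fC|rewrite rmorph0].
Qed.

Lemma mul_dgmE m k n (M : 'M[C]_(m, k)) g (a : 'I_m) (b : 'I_n) :
  (M *m dgm k n g) a b =
  if insub (val b) is Some b' then M a b' * g b else 0.
Proof.
rewrite mxE; case: insubP => [b' _ bb'|]; last first.
  rewrite -leqNgt => kb; rewrite big1// => c _; rewrite mxE ifN ?mulr0//.
  by rewrite neq_ltn (leq_trans (ltn_ord c) kb).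
rewrite (bigD1 b')//= big1 ?addr0; first by rewrite mxE bb' eqxx.
move=> c cb; rewrite mxE ifN ?mulr0//; apply: contra cb => /eqP cb.
by apply/eqP/val_inj; rewrite /= cb bb'.
Qed.

(** Each round raises the exponent by 2, starting from 1. The rectangular diagonal matrices multiply
    entrywise because the singular values vanish beyond min (m, n). *)
Lemma power_iter_svd m n l (s : nat -> R) (U : 'M[C]_m) (V : 'M[C]_n)
    (W : 'M[C]_(n, l)) j :
  U \is unitarymx -> V \is unitarymx ->
  (forall a, (minn m n <= a)%N -> s a.+1 = 0) ->
  power_iter (U *m dgm m n (fun a => (s a.+1)%:C) *m V ^t*) W j =
  U *m (dgm m n (fun a => (s a.+1 ^+ (2 * j).+1)%:C) *m (V ^t* *m W)).
Proof.
move=> UU VV s0; set f := fun a => (s a.+1)%:C.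
have fC a : (f a)^* = f a by apply/eqP; rewrite eq_complex/= oppr0 !eqxx.
elim: j => [|j IH].
  by rewrite /power_iter /= !mulmxA; congr (_ *m _ *m _ *m _).
rewrite /power_iter iterS -/(power_iter _ W j) IH.
have f0 a : (minn m n <= a)%N -> f a = 0 by move=> /s0; rewrite /f => ->; rewrite rmorph0.
rewrite !trmxC_mul trmxCK dgm_trmxC//.
rewrite !mulmxA -[_ *m U ^t* *m U]mulmxA (unitary_mulC UU) mulmx1.
rewrite -[_ *m V ^t* *m V]mulmxA (unitary_mulC VV) mulmx1.
rewrite -[_ *m dgm m n _ *m dgm n m _]mulmxA dgm_mul; last first.
  by move=> a na; rewrite f0 ?mulr0// geq_min na orbT.
rewrite -[_ *m dgm m m _ *m dgm m n _]mulmxA dgm_mul; last first.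
  by move=> a na; rewrite f0 ?mulr0 ?mul0r// geq_min na.
apply: (f_equal (fun D => U *m D *m V ^t* *m W)); apply/matrixP => a b.
rewrite !mxE; case: ifP => // _.
by rewrite mulnS add2n !exprS !rmorphM mulrA.
Qed.

Lemma sum_ord_cut (Z : nmodType) (F : nat -> Z) m n :
  (forall a, (minn m n <= a)%N -> F a = 0) -> \sum_(a < m) F a = \sum_(a < n) F a.
Proof.
have cut p q : (forall a, (minn p q <= a)%N -> F a = 0) ->
    \sum_(a < p) F a = \sum_(a < minn p q) F a.
  move=> F0; rewrite -!(big_mkord xpredT F).
  rewrite (big_cat_nat (n := minn p q)) ?geq_minl//= [X in _ + X]big1_seq ?addr0//.
  by move=> a; rewrite mem_index_iota /= => /andP[h _]; exact: F0.
move=> F0; rewrite (cut m n F0) (cut n m) minnC//.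
Qed.

(** * Comparison with an explicit matrix in the range *)

Section slice.
Variables (m n l k q c : nat) (s : nat -> R) (U : 'M[C]_m) (V : 'M[C]_n).
Variables (W : 'M[C]_(n, l)) (Q : 'M[C]_(m, c)).
Hypotheses (UU : U \is unitarymx) (VV : V \is unitarymx).
Hypothesis s_mono : forall j, (0 < j)%N -> 0 <= s j.+1 <= s j.
Hypothesis s0 : forall j, (minn m n < j)%N -> s j = 0.
Hypotheses (k0 : (0 < k)%N) (sk : 0 < s k) (kn : (k <= n)%N).
Let X := U *m dgm m n (fun a => (s a.+1)%:C) *m V ^t*.
Hypothesis XQ : subspace_iter X W q Q.

Let Vk : 'M[C]_(n, k) := \matrix_(i, j) V i (widen_ord kn j).
Let O := Vk ^t* *m W.
Let T := V ^t* *m W *m (O ^t* *m pinvd (gramm O)).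
Hypothesis O0 : \det (gramm O) != 0.

Lemma s_anti i j : (0 < i)%N -> (i <= j)%N -> s j <= s i.
Proof.
move=> i0; elim: j => [|j IH]; first by rewrite leqn0 => /eqP ji; rewrite ji in i0.
rewrite leq_eqVlt => /predU1P[->//|ij]; apply: le_trans (IH ij).
by have /andP[] := s_mono (leq_trans i0 ij).
Qed.

Lemma s_ge0 j : 0 <= s j.+1.
Proof.
case: j => [|j]; last by have /andP[] := s_mono (ltn0Sn j).
have /andP[h1 h2] := s_mono (ltn0Sn 0); exact: le_trans h2.
Qed.

Lemma T_row (a : 'I_n) b :
  T a b = (((col a V) ^t* *m W) *m O ^t* *m pinvd (gramm O)) 0 b.
Proof.
rewrite /T !mulmxA; move: (pinvd _) (O ^t*) => Y Z.
have rE (M : 'M[C]_(n, k)) : M a b = row a M 0 b by rewrite mxE.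
rewrite rE -!mulmxA row_mul; congr ((_ *m _) 0 b).
by apply/rowP => i; rewrite mxE trmxCE [RHS]trmxCE !mxE.
Qed.

Lemma T_top (j b : 'I_k) : T (widen_ord kn j) b = (j == b)%:R.
Proof.
have : (O *m (O ^t* *m pinvd (gramm O))) j b = (j == b)%:R.
  by rewrite mulmxA -/(gramm O) mulV_pinvd// mxE.
move=> <-; rewrite /T /O; move: (_ *m pinvd _) => Y; rewrite -!mulmxA.
move: (W *m Y) => Z; rewrite !mxE; apply: eq_bigr => e _.
by rewrite !mxE.
Qed.

Let g b : C := (s b.+1 ^- (2 * q))%:C.
Let fq a : C := (s a.+1 ^+ (2 * q).+1)%:C.
(** In singular coordinates, the error of the comparison matrix. The first k rows of [T] form the
    identity, and the factors s_b^(-2 q) in [g] undo the powers of the leading singular values, so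
    that the first k rows of [E] vanish. *)
Let E : 'M[C]_(m, n) := dgm m n (fun a => (s a.+1)%:C) -
  dgm m n fq *m (T *m dgm k n g).

Lemma residual_le : fro2 (X - Q *m Q ^t* *m X) <= fro2 E.
Proof.
have [QQ _ [N XN]] := subspace_iter_range XQ.
(* The power iterate is Q N; multiplying it by the right-hand factors of [Z] gives the comparison
   matrix in the original coordinates. *)
pose Z := N *m (O ^t* *m pinvd (gramm O)) *m (dgm k n g *m V ^t*).
have QZ : Q *m Z = U *m (dgm m n fq *m (T *m dgm k n g)) *m V ^t*.
  have := power_iter_svd W q UU VV (fun a h => s0 (leq_ltn_trans h (ltnSn a))).
  rewrite -/X XN => QN; rewrite /Z !mulmxA QN /T !mulmxA.
  by [].
have := fro2_best X Z QQ; rewrite QZ => /le_trans; apply.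
by rewrite -(fro2_unitary E UU VV) /E mulmxBr mulmxBl.
Qed.

Let tau := s k.+1 / s k.

Lemma E_entry (a : 'I_m) (b : 'I_n) (an : (a < n)%N) :
  E a b = (if a == b :> nat then (s a.+1)%:C else 0) -
    fq a * (if insub (val b) is Some b' then T (Ordinal an) b' * g b else 0).
Proof.
by rewrite /E [LHS]mxE [X in X + _]mxE [X in _ + X]mxE (dgm_mulE _ _ _ an) mul_dgmE.
Qed.

Lemma E_bottom (a : 'I_m) (b : 'I_n) : (n <= a)%N -> E a b = 0.
Proof.
move=> na; rewrite /E [LHS]mxE [X in X + _]mxE [X in _ + X]mxE dgm_mul0// subr0.
by rewrite ifN// neq_ltn (leq_trans (ltn_ord b) na) orbT.
Qed.

Lemma E_top (a : 'I_m) (b : 'I_n) : (a < k)%N -> E a b = 0.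
Proof.
move=> ak; have an : (a < n)%N by exact: leq_trans kn.
rewrite (E_entry _ an); case: insubP => [b' _ bb'|].
  rewrite (_ : Ordinal an = widen_ord kn (Ordinal ak)); last exact/val_inj.
  rewrite T_top -bb' (_ : (Ordinal ak == b') = (a == b' :> nat))//.
  case: eqP => [ab|_]; last by rewrite mul0r mulr0 subr0.
  rewrite mul1r /fq /g -ab -rmorphM -rmorphB/= exprSr.
  have sa : 0 < s a.+1 := lt_le_trans sk (s_anti (ltn0Sn a) ak).
  by rewrite mulrAC mulfV ?mul1r ?subrr// gt_eqF// exprn_gt0.
by rewrite -leqNgt mulr0 subr0 => kb; rewrite ifN// neq_ltn (leq_trans ak kb).
Qed.

(** In a row a >= k the diagonal entry sits in a column b >= k and the entries of [T] in columns b <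
    k, so no cross term arises. For the latter, s_a <= s_(k+1) and s_b >= s_k, counted from 1, bound
    the ratio by tau. *)
Lemma E_low (a : 'I_m) (b : 'I_n) (an : (a < n)%N) : (k <= a)%N ->
  `|E a b| ^+ 2 <= (if a == b :> nat then (s a.+1 ^+ 2)%:C else 0) +
    (s a.+1 ^+ 2 * tau ^+ (4 * q))%:C *
    (if insub (val b) is Some b' then `|T (Ordinal an) b'| ^+ 2 else 0).
Proof.
move=> ka; rewrite (E_entry _ an); case: insubP => [b' b'k bb'|_].
  have bk : (b < k)%N by [].
  have /negbTE-> : (a != b :> nat) by rewrite neq_ltn (leq_trans bk ka) orbT.
  rewrite sub0r normrN add0r mulrCA normrM exprMn mulrC.
  apply: ler_wpM2r; first by rewrite exprn_ge0.
  have sb : s k <= s b.+1 by apply: s_anti.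
  have sb0 : 0 < s b.+1 := lt_le_trans sk sb.
  have sa0 := s_ge0 a.
  have tau0 : 0 <= tau by rewrite /tau divr_ge0 ?(ltW sk)// s_ge0.
  pose y := s a.+1 * (s a.+1 / s b.+1) ^+ (2 * q).
  have -> : fq a * g b = y%:C.
    by rewrite /fq /g -rmorphM/= /y exprS exprMn -exprVn mulrA.
  have r0 : 0 <= s a.+1 / s b.+1 by rewrite divr_ge0// ltW.
  have y0 : 0 <= y by rewrite mulr_ge0// exprn_ge0.
  rewrite ger0_norm ?lecR// -(rmorphXn (real_complex R)) lecR /y exprMn -exprM.
  rewrite (_ : (2 * q * 2 = 4 * q)%N); last by rewrite mulnAC.
  rewrite ler_wpM2l ?exprn_ge0// lerXn2r ?nnegrE//.
  rewrite /tau ler_pM ?invr_ge0 ?(ltW sb0)//; first exact: s_anti.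
  by rewrite lef_pV2 ?posrE.
rewrite !mulr0 subr0 addr0; case: eqP => _; last by rewrite normr0 expr0n.
by rewrite ger0_norm ?lecR ?s_ge0// -(rmorphXn (real_complex R)).
Qed.

Lemma slice_bound : fro2 (X - Q *m Q ^t* *m X) <=
  \sum_(a < n) (if (k <= a)%N then (s a.+1 ^+ 2)%:C +
    (s a.+1 ^+ 2 * tau ^+ (4 * q))%:C *
    nrm2 (((col a V) ^t* *m W) *m O ^t* *m pinvd (gramm O)) else 0).
Proof.
apply: le_trans residual_le _; rewrite fro2E.
pose G (a : 'I_n) := if (k <= a)%N then (s a.+1 ^+ 2)%:C +
    (s a.+1 ^+ 2 * tau ^+ (4 * q))%:C * (\sum_b `|T a b| ^+ 2) else 0.
(* There are m rows but n right singular vectors; extension by 0 lets the sum pass from one range to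
   the other. *)
pose G' (a : nat) := if insub a is Some a' then G a' else 0.
have -> : \sum_(a < n) (if (k <= a)%N then (s a.+1 ^+ 2)%:C +
    (s a.+1 ^+ 2 * tau ^+ (4 * q))%:C *
    nrm2 (((col a V) ^t* *m W) *m O ^t* *m pinvd (gramm O)) else 0) =
    \sum_(a < n) G' a.
  apply: eq_bigr => a _; rewrite /G' valK /G; case: ifP => // _.
  by rewrite nrm2E; congr (_ + _ * _); apply: eq_bigr => b _; rewrite T_row.
rewrite -(@sum_ord_cut _ G' m n); last first.
  move=> a mna; rewrite /G'; case: insubP => // a' _ aE.
  by rewrite /G aE s0 ?ltnS// expr0n/= mul0r rmorph0 mul0r addr0 if_same.
apply: ler_sum => a _; rewrite /G'; case: insubP => [a' an aE|].
  rewrite /G aE; case: leqP => [ka|ak]; last first.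
    by rewrite big1// => b _; rewrite E_top// normr0 expr0n.
  apply: le_trans (ler_sum _ (fun b _ => E_low b an ka)) _.
  rewrite big_split/= -mulr_sumr.
  rewrite (_ : Ordinal an = a'); last by apply/val_inj; rewrite /= aE.
  rewrite (bigD1 a')//= aE eqxx big1 ?addr0; last first.
    move=> b ba; rewrite ifN//; apply: contra ba => /eqP ab.
    by apply/eqP/val_inj; rewrite /= aE ab.
  rewrite lerD2l le_eqVlt; apply/orP; left; apply/eqP; congr (_ * _).
  pose h (b : nat) := if insub b is Some b' then `|T a' b'| ^+ 2 else 0.
  rewrite -[LHS]/(\sum_(b < n) h b) (@sum_ord_cut _ h n k).
    by apply: eq_bigr => b _; rewrite /h valK.
  move=> b; rewrite (minn_idPr kn) => kb.
  by rewrite /h insubF// ltnNge kb.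
rewrite -leqNgt => na; rewrite big1// => b _.
by rewrite E_bottom// normr0 expr0n.
Qed.

End slice.

End frobenius.

(** * Fourier slices *)

Section fourier.
Context {R : realType}.
Local Notation C := R[i].

Section root.
Variable n : nat.
Hypothesis n0 : (0 < n)%N.
Local Notation om := (dft_root R n).

Lemma dft_rootX d :
  om ^+ d = cos (2 * pi / n%:R * d%:R) -i* sin (2 * pi / n%:R * d%:R).
Proof.
elim: d => [|d IH]; first by rewrite expr0 mulr0 cos0 sin0 oppr0.
rewrite exprS IH /dft_root; move: (2 * pi / n%:R) => x.
rewrite (_ : x * d.+1%:R = x * d%:R + x) ?cosD ?sinD; last by rewrite -natr1 mulrDr mulr1.
apply/eqP; rewrite eq_complex /=; apply/andP; split; apply/eqP; ring.
Qed.

Lemma dft_root_expn : om ^+ n = 1.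
Proof.
have nr0 : n%:R != 0 :> R by rewrite pnatr_eq0 -lt0n.
by rewrite dft_rootX mulfVK// mulr_natl cos2pi sin2pi oppr0.
Qed.

(** Otherwise cos (2 x) = 1 for x = pi d / n strictly between 0 and pi, which forces sin x = 0. *)
Lemma dft_root_neq1 d : (0 < d < n)%N -> om ^+ d != 1.
Proof.
move=> /andP[d0 dn]; rewrite dft_rootX eq_complex/=; apply/negP => /andP[/eqP h _].
pose x : R := pi * (d%:R / n%:R).
have nr0 : 0 < n%:R :> R by rewrite ltr0n.
have x0 : 0 < x by rewrite mulr_gt0 ?pi_gt0// divr_gt0// ltr0n.
have xpi : x < pi by rewrite gtr_pMr ?pi_gt0// ltr_pdivrMr// mul1r ltr_nat.
have : 0 < sin x by apply: sin_gt0_pi; rewrite x0 xpi.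
have E : 2 * pi / n%:R * d%:R = x *+ 2.
  by rewrite /x -mulr_natr; field; rewrite gt_eqF.
move: h; rewrite E cos_mulr2n => h.
have : sin x ^+ 2 = 0 by rewrite sin2cos2; lra.
by move/eqP; rewrite sqrf_eq0 => /eqP->; rewrite ltxx.
Qed.

Lemma dft_root_neq0 : om != 0.
Proof.
apply/eqP => h; have := dft_root_expn.
by rewrite h expr0n gtn_eqF// => /eqP; rewrite eq_sym oner_eq0.
Qed.

Lemma dft_root_conj : om^* = om^-1.
Proof.
apply: (mulfI dft_root_neq0); rewrite divff ?dft_root_neq0//.
rewrite /dft_root; have := cos2Dsin2 (2 * pi / n%:R : R); move: (2 * pi / n%:R) => x cs.
by apply/eqP; rewrite eq_complex/=; apply/andP; split; apply/eqP; [rewrite -cs|]; ring.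
Qed.

Lemma dft_rootX_conj d : (om ^+ d)^* = om ^- d.
Proof. by rewrite -exprVn -dft_root_conj; exact: rmorphXn. Qed.

Lemma dft_root_mod d e : om ^+ (d * (e %% n)) = om ^+ (d * e).
Proof.
rewrite [in RHS](divn_eq e n) mulnDr exprD mulnCA mulnA [(_ * n)%N]mulnC.
by rewrite [X in _ = X * _]exprM dft_root_expn expr1n mul1r.
Qed.

(** A geometric sum whose ratio is an n-th root of unity, different from 1 unless t = s. *)
Lemma dft_root_sum (t s : 'I_n) :
  \sum_(i < n) om ^+ (i * t) * om ^- (i * s) = n%:R *+ (t == s).
Proof.
pose z := om ^+ t / om ^+ s.
have -> : \sum_(i < n) om ^+ (i * t) * om ^- (i * s) = \sum_(i < n) z ^+ i.
  by apply: eq_bigr => i _; rewrite /z expr_div_n -!exprM ![(_ * i)%N]mulnC.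
have us : om ^+ s != 0 by rewrite expf_neq0// dft_root_neq0.
have ut : om ^+ t != 0 by rewrite expf_neq0// dft_root_neq0.
have [ts|ts] := eqVneq t s.
  rewrite /z ts divff// (eq_bigr (fun=> 1)) => [|i _]; last by rewrite expr1n.
  by rewrite sumr_const card_ord mulr1n.
have z1 : z != 1.
  apply/negP => /eqP E; have {}E : om ^+ t = om ^+ s.
    by rewrite -[LHS](mulfVK us) -/z E mul1r.
  have [lt|gt|e] := ltngtP t s; last by rewrite (val_inj e) eqxx in ts.
  - have h : (0 < s - t < n)%N by rewrite subn_gt0 lt/= (leq_ltn_trans (leq_subr _ _)).
    case/negP: (dft_root_neq1 h).
    by apply/eqP; apply: (mulfI ut); rewrite -exprD subnKC ?E ?mulr1// ltnW.
  - have h : (0 < t - s < n)%N by rewrite subn_gt0 gt/= (leq_ltn_trans (leq_subr _ _)).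
    case/negP: (dft_root_neq1 h).
    by apply/eqP; apply: (mulfI us); rewrite -exprD subnKC ?E ?mulr1// ltnW.
have zn : z ^+ n = 1.
  by rewrite /z expr_div_n -!exprM ![(_ * n)%N]mulnC !exprM dft_root_expn !expr1n divr1.
apply: (mulfI (_ : z - 1 != 0)); first by rewrite subr_eq0.
by rewrite -subrX1 zn subrr mulr0n mulr0.
Qed.

End root.

Section tensor.
Variables (n1 n2 n3 : nat).
Hypothesis n0 : (0 < n3)%N.
Local Notation om := (dft_root R n3).

Lemma dftB (A B : tensor C n1 n2 n3) i : dft (A - B) i = dft A i - dft B i.
Proof.
rewrite !ffunE -sumrB; apply: eq_bigr => t _.
by rewrite !ffunE scalerBr.
Qed.

Lemma dft_idft (B : tensor C n1 n2 n3) : dft (idft B) = B.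
Proof.
apply/ffunP => i; rewrite ffunE.
under eq_bigr => t _ do rewrite ffunE scalerA scaler_sumr.
rewrite exchange_big/= (eq_bigr (fun j => (j == i)%:R *: B j)) => [|j _].
  rewrite (bigD1 i)//= eqxx scale1r big1 ?addr0// => j /negbTE->.
  by rewrite scale0r.
under eq_bigr => t _ do rewrite scalerA mulrAC.
rewrite -scaler_suml -mulr_suml.
under eq_bigr => t _ do rewrite [(i * t)%N]mulnC [(j * t)%N]mulnC.
rewrite (dft_root_sum n0) eq_sym; case: eqP => _; last by rewrite mulr0n mul0r.
by rewrite mulr1n divff// pnatr_eq0 -lt0n.
Qed.

Lemma frobE (A : tensor C n1 n2 n3) :
  ((frob A) ^+ 2)%:C = \sum_t fro2 (A t).
Proof.
rewrite /frob sqr_sqrtr; last by do 3! (apply: sumr_ge0 => ? _); exact: sqr_ge0.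
rewrite rmorph_sum; apply: eq_bigr => t _; rewrite fro2E rmorph_sum; apply: eq_bigr => a _.
by rewrite rmorph_sum; apply: eq_bigr => b _; rewrite rmorphXn.
Qed.

(** Both factors are expanded; summing over the frequency first leaves the terms with t = s. The
    factor n3 reflects the unnormalised transform. *)
Lemma dft_parseval (A : tensor C n1 n2 n3) :
  \sum_i fro2 (dft A i) = n3%:R * \sum_t fro2 (A t).
Proof.
have E (i : 'I_n3) : fro2 (dft A i) =
    \sum_(t < n3) \sum_(s < n3) om ^+ (i * t) * om ^- (i * s) *
    \tr (A t *m (A s) ^t*).
  rewrite /fro2 ffunE mulmx_suml raddf_sum; apply: eq_bigr => t _.
  rewrite [X in _ *m X](_ : _ = \sum_(s < n3) om ^- (i * s) *: (A s) ^t*).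
    rewrite mulmx_sumr raddf_sum; apply: eq_bigr => s _.
    rewrite -scalemxAl -scalemxAr scalerA /=; exact: mxtraceZ.
  rewrite (big_morph (fun M : 'M[C]_(n1, n2) => M ^t*) (@trmxCD _ _ _) (_ : 0 ^t* = 0)); last first.
    by rewrite trmx0 map_mx0.
  apply: eq_bigr => s _.
  by rewrite trmxCZ dft_rootX_conj.
rewrite (eq_bigr _ (fun i _ => E i)) exchange_big mulr_sumr; apply: eq_bigr => t _.
rewrite exchange_big/= (eq_bigr (fun s => n3%:R *+ (t == s) * \tr (A t *m (A s) ^t*))).
  rewrite (bigD1 t)//= eqxx mulr1n big1 ?addr0// => s; rewrite eq_sym => /negbTE->.
  by rewrite mulr0n mul0r.
by move=> s _; rewrite -mulr_suml (dft_root_sum n0).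
Qed.

End tensor.

Lemma dft_ttr n1 n2 n3 (A : tensor C n1 n2 n3) i :
  (0 < n3)%N -> dft (ttr A) i = (dft A i) ^t*.
Proof. by move=> n0; rewrite /ttr dft_idft// ffunE. Qed.

(** For given r and s exactly one t is r + s modulo n3, and the powers of the root do not see this
    reduction. *)
Lemma dft_tprod n1 n2 n3 n4 (A : tensor C n1 n2 n3) (B : tensor C n2 n4 n3) i :
  (0 < n3)%N -> dft (tprod A B) i = dft A i *m dft B i.
Proof.
move=> n0; apply/matrixP => a b.
rewrite !ffunE summxE [RHS]mxE.
under eq_bigr => t _ do rewrite ffunE mxE mxE mulr_sumr.
rewrite exchange_big; apply: eq_bigr => l _.
rewrite !summxE mulr_suml.
under eq_bigr => t _ do rewrite /circ_conv /tube mulr_sumr.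
rewrite exchange_big; apply: eq_bigr => r _.
rewrite mulr_sumr.
under eq_bigr => t _ do rewrite mulr_sumr big_mkcond.
rewrite exchange_big; apply: eq_bigr => s _.
pose u : 'I_n3 := Ordinal (ltn_pmod (r + s) n0).
rewrite -big_mkcond (big_pred1 u) => [|t]; last first.
  by rewrite /= -val_eqE eq_sym.
rewrite !mxE /= dft_root_mod// mulnDr exprD.
by rewrite mulrACA.
Qed.

End fourier.

(** * The good event *)

Section average.
Context {R : realType}.
Local Notation C := R[i].
Local Notation vect I := (vect R I).
Variables (n k p : nat) (J : finType) (V : J -> 'M[C]_(n, k)).
Hypotheses (VV : forall j, (V j) ^t* *m V j = 1%:M) (k1 : (1 <= k)%N).
Variables (d0 : measure_display) (T : measurableType d0) (P : probability T R).
Variables (F : T -> vect ('I_n * 'I_(k + p))%type).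
Hypothesis gF : gauss_map P F.

Let singular : set T :=
  \big[setU/set0]_(j in J) [set x | \det (gramm (Ov (V j) (F x))) == 0].

Let singular_null : measurable singular /\ P singular = 0%E.
Proof.
rewrite /singular; elim/big_ind: _ => [|A B [mA A0] [mB B0]|j _].
- by split; [exact: measurable0|exact: measure0].
- by split; [exact: measurableU|rewrite measureU0].
- split; last exact: gramm_singular_null (VV j) (leq_addr _ _) _ _ _ _ gF.
  have mF : measurable_fun setT F by case: gF.
  rewrite (_ : [set x | _] = [set: T] `&`
      (fun x => \det (gramm (Ov (V j) (F x))) == 0) @^-1` [set true]).
    exact: (measurable_det0 (V j) mF).
  by rewrite setTI; apply/seteqP; split=> x /=; case: (_ == _).
Qed.

Let nonsingular x : ~ singular x -> forall j, \det (gramm (Ov (V j) (F x))) != 0.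
Proof.
move=> xN j; apply/negP => xj; apply: xN; rewrite /singular -bigcup_seq.
by exists j => //=; rewrite mem_index_enum.
Qed.

Variable delta : R.
Hypothesis d01 : 0 < delta < 1.

Lemma nonsingular_prob : prob_ge P (1 - delta)
  [set x | forall j, \det (gramm (Ov (V j) (F x))) != 0].
Proof.
have [mS S0] := singular_null; exists (~` singular); split.
- exact: measurableC.
- exact: nonsingular.
- rewrite probability_setC// S0 sube0 lee_fin; have /andP[d0' _] := d01; lra.
Qed.

Variables (v : J -> 'cV[C]_n) (a : J -> R).
Hypotheses (vv : forall j, (v j) ^t* *m v j = 1%:M)
  (Vv : forall j, (V j) ^t* *m v j = 0).
Hypotheses (n1 : (1 < n)%N) (p2 : (2 <= p)%N) (a0 : forall j, 0 <= a j).

Lemma average_prob : prob_ge P (1 - delta)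
  [set x | (forall j, \det (gramm (Ov (V j) (F x))) != 0) /\
    \sum_j a j * (1 + Xf (V j) (v j) (F x)) <=
    C_delta n k p delta ^+ 2 * \sum_j a j].
Proof.
have sa : 0 <= \sum_j a j by rewrite sumr_ge0.
(* Markov's inequality divides by the total weight; if that is 0, only regularity has to be
   ensured. *)
have [sa0|sa_neq0] := eqVneq (\sum_j a j) 0.
  have [E [mE ES PE]] := nonsingular_prob; exists E; split=> // x Ex /=.
  split; first exact: ES.
  rewrite sa0 mulr0 big1// => j _.
  by rewrite (_ : a j = 0) ?mul0r//; exact: (psumr_eq0P (fun j _ => a0 j) sa0).
have sa_gt0 : 0 < \sum_j a j by rewrite lt_def sa_neq0.
have [x00 Hb] := @bad_prob_bound R n k p delta _ k1 p2 d01 erefl.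
have dE : (k + p + 1 = k + p.+1)%N by rewrite addn1 addnS.
have m2 : (2 < p.+1)%N by [].
have Pb := @bad_prob R n k (k + p) p.+1 J V v a VV vv Vv n1 dE m2 a0 sa_gt0
  d0 T P F gF _ x00.
set B := bad _ _ _ _ _ in Pb.
have mB : measurable B by exact: (measurable_bad V v a gF).
have [mS S0] := singular_null.
exists (~` (B `|` singular)); split.
- by apply: measurableC; exact: measurableU.
- move=> x /= /not_orP[xB xS]; have xD := nonsingular xS; split=> //.
  by rewrite leNgt; apply/negP => h; apply: xB; split.
- rewrite probability_setC ?measureU0//; last exact: measurableU.
  rewrite EFinB; apply: leeB => //; apply: le_trans Pb _.
  by rewrite lee_fin.
Qed.

End average.

(** * Assembling the slices *)

Section assembly.
Context {R : realType}.
Local Notation C := R[i].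
Local Notation vect I := (vect R I).

(** Only the first frontal slice is nonzero, and it enters every Fourier slice with coefficient 1;
    one real gaussian matrix serves all slices. *)
Lemma gaussian_tensor_map (d : measure_display) (T : measurableType d)
    (P : probability T R) n1 n2 n3 (W : T -> tensor R n1 n2 n3) :
  (0 < n3)%N -> gaussian_tensor P W ->
  exists F : T -> vect ('I_n1 * 'I_n2)%type,
    gauss_map P F /\ forall w i, dft (tensorC (W w)) i = Wm (F w).
Proof.
move=> n0 [g [gi gn gW]]; exists (fun w ab => g ab w); split; first split.
- by apply: measurable_vect => ab; exact: measurable_funPT.
- move=> B mB; have := gi finset.setT B (fun i _ => mB i).
  rewrite (_ : [set w | _] = (fun w ab => g ab w) @^-1` rect B); last first.
    by apply/seteqP; split=> w /= h i; [apply: h; rewrite finset.in_setT|move=> _; exact: h].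
  move=> ->; rewrite (eq_bigl xpredT) => [|i]; last by rewrite finset.in_setT.
  by apply: eq_bigr => i _; exact: gn (mB i).
- move=> w i; rewrite ffunE (bigD1 (Ordinal n0))//= big1 ?addr0 => [|t t0].
    rewrite muln0 expr0 scale1r ffunE; apply/matrixP => a b.
    by rewrite [LHS]mxE gW/= [RHS]mxE.
  rewrite ffunE (_ : map_mx _ _ = 0) ?scaler0//; apply/matrixP => a b.
  rewrite [LHS]mxE gW [RHS]mxE ifN ?rmorph0//.
Qed.

Lemma frob_error n1 n2 n3 l (A : tensor C n1 n2 n3) (Qh : tensor C n1 l n3) :
  (0 < n3)%N ->
  ((frob (A - tprod (tprod (idft Qh) (ttr (idft Qh))) A)) ^+ 2)%:C =
  n3%:R^-1 * \sum_i fro2 (dft A i - Qh i *m (Qh i) ^t* *m dft A i).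
Proof.
move=> n0; set E := _ - _.
have -> : \sum_i fro2 (dft A i - Qh i *m (Qh i) ^t* *m dft A i) =
    \sum_i fro2 (dft E i).
  apply: eq_bigr => i _; rewrite /E dftB (dft_tprod _ _ _ n0) (dft_tprod _ _ _ n0).
  by rewrite (dft_ttr _ _ n0) (dft_idft n0).
have nz : (n3%:R : C) != 0 by rewrite pnatr_eq0 -lt0n.
by rewrite (dft_parseval n0) mulrA (mulVf nz) mul1r -frobE.
Qed.

Lemma pid_mx_pad n1 c l (Q : 'M[C]_(n1, c)) : (c <= l)%N ->
  (Q *m pid_mx c) *m (Q *m (pid_mx c : 'M[C]_(c, l))) ^t* = Q *m Q ^t*.
Proof.
move=> cl; rewrite trmxC_mul tr_pid_mx map_pid_mx mulmxA -[_ *m pid_mx c *m _]mulmxA.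
by rewrite pid_mx_id// pid_mx_1 mulmx1.
Qed.

(** Singular values are numbered from 1 and matrix indices from 0, so j = a + 1. *)
Lemma tail_sum (G : nat -> R) m n k : (k <= minn m n)%N ->
  (forall j, (minn m n < j)%N -> G j = 0) ->
  \sum_(k.+1 <= j < (minn m n).+1) G j =
  \sum_(a < n) (if (k <= a)%N then G a.+1 else 0).
Proof.
move=> kmn G0; rewrite big_add1 /= (big_nat_widenl k 0)// big_mkcond /=.
rewrite big_mkord; apply: (@sum_ord_cut _ (fun a => if (k <= a)%N then G a.+1 else 0)).
move=> a; rewrite (minn_idPl (geq_minr m n)) => h.
by rewrite G0 ?if_same.
Qed.

Lemma unitary_cols n k (kn : (k <= n)%N) (V : 'M[C]_n) :
  V \is unitarymx ->
  let Vk : 'M[C]_(n, k) := \matrix_(i, j) V i (widen_ord kn j) in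
  [/\ Vk ^t* *m Vk = 1%:M,
      forall a, (col a V) ^t* *m col a V = 1%:M
    & forall a : 'I_n, (k <= a)%N -> Vk ^t* *m col a V = 0].
Proof.
move=> VU Vk; have VV (a b : 'I_n) : \sum_e (V e a)^* * V e b = (a == b)%:R.
  have := unitary_mulC VU => /matrixP/(_ a b); rewrite !mxE => <-.
  by apply: eq_bigr => e _; rewrite !mxE.
split=> [|a|a ka]; apply/matrixP => i j; rewrite [LHS]mxE [RHS]mxE.
- rewrite -[RHS](VV (widen_ord kn i) (widen_ord kn j)).
  by apply: eq_bigr => e _; rewrite !mxE.
- rewrite (ord1 i) (ord1 j) eqxx; transitivity ((a == a)%:R : C); last by rewrite eqxx.
  by rewrite -VV; apply: eq_bigr => e _; rewrite !mxE.
- transitivity ((widen_ord kn i == a)%:R : C).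
    by rewrite -VV; apply: eq_bigr => e _; rewrite !mxE.
  rewrite (_ : _ == _ = false)//; apply/negP => /eqP ia.
  by have := ltn_ord i; rewrite ltnNge; move: ka; rewrite -ia /= => ->.
Qed.

End assembly.

Definition lead_cols (R : rcfType) n k (kn : (k <= n)%N) (V : 'M[R[i]]_n) : 'M[R[i]]_(n, k) :=
  \matrix_(i, j) V i (widen_ord kn j).

Lemma slice_error (R : realType) m n l k q c (s : nat -> R) (U : 'M[R[i]]_m)
    (V : 'M[R[i]]_n) (f : 'I_n * 'I_l -> R) (Q : 'M[R[i]]_(m, c)) (kn : (k <= n)%N) X :
  X = U *m dgm m n (fun a => (s a.+1)%:C) *m V ^t* ->
  U \is unitarymx -> V \is unitarymx ->
  (forall j, (0 < j)%N -> 0 <= s j.+1 <= s j) ->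
  (forall j, (minn m n < j)%N -> s j = 0) -> 0 < s k ->
  subspace_iter X (Wm f) q Q ->
  \det (gramm (Ov (lead_cols kn V) f)) != 0 ->
  fro2 (X - Q *m Q ^t* *m X) <=
  (\sum_(a < n) (if (k <= a)%N then s a.+1 ^+ 2 +
     s a.+1 ^+ 2 * (s k.+1 / s k) ^+ (4 * q) * Xf (lead_cols kn V) (col a V) f
   else 0))%:C.
Proof.
move=> -> UU VU s_mono s0 sk XQ O0.
apply: le_trans (slice_bound UU VU s_mono s0 sk XQ O0) _.
rewrite le_eqVlt; apply/orP; left; apply/eqP.
rewrite rmorph_sum; apply: eq_bigr => a _; case: ifP => _; last by rewrite rmorph0.
rewrite [RHS]rmorphD; congr (_ + _); rewrite [RHS]rmorphM; congr (_ * _).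
by apply: ge0_ReE; exact: nrm2_ge0.
Qed.

Local Close Scope complex_scope.
Local Close Scope sesquilinear_scope.

Theorem theorem6 (R : realType) (d : measure_display) (T : measurableType d)
    (P : probability T R)
    (n1 n2 n3 k p : nat) (hk : (1 <= k)%N) (hp : (2 <= p)%N)
    (A : tensor R n1 n2 n3) (q : 'I_n3 -> nat)
    (W : T -> tensor R n2 (k + p) n3) (hW : gaussian_tensor P W)
    (sigma : 'I_n3 -> nat -> R)
    (hsigma : forall i, singular_values (dft (tensorC A) i) (sigma i))
    (hsigma_k : forall i, 0 < sigma i k)
    (tau := fun i : 'I_n3 => sigma i k.+1 / sigma i k)
    (htau : forall i, tau i < 1)
    (Q : T -> tensor R[i] n1 (k + p) n3)
    (hQ : forall w, slicewise_rsi A (W w) q (Q w))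
    (delta : R) (hdelta : 0 < delta < 1) :
  prob_ge P (1 - delta)
    [set w | frob (tensorC A - tprod (tprod (Q w) (ttr (Q w))) (tensorC A)) ^+ 2
             <= n3%:R^-1 *
                \sum_(i < n3)
                  (1 + C_delta n2 k p delta ^+ 2 * tau i ^+ (4 * q i)) *
                  (\sum_(k.+1 <= j < (minn n1 n2).+1) sigma i j ^+ 2)].
Proof.
Local Open Scope complex_scope.
Local Open Scope sesquilinear_scope.
Local Open Scope ring_scope.
have [n30|n3_gt0] := posnP n3.
  subst n3; exists setT; split=> //; last first.
    rewrite probability_setT lee_fin; have /andP[d0 _] := hdelta; lra.
  by move=> w _ /=; rewrite /frob !big_ord0 sqrtr0 expr0n mulr0.
have [F [gF FE]] := gaussian_tensor_map n3_gt0 hW.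
set x0 := C_delta n2 k p delta ^+ 2.
pose i0 := Ordinal n3_gt0.
have s0 i j : (minn n1 n2 < j)%N -> sigma i j = 0.
  by case: (hsigma i) => _ + _; apply.
have s_mono i j : (0 < j)%N -> 0 <= sigma i j.+1 <= sigma i j.
  by case: (hsigma i) => + _ _; apply.
(* Beyond min (n1, n2) the singular values are 0, whereas sigma_k > 0. *)
have kmn : (k <= minn n1 n2)%N.
  by rewrite leqNgt; apply/negP => /(s0 i0) h; have := hsigma_k i0; rewrite h ltxx.
have kn : (k <= n2)%N by apply: leq_trans kmn (geq_minr _ _).
have /choice [UV UVP] : forall i, exists UV : 'M[R[i]]_n1 * 'M[R[i]]_n2,
    [/\ UV.1 \is unitarymx, UV.2 \is unitarymx & dft (tensorC A) i =
     UV.1 *m dgm n1 n2 (fun a => (sigma i a.+1)%:C) *m UV.2 ^t*].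
  by move=> i; case: (hsigma i) => _ _ [U [V UV]]; exists (U, V).
pose V i := (UV i).2; pose Vk i := lead_cols kn (V i).
have VU i : V i \is unitarymx by case: (UVP i).
have tau0 i : 0 <= tau i ^+ (4 * q i).
  by rewrite exprn_ge0// divr_ge0 ?(ltW (hsigma_k i))//; have /andP[] := s_mono i k hk.
pose b i (a : 'I_n2) : R := if (k <= a)%N then sigma i a.+1 ^+ 2 else 0.
(* The coefficient of |xi_a|^2 in the error of slice i. Slices and singular vectors are averaged
   jointly with these weights. *)
pose wt i a := b i a * tau i ^+ (4 * q i).
have wt0 i a : 0 <= wt i a.
  by rewrite mulr_ge0 ?tau0// /b; case: ifP => // _; rewrite sqr_ge0.
have err w : (forall i, \det (gramm (Ov (Vk i) (F w))) != 0) ->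
    frob (tensorC A - tprod (tprod (Q w) (ttr (Q w))) (tensorC A)) ^+ 2 <=
    n3%:R^-1 * \sum_i \sum_a (b i a + wt i a * Xf (Vk i) (col a (V i)) (F w)).
  move=> nonsing; have [Qh [QhP ->]] := hQ w.
  rewrite -lecR (frob_error _ _ n3_gt0) rmorphM fmorphV rmorph_nat.
  apply: ler_wpM2l; first by rewrite invr_ge0 ler0n.
  rewrite rmorph_sum; apply: ler_sum => i _.
  have [c [Qi [Qi_iter ->]]] := QhP i; rewrite FE in Qi_iter.
  have [_ cl _] := subspace_iter_range Qi_iter; rewrite pid_mx_pad//.
  have [UU VV XE] := UVP i.
  have := slice_error XE UU VV (s_mono i) (s0 i) (hsigma_k i) Qi_iter (nonsing i).
  move/le_trans; apply; rewrite le_eqVlt; apply/orP; left; apply/eqP.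
  congr (_%:C); apply: eq_bigr => a _; rewrite /wt /b.
  by case: ifP => // _; rewrite !mul0r addr0.
have tailE i : \sum_(k.+1 <= j < (minn n1 n2).+1) sigma i j ^+ 2 = \sum_a b i a.
  by apply: (tail_sum kmn) => j /(s0 i) ->; rewrite expr0n.
have final w : (forall i, \det (gramm (Ov (Vk i) (F w))) != 0) ->
    \sum_i \sum_a wt i a * Xf (Vk i) (col a (V i)) (F w) <=
    x0 * \sum_i \sum_a wt i a ->
    frob (tensorC A - tprod (tprod (Q w) (ttr (Q w))) (tensorC A)) ^+ 2 <=
    n3%:R^-1 * \sum_(i < n3) (1 + x0 * tau i ^+ (4 * q i)) *
                  (\sum_(k.+1 <= j < (minn n1 n2).+1) sigma i j ^+ 2).
  move=> nonsing h; apply: le_trans (err w nonsing) _.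
  apply: ler_wpM2l; first by rewrite invr_ge0 ler0n.
  under eq_bigr => i _ do rewrite big_split.
  under [X in _ <= X]eq_bigr => i _ do rewrite tailE mulrDl mul1r.
  rewrite !big_split /= lerD2l; apply: le_trans h _.
  rewrite mulr_sumr le_eqVlt; apply/orP; left; apply/eqP.
  apply: eq_bigr => i _; rewrite -mulr_suml -mulrA; congr (_ * _); exact: mulrC.
(* For n2 <= k there is no tail and all weights vanish. Otherwise n2 > k >= 1 yields the condition
   n2 > 1 required for a fresh column. *)
have [n2k|kn2] := leqP n2 k.
  have VkP (i : 'I_n3) : (Vk i) ^t* *m Vk i = 1%:M.
    by have [] := unitary_cols kn (VU i).
  have [E [mE ES PE]] := nonsingular_prob VkP gF hdelta.
  exists E; split=> // w /ES /= nonsing; apply: final => //.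
  have z i a : wt i a = 0.
    by rewrite /wt /b leqNgt (leq_trans (ltn_ord a) n2k) mul0r.
  rewrite big1 => [|i _]; last by rewrite big1// => a _; rewrite z mul0r.
  by rewrite [X in _ * X]big1 ?mulr0// => i _; rewrite big1.
pose V' (j : 'I_n3 * 'I_n2) := Vk j.1.
(* [average_prob] requires a vector orthogonal to the leading ones at every index. For a < k, where
   the weight is 0, the column with index k stands in. *)
pose col_or (a : 'I_n2) : 'I_n2 := if (k <= a)%N then a else Ordinal kn2.
have col_orP a : (k <= col_or a)%N by rewrite /col_or; case: ifP.
pose v (j : 'I_n3 * 'I_n2) := col (col_or j.2) (V j.1).
pose a' (j : 'I_n3 * 'I_n2) := wt j.1 j.2.
have V'P j : (V' j) ^t* *m V' j = 1%:M by have [] := unitary_cols kn (VU j.1).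
have vP j : (v j) ^t* *m v j = 1%:M by have [_ ->] := unitary_cols kn (VU j.1).
have V'v j : (V' j) ^t* *m v j = 0.
  by have [_ _] := unitary_cols kn (VU j.1); apply.
have n21 : (1 < n2)%N := leq_ltn_trans hk kn2.
have [E [mE ES PE]] := average_prob V'P hk gF hdelta vP V'v n21 hp
  (fun j => wt0 j.1 j.2).
exists E; split=> // w /ES /= [nonsing avg]; apply: final => [i|].
  exact: (nonsing (i, Ordinal kn2)).
(* The event controls the average of 1 + |xi_a|^2, which dominates that of |xi_a|^2. *)
rewrite !pair_big /=; apply: le_trans avg; apply: ler_sum => -[i a] _ /=.
rewrite /wt /b /v /V' /col_or; case: ifP => ka /=; last by rewrite !mul0r.
by rewrite ler_wpM2l ?lerDr// mulr_ge0 ?sqr_ge0.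
Qed.
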